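(* Let $(X_{i,j})_{i,j\ge1}$ be independent identically distributed real random variables with $\mathbb{E}[X_{i,j}]=0$ and $\mathrm{Var}[X_{i,j}]=\sigma^2\in(0,+\infty)$. For $m,n\in\mathbb{N}$ put $\mathbf X=[X_{i,j}]_{1\le i\le n,1\le j\le m}$ and $\mathbf M(m,n)=m^{-1}\mathbf X\mathbf X^T$. Let $m=m(n)$ be such that $\lim_{n\to\infty}\frac{n}{m(n)}=\lambda\in(0,\infty)$, and put $\lambda^*=\max(1-\lambda^{-1},0)$. Define $$a_{k:n}:=[x^k]\frac{\det(\mathbf M(m,n)+x\mathbf{Id}_n)}{\det(\mathbf M(m,n)+\mathbf{Id}_n)},\qquad k\in\{0,1,\ldots,n\}.$$ Then, for all sufficiently small $\varepsilon>0$, with probability one, $$\sup_{(\lambda^*+\varepsilon)n\le k\le(1-\varepsilon)n}\left|\frac1n\log a_{k:n}-g_{\mathbf M}\left(\frac kn\right)\right|\xrightarrow[n\to\infty]{}0,$$ as well as $$\sup_{0\le k\le(\lambda^*-\varepsilon)n}\frac1n\log a_{k:n}\xrightarrow[n\to\infty]{}-\infty.$$ Here $g_{\mathbf M}:(\lambda^*,1)\to(-\infty,0]$ is a strictly concave infinitely differentiable function satisfying $$e^{-g_{\mathbf M}'(\alpha)}=\frac{\sigma^2\alpha(\lambda\alpha+1-\lambda)}{1-\alpha},\qquad\lambda^*<\alpha<1,$$ and defined by $$g_{\mathbf M}(\alpha)=-2\alpha\log\sigma+\left(-\alpha+1-\frac1\lambda\right)\log(\lambda\alpha+1-\lambda)+\alpha-\alpha\log\alpha-(1-\alpha)\log(1-\alpha)+C,$$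 where $$C=\frac1\lambda\log(1-\alpha^* )-\frac1\lambda\log\alpha^*+\log\alpha^*-\alpha^*-2\left(\frac1\lambda-1\right)\log\sigma$$ and $\alpha^*$ is the unique solution in $(\lambda^*,1)$ of the equation $$\frac{1-\alpha^*}{\alpha^*(\lambda\alpha^*+1-\lambda)}=\sigma^2.$$
   Context: $[x^k]p(x)$ denotes the coefficient of $x^k$ in the polynomial $p$, $\mathbf{Id}_n$ is the $n\times n$ identity matrix, and $\sigma>0$ is the square root of $\sigma^2$. Conventions: $\log0=-\infty$, and a supremum over an empty set of indices is $-\infty$ (relevant to the second relation if $\lambda^*=0$). *)

(* Defs.v *)
From HB Require Import structures.
From mathcomp Require Import all_boot all_order all_algebra.
From mathcomp Require Import finmap.
From mathcomp Require Import all_classical all_reals all_analysis.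

Set Implicit Arguments.
Unset Strict Implicit.
Unset Printing Implicit Defensive.

Import Order.TTheory GRing.Theory Num.Theory.
Import numFieldNormedType.Exports.

Local Open Scope classical_set_scope.
Local Open Scope ring_scope.

Definition independent_RVs (d : measure_display) (T : measurableType d)
    (R : realType) (P : probability T R) (I : choiceType)
    (X : I -> {RV P >-> R}) : Prop :=
  forall (J : {fset I}) (B : I -> set R),
    (forall j, j \in J -> measurable (B j)) ->
    P (\bigcap_(j in [set` J]) (X j @^-1` B j)) =
    (\prod_(j <- J) P (X j @^-1` B j))%E.

(* The laws are compared on Borel sets only: [distribution P Y] is a function
   on all of [set R], whose values on other sets carry no meaning. *)
Definition identically_distributed (d : measure_display)
    (T : measurableType d) (R : realType) (P : probability T R) (I : Type)
    (X : I -> {RV P >-> R}) : Prop :=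
  forall (i j : I) (B : set R), measurable B ->
    distribution P (X i) B = distribution P (X j) B.

Arguments independent_RVs {d T R} P {I} X.
Arguments identically_distributed {d T R} P {I} X.

Section sample_covariance.
Context (R : realType).

(* Rows and columns are numbered from 0: the entry X_{i,j} with i, j >= 1 of
   the infinite array is [x (i.-1, j.-1)]. *)
Definition data_mx (x : nat * nat -> R) (n m : nat) : 'M[R]_(n, m) :=
  \matrix_(i < n, j < m) x (nat_of_ord i, nat_of_ord j).

Definition cov_mx (x : nat * nat -> R) (m n : nat) : 'M[R]_n :=
  m%:R^-1 *: (data_mx x n m *m (data_mx x n m)^T).

Definition det_shift (n : nat) (M : 'M[R]_n) : {poly R} :=
  \det (map_mx polyC M + 'X%:M).

Definition det_coef (n : nat) (M : 'M[R]_n) (k : nat) : R :=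
  ((\det (M + 1%:M))^-1 *: det_shift M)`_k.

End sample_covariance.

Section profile.
Context (R : realType).
Implicit Types (sigma lambda a : R).

Definition lambda_star lambda : R := Num.max (1 - lambda^-1) 0.

Definition is_alpha_star sigma lambda a : Prop :=
  lambda_star lambda < a < 1 /\
  (1 - a) / (a * (lambda * a + 1 - lambda)) = sigma ^+ 2.

Definition g_const sigma lambda (astar : R) : R :=
  lambda^-1 * ln (1 - astar) - lambda^-1 * ln astar + ln astar - astar
  - 2 * (lambda^-1 - 1) * ln sigma.

Definition g_M sigma lambda (astar a : R) : R :=
  - 2 * a * ln sigma
  + (- a + 1 - lambda^-1) * ln (lambda * a + 1 - lambda)
  + a - a * ln a - (1 - a) * ln (1 - a) + g_const sigma lambda astar.

Definition strictly_concave_on (l u : R) (f : R -> R) : Prop :=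
  forall x y t : R, l < x < u -> l < y < u -> x != y -> 0 < t < 1 ->
    t * f x + (1 - t) * f y < f (t * x + (1 - t) * y).

Definition smooth_on (l u : R) (f : R -> R) : Prop :=
  forall (p : nat) (x : R), l < x < u -> derivable (f^`(p))%classic x 1.

End profile.

(* Main.v *)
Require Import Defs.
From HB Require Import structures.
From mathcomp Require Import all_boot all_order all_algebra.
From mathcomp Require Import complex.
From mathcomp Require Import finmap.
From mathcomp Require Import all_classical all_reals all_analysis.
From mathcomp Require Import measurable_realfun.
From mathcomp Require Import ring lra zify.

(** Let [e l] be the [l]-th elementary symmetric function of the eigenvalues of
    the [m]-by-[m] Gram matrix [m^-1 X^T X] of the first [n] rows.  Since
    [x^m det(M + x) = x^n det(m^-1 X^T X + x)], the quantity [a_k] equals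
    [e (n - k) / (e 0 + ... + e n)] ([det_coefE]).  Only [m] of the [e l] with
    [l > 0] can be nonzero, so [a_k = 0] as soon as [n - k > m]; this is the
    second limit ([det_coef_eq0]).  The first limit amounts to computing
    [e l] up to factors [exp(o(n))], uniformly in the bulk.

    Add the rows of [X] one at a time.  A new row [r] changes [e l] by
    [m^-1 r B r^T], where [B] is a coefficient of an adjugate built from the
    earlier rows, hence independent of [r] ([ecoefS]).  By the spectral theorem
    [B] is positive semidefinite, its trace is [(m - l + 1) e (l - 1)] and its
    squared Frobenius norm is at most [m (e (l - 1))^2].  The trace identity
    turns the expectation of [e l] into an explicit product [laguerre_coef]
    ([hasE_ecoef]), essentially a coefficient of a Laguerre polynomial.

    Upper bound: Markov's inequality and the Borel-Cantelli lemma give, almost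
    surely and eventually, [e l <= exp(eps n) laguerre_coef] for all [l]
    ([ae_ecoef_le]).

    Lower bound: the same argument is applied to [1 / e l]
    ([inv_ecoef_expectation], [ae_ecoef_ge]).  For this the squares of the
    entries are truncated, which makes the fluctuation of [r B r^T] square
    integrable, and the Gram matrix is shifted by [eta Id], which keeps
    [e (l - 1)] of the order of [e l].  Adding one row then costs at most a
    factor [1 + O(1/m)] with respect to the deterministic recursion, hence a
    bounded factor over [n] rows.

    Removing the shift: the coefficients for [eta] are combinations of those
    for [0] with index at most [l] ([ecoef_shift]); the upper bound makes the
    terms far from [l] negligible when [eta] is small, so some [e l'] with [l']
    slightly below [l] is large ([window]).  Applying this at [l] and slightly
    above [l], log-concavity of [e] bounds [e l] from below ([ecoef_bulk_ge]).

    Finally, the logarithm of [laguerre_coef], divided by [n], follows from a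
    crude form of Stirling's formula: it is [g] plus a constant
    ([log_laguerre_coef]).  As [g] is strictly concave with maximum
    [g astar = 0] and [e] is unimodal, the sum of all [e l] is governed by the
    indices with [n - l] close to [astar n], so dividing by it removes exactly
    that constant ([log_det_sum], [log_det_coef]). *)

Set Implicit Arguments.
Unset Strict Implicit.
Unset Printing Implicit Defensive.

Import Order.TTheory GRing.Theory Num.Theory.
Import numFieldNormedType.Exports.

Local Open Scope classical_set_scope.
Local Open Scope ring_scope.

(** * Determinants of shifted matrices *)

(** Sylvester's determinant identity, with a parameter: both sides are the
    determinant of one block matrix multiplied by a block triangular one. *)
Lemma det_addM_comm (S : comNzRingType) (n m : nat) (t : S)
    (A : 'M[S]_(n, m)) (B : 'M[S]_(m, n)) :
  t ^+ m * \det (t%:M + A *m B) = t ^+ n * \det (t%:M + B *m A).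
Proof.
pose P := block_mx t%:M (- A) B 1%:M.
have e1 : block_mx 1%:M A 0 1%:M *m P = block_mx (t%:M + A *m B) 0 B 1%:M.
  by rewrite mulmx_block !mul1mx !mulmx1 !mul0mx !add0r addNr.
have e2 : P *m block_mx 1%:M A 0 t%:M = block_mx t%:M 0 B (t%:M + B *m A).
  rewrite mulmx_block !mulmx1 !mulmx0 !addr0 mul1mx mul_scalar_mx mul_mx_scalar.
  by rewrite scalerN subrr addrC.
have := congr1 determinant e2; have := congr1 determinant e1.
rewrite !det_mulmx !det_ublock !det_lblock !det1 !mul1r !mulr1 !det_scalar.
by move=> -> <-; rewrite mulrC.
Qed.

(** The matrix determinant lemma, freed from the invertibility of [N]: it
    is Sylvester's identity for [\adj N *m w] and [v], after cancelling the
    determinant of the adjugate.  The case of interest is a matrix of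
    polynomials. *)
Lemma det_rank1 (S : idomainType) (m : nat) (N : 'M[S]_m)
    (w : 'cV[S]_m) (v : 'rV[S]_m) : \det N != 0 ->
  \det (N + w *m v) = \det N + (v *m \adj N *m w) 0 0.
Proof.
move=> N0; set d := \det N.
have e1 : \adj N *m (N + w *m v) = d%:M + (\adj N *m w) *m v.
  by rewrite mulmxDr mul_adj_mx mulmxA.
have e2 : d * \det (\adj N) = d ^+ m.
  by rewrite -det_mulmx mul_mx_adj det_scalar.
have := det_addM_comm d (\adj N *m w) v.
rewrite -e1 det_mulmx expr1 mulrA e2 => /(mulfI _) -> //; last first.
  by rewrite expf_neq0.
by rewrite det_mx11 mxE [_%:M _ _]mxE eqxx mulr1n mulmxA.
Qed.

Section shift.
Context (R : realType).
Implicit Types m n : nat.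

Lemma det_shift_horner n (M : 'M[R]_n) t :
  (det_shift M).[t] = \det (M + t%:M).
Proof.
rewrite /det_shift -horner_evalE -det_map_mx; congr (\det _).
apply/matrixP => i j; rewrite !mxE /= /horner_eval; by rewrite hornerD hornerC hornerMn hornerX.
Qed.

Lemma det_shift_char_poly n (M : 'M[R]_n) : det_shift M = char_poly (- M).
Proof. by rewrite /char_poly /char_poly_mx map_mxN opprK addrC. Qed.

Lemma det_shift_monic n (M : 'M[R]_n) : det_shift M \is monic.
Proof. by rewrite det_shift_char_poly char_poly_monic. Qed.

Lemma size_det_shift n (M : 'M[R]_n) : size (det_shift M) = n.+1.
Proof. by rewrite det_shift_char_poly size_char_poly. Qed.

Lemma det_shift_comm n m (A : 'M[R]_(n, m)) (B : 'M[R]_(m, n)) :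
  'X ^+ m * det_shift (A *m B) = 'X ^+ n * det_shift (B *m A).
Proof.
rewrite /det_shift !map_mxM ![map_mx _ _ *m _ + _]addrC.
exact: det_addM_comm.
Qed.

(** The adjugate of [A + 'X] is a polynomial in ['X] with matrix
    coefficients; these are its coefficients. *)
Definition adj_coef m (A : 'M[R]_m) (k : nat) : 'M[R]_m :=
  \matrix_(i, j) (\adj (map_mx polyC A + 'X%:M) i j)`_k.

Lemma det_shift_rank1 m (A : 'M[R]_m) (c : R) (u : 'rV[R]_m) k :
  (det_shift (A + c *: (u^T *m u)))`_k =
  (det_shift A)`_k + c * (u *m adj_coef A k *m u^T) 0 0.
Proof.
rewrite {1}/det_shift map_mxD map_mxZ map_mxM -addrA [_ + 'X%:M]addrC addrA.
rewrite scalemxAl det_rank1; last first.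
  by rewrite -/(det_shift A) monic_neq0 ?det_shift_monic.
rewrite coefD; congr (_ + _).
rewrite -!scalemxAr mxE coefCM; congr (_ * _).
rewrite !mxE coef_sum; apply: eq_bigr => j _.
rewrite !mxE coefMC; congr (_ * _); rewrite coef_sum.
by apply: eq_bigr => i _; rewrite !mxE coefCM.
Qed.

Lemma adj_coef_sym m (A : 'M[R]_m) k : A^T = A -> (adj_coef A k)^T = adj_coef A k.
Proof.
move=> sA; set N := map_mx polyC A + 'X%:M.
have sN : N^T = N.
  apply/matrixP => i j; rewrite /N !mxE eq_sym.
  by have /matrixP/(_ i j) := sA; rewrite mxE => ->.
apply/matrixP => i j; rewrite [LHS]mxE [LHS]mxE [RHS]mxE; congr (_ `_ k).
by have /matrixP/(_ i j) := trmx_adj N; rewrite sN => <-; rewrite [X in _ = polyseq X]mxE.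
Qed.

End shift.

Local Open Scope sesquilinear_scope.
(** * Spectral description of the adjugate *)

Section spectral.
Context (R : realType).
Implicit Types m n : nat.
Local Notation C := (complex R).
Local Notation toC := (real_complex R).

(** Diagonalization is carried out over the complex numbers, where the
    spectral theorem for normal matrices applies; hermitian symmetry makes the
    eigenvalues real. *)
Lemma real_sym_spectral m (A : 'M[R]_m) : A^T = A ->
  exists (s : 'I_m -> R) (U : 'M[C]_m), U \is unitarymx /\
    map_mx toC A = U^t* *m diag_mx (\row_j toC (s j)) *m U.
Proof.
move=> sA; pose B := map_mx toC A.
have hB : B \is hermsymmx.
  apply/is_hermitianmxP; rewrite expr0 scale1r.
  apply/matrixP => i j; rewrite !mxE.
  have /matrixP/(_ i j) := sA; rewrite mxE => ->.
  by apply/esym/CrealP; rewrite complex_real.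
have /orthomx_spectralP := hermitian_normalmx hB.
have /mxOverP rd := hermitian_spectral_diag_real hB.
set U := spectralmx B => BE.
exists (fun j => complex.Re (spectral_diag B 0 j)), U; split.
  exact: spectral_unitarymx.
have UV : invmx U = U^t* by apply: invmx_unitary; exact: spectral_unitarymx.
apply: etrans BE _; rewrite UV; congr (_ *m diag_mx _ *m _).
by apply/rowP => j; rewrite !mxE RRe_real.
Qed.

Lemma deriv_prod_seq (S : comNzRingType) (I : eqType) (r : seq I)
    (F : I -> {poly S}) : uniq r ->
  (\prod_(i <- r) F i)^`() =
  \sum_(j <- r) (F j)^`() * \prod_(i <- r | i != j) F i.
Proof.
elim: r => [_|x r IH /= /andP[xr ur]]; first by rewrite !big_nil derivC.
rewrite !big_cons derivM eqxx IH //; congr (_ * _ + _).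
  rewrite big_seq [RHS]big_seq_cond; apply: eq_bigl => i.
  by case: (boolP (i \in r)) => //= ir; apply/esym/eqP => ix; rewrite -ix ir in xr.
rewrite mulr_sumr !big_seq; apply: eq_bigr => j jr.
rewrite big_cons ifT; first by ring.
by apply/eqP => xj; rewrite xj jr in xr.
Qed.

Section fixed.
Context (m : nat) (A : 'M[R]_m) (s : 'I_m -> R) (U : 'M[C]_m).
Hypothesis UU : U \is unitarymx.
Hypothesis AE : map_mx toC A = U^t* *m diag_mx (\row_j toC (s j)) *m U.

Let p : {poly R} := \prod_j ('X + (s j)%:P).
Let q j : {poly R} := \prod_(i | i != j) ('X + (s i)%:P).
Let UUt : U *m U^t* = 1%:M. Proof. exact/unitarymxP. Qed.
Let UtU : U^t* *m U = 1%:M. Proof. exact: mulmx1C. Qed.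
Let Uc := map_mx polyC U.
Let Vc := map_mx polyC (U^t*).
Let UVc : Uc *m Vc = 1%:M. Proof. by rewrite -map_mxM UUt map_mx1. Qed.
Let VUc : Vc *m Uc = 1%:M. Proof. by rewrite -map_mxM UtU map_mx1. Qed.
Let N := map_mx polyC A + 'X%:M.

Let NE : map_mx (map_poly toC) N =
  Vc *m diag_mx (\row_j map_poly toC ('X + (s j)%:P)) *m Uc.
Proof.
transitivity (map_mx polyC (map_mx toC A) + 'X%:M).
  apply/matrixP => i j; rewrite !mxE /= rmorphD /= rmorphMn /=.
  by rewrite map_polyX map_polyC.
have -> : 'X%:M = Vc *m 'X%:M *m Uc by rewrite mul_mx_scalar -scalemxAl VUc scalemx1.
rewrite AE !map_mxM -/Uc -/Vc -mulmxDl -mulmxDr; congr (_ *m _ *m _).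
apply/matrixP => i j; rewrite !mxE rmorphMn /= rmorphD /= map_polyX map_polyC /=.
by rewrite -mulrnDl addrC.
Qed.

(** Unitary conjugation leaves the determinant unchanged, so the eigenvalues
    [s j] of [A] are read off the diagonal form. *)
Lemma det_shift_spectral : det_shift A = p.
Proof.
apply: (map_poly_inj toC); rewrite /det_shift -det_map_mx NE !det_mulmx mulrC mulrA.
rewrite -det_mulmx UVc det1 mul1r det_diag rmorph_prod.
by apply: eq_bigr => j _; rewrite mxE.
Qed.

Let adjE : map_mx (map_poly toC) (\adj N) =
  Vc *m diag_mx (\row_j map_poly toC (q j)) *m Uc.
Proof.
set Y := RHS; set N' := map_mx (map_poly toC) N.
have NY : N' *m Y = (map_poly toC p)%:M.
  rewrite /N' NE /Y !mulmxA -(mulmxA _ Uc Vc) UVc mulmx1.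
  rewrite -(mulmxA Vc) mulmx_diag.
  suff -> : diag_mx (\row_j ((\row_j map_poly toC ('X + (s j)%:P)) 0 j *
      (\row_j map_poly toC (q j)) 0 j)) = (map_poly toC p)%:M.
    by rewrite mul_mx_scalar -scalemxAl VUc scalemx1.
  apply/matrixP => i j; rewrite !mxE -rmorphM; congr ((map_poly _ _) *+ _).
  by rewrite /p (bigD1 i).
have p0 : map_poly toC p != 0.
  by rewrite map_poly_eq0 -det_shift_spectral monic_neq0 ?det_shift_monic.
have dN : \det N' = map_poly toC p by rewrite det_map_mx -/(det_shift A) det_shift_spectral.
have : \adj N' *m (N' *m Y) = \adj N' *m (map_poly toC p)%:M by rewrite NY.
rewrite mulmxA mul_adj_mx dN mul_scalar_mx mul_mx_scalar map_mx_adj => e.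
by apply/matrixP => i j; have /matrixP/(_ i j) := e; rewrite !mxE => /(mulfI p0).
Qed.

(* [b k j] is the eigenvalue of [adj_coef A k] along the [j]-th eigenvector
   of [A] *)
Let b k j : R := (q j)`_k.

Let adjcE k : map_mx toC (adj_coef A k) =
  U^t* *m diag_mx (\row_j toC (b k j)) *m U.
Proof.
apply/matrixP => i j; rewrite mxE [adj_coef _ _ _ _]mxE -coef_map.
have /matrixP/(_ i j) := adjE; rewrite [X in X = _]mxE => ->.
rewrite !mxE coef_sum; apply: eq_bigr => a _; rewrite !mxE coefMC; congr (_ * _).
rewrite coef_sum; apply: eq_bigr => c _; rewrite !mxE coefCM; congr (_ * _).
by rewrite coefMn coef_map.
Qed.

(** Coefficientwise form of the product rule for the derivative of
    [\prod_j ('X + s j)]. *)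
Lemma coef_spectral_sum k : \sum_j b k j = (k.+1)%:R * (det_shift A)`_k.+1.
Proof.
rewrite det_shift_spectral mulr_natl -coef_deriv /p.
rewrite -coef_sum; congr (polyseq _)`_k; apply/esym.
rewrite deriv_prod_seq ?index_enum_uniq//.
transitivity (\sum_j q j); last by [].
by apply: eq_bigr => j _; rewrite derivD derivX derivC addr0 mul1r.
Qed.

Lemma adj_coef_tr k : \tr (adj_coef A k) = (k.+1)%:R * (det_shift A)`_k.+1.
Proof.
rewrite -coef_spectral_sum; apply: (complexI (R := R)).
rewrite -trace_map_mx adjcE -mulmxA mxtrace_mulC -mulmxA UUt mulmx1 mxtrace_diag.
by rewrite rmorph_sum; apply: eq_bigr => j _; rewrite mxE.
Qed.

Lemma coef_spectralS k j :
  (det_shift A)`_k.+1 = s j * b k.+1 j + b k j.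
Proof.
rewrite det_shift_spectral /p (bigD1 j)//= mulrDl coefD coefXM coefCM /= addrC.
by congr (_ * _ + _).
Qed.

Lemma coef_spectral0 j : (det_shift A)`_0 = s j * b 0 j.
Proof.
by rewrite det_shift_spectral /p (bigD1 j)//= mulrDl coefD coefXM coefCM /= add0r.
Qed.

(** Euler's identity for the homogeneous elementary symmetric functions; it
    follows by summing the one-variable expansion [coef_spectralS] over [j]. *)
Lemma coef_spectral_wsum k : \sum_j s j * b k j = (m%:R - k%:R) * (det_shift A)`_k.
Proof.
case: k => [|k].
  rewrite (eq_bigr (fun=> (det_shift A)`_0)); last by move=> j _; rewrite -coef_spectral0.
  by rewrite sumr_const card_ord subr0 mulr_natl.
rewrite (eq_bigr (fun j => (det_shift A)`_k.+1 - b k j)); last first.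
  by move=> j _; rewrite (coef_spectralS k j); ring.
by rewrite sumrB sumr_const card_ord coef_spectral_sum; ring.
Qed.

Hypothesis s_ge0 : forall j, 0 <= s j.

Lemma coef_spectral_ge0 k j : 0 <= b k j.
Proof.
rewrite /b /q; elim/big_ind: _ k => [k|x y hx hy k|i _ k].
- by rewrite coef1; case: eqP.
- by rewrite coefM; apply: sumr_ge0 => i _; rewrite mulr_ge0.
- by rewrite coefD coefX coefC addr_ge0 ?ler0n//; case: ifP.
Qed.

Lemma coef_spectral_le k j : b k j <= (det_shift A)`_k.+1.
Proof. by rewrite (coef_spectralS k j) lerDr mulr_ge0// coef_spectral_ge0. Qed.

(** In an eigenbasis of [A] the matrix is diagonal with entries [b k j], which
    are sums of products of the nonnegative [s i]. *)
Lemma adj_coef_psd k (u : 'rV[R]_m) : 0 <= (u *m adj_coef A k *m u^T) 0 0.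
Proof.
rewrite -lecR; set v := U *m map_mx toC u^T.
have vE : v^t* = map_mx toC u *m U^t*.
  rewrite /v trmx_mul map_mxM /=; congr (_ *m _).
  apply/matrixP => i j; rewrite !mxE.
  by apply/CrealP; rewrite complex_real.
have -> : toC ((u *m adj_coef A k *m u^T) 0 0) =
    (v^t* *m diag_mx (\row_j toC (b k j)) *m v) 0 0.
  rewrite vE /v.
  have -> : toC ((u *m adj_coef A k *m u^T) 0 0) =
      (map_mx toC (u *m adj_coef A k *m u^T)) 0 0 by rewrite [RHS]mxE.
  by rewrite !map_mxM adjcE !mulmxA.
rewrite mul_mx_diag mxE; apply: sumr_ge0 => j _; rewrite !mxE.
rewrite mulrAC mulr_ge0 //; last by rewrite lecR coef_spectral_ge0.
by rewrite mulrC -normCK exprn_ge0.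
Qed.

(** The left side is the trace of the square, that is the sum of the
    [b k j ^+ 2], and each [b k j] is at most [(det_shift A)`_k.+1]. *)
Lemma adj_coef_sqsum k : A^T = A ->
  \sum_i \sum_j adj_coef A k i j ^+ 2 <= m%:R * (det_shift A)`_k.+1 ^+ 2.
Proof.
move=> sA.
have -> : \sum_i \sum_j adj_coef A k i j ^+ 2 = \sum_j b k j ^+ 2.
  transitivity (\tr (adj_coef A k *m adj_coef A k)).
    apply: eq_bigr => i _; rewrite mxE; apply: eq_bigr => j _.
    have /matrixP/(_ j i) := adj_coef_sym k sA.
    by rewrite [X in X = _ -> _]mxE => <-; rewrite expr2.
  apply: (complexI (R := R)).
  rewrite -trace_map_mx map_mxM adjcE !mulmxA -(mulmxA _ U) UUt mulmx1.
  rewrite -mulmxA mxtrace_mulC -!mulmxA (mulmxA U) UUt mul1mx.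
  rewrite mulmx_diag mxtrace_diag rmorph_sum; apply: eq_bigr => j _.
  by rewrite !mxE -rmorphM expr2.
have -> : m%:R * (det_shift A)`_k.+1 ^+ 2 = \sum_(j < m) (det_shift A)`_k.+1 ^+ 2.
  by rewrite sumr_const card_ord mulr_natl.
apply: ler_sum => j _.
by rewrite ler_sqr ?nnegrE ?coef_spectral_le// (le_trans (coef_spectral_ge0 k j))// coef_spectral_le.
Qed.

End fixed.

Definition shifted_gram m n (eta c : R) (Y : 'M[R]_(n, m)) : 'M[R]_m :=
  eta%:M + c *: (Y^T *m Y).

Lemma shifted_gram_sym m n eta c (Y : 'M[R]_(n, m)) :
  (shifted_gram eta c Y)^T = shifted_gram eta c Y.
Proof. by rewrite /shifted_gram linearD linearZ /= tr_scalar_mx trmx_mul trmxK. Qed.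

(** The [j]-th eigenvalue is [eta] plus [c] times the squared norm of the image
    of the [j]-th eigenvector. *)
Lemma shifted_gram_spectral m n eta c (Y : 'M[R]_(n, m)) : 0 <= c ->
  exists (s : 'I_m -> R) (U : 'M[C]_m), [/\ U \is unitarymx,
    map_mx toC (shifted_gram eta c Y) = U^t* *m diag_mx (\row_j toC (s j)) *m U &
    forall j, eta <= s j].
Proof.
move=> c0; have [s [U [UU AE]]] := real_sym_spectral (shifted_gram_sym eta c Y).
exists s, U; split=> // j.
have UUt : U *m U^t* = 1%:M by exact/unitarymxP.
have : U *m map_mx toC (shifted_gram eta c Y) *m U^t* = diag_mx (\row_j toC (s j)).
  by rewrite AE !mulmxA UUt mul1mx -mulmxA UUt mulmx1.
move=> /matrixP/(_ j j); rewrite [RHS]mxE eqxx mulr1n [RHS]mxE => e.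
rewrite -lecR -e /shifted_gram map_mxD map_scalar_mx mulmxDr mulmxDl mul_mx_scalar.
rewrite -scalemxAl UUt map_mxZ map_mxM -scalemxAr -scalemxAl scalemx1 mxE.
rewrite [X in _ <= X + _]mxE eqxx mulr1n [X in _ <= _ + X]mxE.
rewrite lerDl mulr_ge0 ?lecR//.
set Z := map_mx toC Y.
have ZE : (Z *m U^t*)^t* = U *m map_mx toC Y^T.
  apply/matrixP => a b; rewrite !mxE rmorph_sum; apply: eq_bigr => k _.
  rewrite !mxE rmorphM mulrC; congr (_ * _); first exact: conjCK.
  by apply/CrealP; rewrite complex_real.
have -> : U *m (map_mx toC Y^T *m Z) *m U^t* = (Z *m U^t*)^t* *m (Z *m U^t*).
  by rewrite ZE -!mulmxA.
rewrite mxE; apply: sumr_ge0 => i _; rewrite 2!mxE.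
by rewrite mulrC -normCK exprn_ge0.
Qed.

End spectral.

(** * Log-concavity for real-rooted polynomials *)

Section log_concavity.
Context (R : realType).

(** Total positivity of order two of the Toeplitz matrix of [a]: log-concavity
    in the form that also controls sequences with zeros, and that is stable
    under multiplication of generating polynomials by ['X + s]. *)
Definition pf2 (a : nat -> R) :=
  (forall k, 0 <= a k) /\
  (forall i j, (i <= j)%N -> a i * a j.+2 <= a i.+1 * a j.+1).

(** The new minor is a polynomial in [s] whose coefficients are minors of [a],
    except that the middle one combines two adjacent minors. *)
Lemma pf2_mulXaddC (p : {poly R}) (s : R) : 0 <= s ->
  pf2 (fun k => p`_k) -> pf2 (fun k => (('X + s%:P) * p)`_k).
Proof.
move=> s0 [p0 pp].
have cE k : (('X + s%:P) * p)`_k.+1 = p`_k + s * p`_k.+1.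
  by rewrite mulrDl coefD coefXM coefCM.
have c0 : (('X + s%:P) * p)`_0 = s * p`_0.
  by rewrite mulrDl coefD coefXM coefCM add0r.
split=> [[|k]|]; first by rewrite c0 mulr_ge0.
  by rewrite cE addr_ge0 ?mulr_ge0.
move=> [|i] [|j] // ij; rewrite !cE ?c0.
- rewrite -subr_ge0.
  have -> : (p`_0 + s * p`_1) * (p`_0 + s * p`_1) - s * p`_0 * (p`_1 + s * p`_2) =
    p`_0 * p`_0 + s * (p`_0 * p`_1) + s ^+ 2 * (p`_1 * p`_1 - p`_0 * p`_2) by ring.
  have h : 0 <= p`_1 * p`_1 - p`_0 * p`_2 by rewrite subr_ge0 pp.
  by rewrite addr_ge0 ?mulr_ge0 ?sqr_ge0// addr_ge0 ?mulr_ge0.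
- rewrite -subr_ge0.
  set a0 := p`_0; set a1 := p`_1; set b1 := p`_j.+1; set b2 := p`_j.+2; set b3 := p`_j.+3.
  have -> : (a0 + s * a1) * (b1 + s * b2) - s * a0 * (b2 + s * b3) =
    a0 * b1 + s * (a1 * b1) + s ^+ 2 * (a1 * b2 - a0 * b3) by ring.
  have h : 0 <= a1 * b2 - a0 * b3 by rewrite subr_ge0 pp.
  by rewrite addr_ge0 ?mulr_ge0 ?sqr_ge0// addr_ge0 ?mulr_ge0// p0.
rewrite ltnS in ij.
rewrite -subr_ge0.
set a0 := p`_i; set a1 := p`_i.+1; set a2 := p`_i.+2.
set b1 := p`_j.+1; set b2 := p`_j.+2; set b3 := p`_j.+3.
have -> : (a1 + s * a2) * (b1 + s * b2) - (a0 + s * a1) * (b2 + s * b3) =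
   (a1 * b1 - a0 * b2) + s * (a2 * b1 - a0 * b3) + s ^+ 2 * (a2 * b2 - a1 * b3) by ring.
have h1 : 0 <= a1 * b1 - a0 * b2 by rewrite subr_ge0 pp.
have h3 : 0 <= a2 * b2 - a1 * b3 by rewrite subr_ge0 pp.
have h2 : 0 <= a2 * b1 - a0 * b3.
  rewrite subr_ge0; have := ij; rewrite leq_eqVlt => /predU1P[e|lij].
    by rewrite /a0 /a2 /b1 /b3 -e [leRHS]mulrC; exact: (pp i i.+1 (leqnSn i)).
  have h : a0 * b3 <= a1 * b2 by apply: (pp i j.+1); rewrite ltnW// ltnS ltnW.
  apply: le_trans h _.
  exact: (pp i.+1 j lij).
by rewrite addr_ge0 ?mulr_ge0 ?sqr_ge0// addr_ge0 ?mulr_ge0.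
Qed.

Lemma pf2_prod_XaddC (I : Type) (r : seq I) (s : I -> R) : (forall i, 0 <= s i) ->
  pf2 (fun k => (\prod_(i <- r) ('X + (s i)%:P))`_k).
Proof.
move=> s0; elim: r => [|x r IH].
  split=> [k|i j _]; rewrite big_nil !coef1; first by case: eqP.
  by rewrite mulr0 mulr_ge0// ler0n.
rewrite (_ : (fun _ => _) = (fun k => (('X + (s x)%:P) *
  (\prod_(i <- r) ('X + (s i)%:P)))`_k)); first exact: pf2_mulXaddC.
by apply/funext => k; rewrite big_cons.
Qed.

(** Once the sequence has decreased it keeps decreasing, since [pf2] compares
    successive ratios; so either it increases up to [k] or decreases from
    [k] on. *)
Lemma pf2_unimodal (a : nat -> R) i k j : pf2 a -> (i <= k <= j)%N ->
  Num.min (a i) (a j) <= a k.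
Proof.
move=> [a0 aa] /andP[ik kj]; rewrite ge_min.
have [/existsP[t /andP[it tS]]|] := boolP [exists t : 'I_k, (i <= t)%N && (a t.+1 < a t)].
  apply/orP; right.
  have dec u : (t < u)%N -> a u.+1 <= a u.
    case: u => // u tu; have at0 : 0 < a t by apply: le_lt_trans tS.
    rewrite -(ler_pM2l at0); apply: le_trans (aa t u tu) _.
    by rewrite ler_wpM2r// ltW.
  elim: j kj => [|j IH]; first by rewrite leqn0 => /eqP ->.
  rewrite leq_eqVlt => /predU1P[->//|kj]; apply: le_trans (IH kj).
  by apply: dec; apply: leq_trans (ltn_ord t) kj.
rewrite negb_exists => /forallP h; apply/orP; left.
have inc u : (i <= u)%N -> (u < k)%N -> a u <= a u.+1.
  by move=> iu uk; have := h (Ordinal uk); rewrite /= iu /= -leNgt.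
elim: k ik {kj h} inc => [|k IH]; first by rewrite leqn0 => /eqP ->.
rewrite leq_eqVlt => /predU1P[->//|ik] inc.
apply: le_trans (IH ik _) (inc k ik (ltnSn k)) => u iu uk.
by apply: inc => //; rewrite ltnW.
Qed.

End log_concavity.

(** * Coefficients of the growing Gram matrix *)

Section ecoef.
Context (R : realType).
Implicit Types (x : nat * nat -> R) (m i l : nat) (eta : R).

Definition row_vec x i m : 'rV[R]_m := \row_(j < m) x (i, nat_of_ord j).

Definition gram_mx eta x m i : 'M[R]_m := shifted_gram eta m%:R^-1 (data_mx x i m).

(** The [l]-th elementary symmetric function of the eigenvalues of the Gram
    matrix of the first [i] rows shifted by [eta]; it is indexed from the top
    degree so that it does not depend on the number of zero eigenvalues. *)
Definition ecoef eta x m i l : R :=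
  if (l <= m)%N then (det_shift (gram_mx eta x m i))`_(m - l) else 0.

Lemma gram_mxS eta x m i : gram_mx eta x m i.+1 =
  gram_mx eta x m i + m%:R^-1 *: ((row_vec x i m)^T *m row_vec x i m).
Proof.
rewrite /gram_mx /shifted_gram -addrA -scalerDr; congr (_ + _ *: _).
apply/matrixP => a b; rewrite !mxE big_ord_recr big_ord1 /=; congr (_ + _).
  by apply: eq_bigr => j _; rewrite !mxE.
by rewrite !mxE.
Qed.

Lemma ecoef0 eta x m i : ecoef eta x m i 0 = 1.
Proof.
rewrite /ecoef subn0.
by have := monicP (det_shift_monic (gram_mx eta x m i)); rewrite lead_coefE size_det_shift.
Qed.

(** The quadratic form that the next row is plugged into; it involves the
    earlier rows only. *)
Definition row_form eta x m i l : 'M[R]_m := adj_coef (gram_mx eta x m i) (m - l.+1).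

Lemma ecoefS eta x m i l : (l < m)%N -> ecoef eta x m i.+1 l.+1 =
  ecoef eta x m i l.+1 +
  m%:R^-1 * (row_vec x i m *m row_form eta x m i l *m (row_vec x i m)^T) 0 0.
Proof. by move=> lm; rewrite /ecoef lm gram_mxS det_shift_rank1. Qed.

Lemma row_form_sym eta x m i l a b :
  row_form eta x m i l a b = row_form eta x m i l b a.
Proof.
have /matrixP/(_ b a) := adj_coef_sym (m - l.+1) (shifted_gram_sym eta m%:R^-1 (data_mx x i m)).
by rewrite mxE.
Qed.

Let invm_ge0 m : 0 <= m%:R^-1 :> R. Proof. by rewrite invr_ge0 ler0n. Qed.

Lemma ecoefE eta x m i l : (l < m)%N ->
  ecoef eta x m i l = (det_shift (gram_mx eta x m i))`_(m - l.+1).+1.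
Proof. by move=> lm; rewrite /ecoef ltnW// -subSn. Qed.

Lemma row_form_tr eta x m i l : (l < m)%N ->
  \tr (row_form eta x m i l) = (m - l)%:R * ecoef eta x m i l.
Proof.
move=> lm; have [s [U [UU AE _]]] :=
  shifted_gram_spectral eta (data_mx x i m) (invm_ge0 m).
by rewrite (adj_coef_tr UU AE) -ecoefE// -subSn// subSS.
Qed.

Lemma row_form_psd eta x m i l (u : 'rV[R]_m) : 0 <= eta ->
  0 <= (u *m row_form eta x m i l *m u^T) 0 0.
Proof.
move=> eta0; have [s [U [UU AE se]]] :=
  shifted_gram_spectral eta (data_mx x i m) (invm_ge0 m).
by apply: (adj_coef_psd UU AE) => j; apply: le_trans (se j).
Qed.

Lemma row_form_diag_ge0 eta x m i l a : 0 <= eta -> 0 <= row_form eta x m i l a a.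
Proof.
move=> eta0; have := row_form_psd x i l (delta_mx 0 a) eta0.
by rewrite -rowE trmx_delta mxE (bigD1 a)//= big1 ?addr0 => [|j ja]; rewrite !mxE ?(negPf ja) ?eqxx ?mulr0 ?mulr1.
Qed.

Lemma row_form_sqsum eta x m i l : (l < m)%N -> 0 <= eta ->
  \sum_a \sum_b row_form eta x m i l a b ^+ 2 <= m%:R * ecoef eta x m i l ^+ 2.
Proof.
move=> lm eta0; have [s [U [UU AE se]]] :=
  shifted_gram_spectral eta (data_mx x i m) (invm_ge0 m).
rewrite ecoefE//; apply: (adj_coef_sqsum UU AE); last exact: shifted_gram_sym.
by move=> j; apply: le_trans (se j).
Qed.

(** By Euler's identity [l.+1 * ecoef l.+1] is the sum over the eigenvalues [s j]
    of [s j] times the symmetric functions of the others, and every eigenvalue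
    is at least [eta].  Consecutive coefficients are thus comparable once
    [eta > 0]. *)
Lemma ecoef_ratio eta x m i l : (l < m)%N -> 0 <= eta ->
  eta * (m - l)%:R * ecoef eta x m i l <= l.+1%:R * ecoef eta x m i l.+1.
Proof.
move=> lm eta0; have [s [U [UU AE se]]] :=
  shifted_gram_spectral eta (data_mx x i m) (invm_ge0 m).
have s0 j : 0 <= s j by apply: le_trans (se j).
have e := coef_spectral_wsum UU AE (m - l.+1).
have e' := coef_spectral_sum UU AE (m - l.+1).
rewrite -mulrA ecoefE// -[(m - l)%N]subSS subSn// -e'.
have -> : l.+1%:R = m%:R - (m - l.+1)%:R :> R by rewrite natrB// opprB addrC subrK.
rewrite [ecoef _ _ _ _ l.+1]/ecoef lm -e mulr_sumr; apply: ler_sum => j _.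
by apply: ler_wpM2r (se j); apply: coef_spectral_ge0.
Qed.

Lemma det_shift_gram_prod eta x m i : exists2 s : 'I_m -> R, (forall j, eta <= s j) &
  det_shift (gram_mx eta x m i) = \prod_j ('X + (s j)%:P).
Proof.
have [s [U [UU AE se]]] :=
  shifted_gram_spectral eta (data_mx x i m) (invm_ge0 m).
by exists s => //; apply: det_shift_spectral AE.
Qed.

Lemma ecoef_ge0 eta x m i l : 0 <= eta -> 0 <= ecoef eta x m i l.
Proof.
move=> eta0; rewrite /ecoef; case: ifP => // _.
have [s se ->] := det_shift_gram_prod eta x m i.
have [h _] : pf2 (fun k => (\prod_j ('X + (s j)%:P))`_k).
  by apply: pf2_prod_XaddC => j; apply: le_trans (se j).
exact: h.
Qed.

Lemma ecoef_gt0 eta x m i l : 0 < eta -> (l <= m)%N -> 0 < ecoef eta x m i l.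
Proof.
move=> eta0; elim: l => [|l IH] lm; first by rewrite ecoef0.
have := ecoef_ratio x i lm (ltW eta0); move/(lt_le_trans _) => h.
have : 0 < l.+1%:R * ecoef eta x m i l.+1.
  by apply: h; rewrite !mulr_gt0 ?IH// ?ltr0n ?subn_gt0// ltnW.
by rewrite pmulr_rgt0 ?ltr0n.
Qed.

(** If [l2 > m] the last coefficient vanishes; otherwise the coefficients are
    those of a real-rooted polynomial. *)
Lemma ecoef_unimodal eta x m i l1 l l2 : 0 <= eta -> (l1 <= l <= l2)%N ->
  Num.min (ecoef eta x m i l1) (ecoef eta x m i l2) <= ecoef eta x m i l.
Proof.
move=> eta0 /andP[l1l ll2]; have [l2m|] := leqP l2 m; last first.
  move=> ml2; rewrite ge_min; apply/orP; right.
  by rewrite {1}/ecoef leqNgt ml2 ecoef_ge0.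
rewrite /ecoef l2m !ifT ?(leq_trans _ l2m)// ?(leq_trans l1l)//.
have [s se ->] := det_shift_gram_prod eta x m i.
rewrite minC; apply: (pf2_unimodal (a := fun k => (\prod_j ('X + (s j)%:P))`_k)).
  by apply: pf2_prod_XaddC => j; apply: le_trans (se j).
by rewrite !leq_sub2l.
Qed.

(** Shifting the Gram matrix by [eta] is the substitution of ['X + eta] for ['X]
    in [det_shift]; expand the powers. *)
Lemma ecoef_shift eta x m i l : (l <= m)%N ->
  ecoef eta x m i l =
  \sum_(j < l.+1) 'C(m - l + j, j)%:R * eta ^+ j * ecoef 0 x m i (l - j).
Proof.
move=> lm; rewrite {1}/ecoef lm.
have -> : det_shift (gram_mx eta x m i) = det_shift (gram_mx 0 x m i) \Po ('X + eta%:P).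
  rewrite /det_shift -[_ \Po _]/(comp_poly _ _) -det_map_mx; congr (\det _).
  apply/matrixP => a b; rewrite !mxE /= comp_polyD comp_polyC mul0rn add0r.
  case: (a == b); rewrite ?mulr1n ?mulr0n ?comp_polyX ?comp_poly0 polyCD //.
    by rewrite -[LHS]addrA [LHS]addrC -[LHS]addrA.
  by rewrite polyC0 add0r.
rewrite comp_polyE size_det_shift coef_sum.
rewrite -(big_mkord xpredT (fun k => ((det_shift (gram_mx 0 x m i))`_k *:
   ('X + eta%:P) ^+ k)`_(m - l))).
rewrite (big_cat_nat (n := (m - l)%N))//=; last by rewrite ltnW// ltnS leq_subr.
rewrite big_nat_cond big1 ?add0r; last first.
  move=> k /andP[/andP[_ kml] _]; rewrite coefZ [X in _ * X]nth_default ?mulr0//.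
  by rewrite -(opprK eta) polyCN size_exp_XsubC.
rewrite -{1}[(m - l)%N]add0n big_addn subSn// ?leq_subr// subKn// big_mkord.
apply: eq_bigr => j _; rewrite coefZ exprDn.
rewrite [X in _ * X]coef_sum (bigD1 (inord (j : nat) : 'I_(j + (m - l)).+1)) //=.
rewrite inordK ?ltnS ?leq_addr// big1 ?addr0; last first.
  move=> k kj; rewrite coefMn -polyC_exp coefMC coefXn.
  case: eqP => [e|_]; last by rewrite mul0r mul0rn.
  case/eqP: kj; apply/val_inj; rewrite /= inordK ?ltnS ?leq_addr//.
  have := ltn_ord k; rewrite ltnS; lia.
rewrite coefMn -polyC_exp coefMC coefXn addKn eqxx mul1r.
rewrite [in RHS]/ecoef ifT ?(leq_trans (leq_subr _ _))//.
have jl : (j <= l)%N by rewrite -ltnS.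
have -> : (m - (l - j) = j + (m - l))%N by rewrite subnBA// addnC addnBA.
by rewrite -mulr_natl addnC; ring.
Qed.

(** The matrices [Y Y^T] and [Y^T Y] have the same nonzero eigenvalues. *)
Lemma coef_cov_mx x m n k : (k <= n)%N ->
  (det_shift (cov_mx x m n))`_k = ecoef 0 x m n (n - k).
Proof.
move=> kn; have := det_shift_comm (m%:R^-1 *: data_mx x n m) (data_mx x n m)^T.
rewrite -scalemxAl -scalemxAr -/(cov_mx x m n).
have -> : m%:R^-1 *: ((data_mx x n m)^T *m data_mx x n m) = gram_mx 0 x m n.
  by rewrite /gram_mx /shifted_gram raddf0 add0r.
move=> /(congr1 (fun p : {poly R} => p`_(m + k))).
rewrite !coefXnM ltnNge leq_addr /= addKn => ->; rewrite /ecoef leq_subLR.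
rewrite (addnC k m) ltnNge; case: leqP => //= h; congr (_`_ _).
lia.
Qed.

Lemma det_cov_mx x m n :
  \det (cov_mx x m n + 1%:M) = \sum_(l < n.+1) ecoef 0 x m n l.
Proof.
rewrite -det_shift_horner horner_coef size_det_shift.
rewrite (reindex_inj rev_ord_inj) /=; apply: eq_bigr => k _.
by rewrite expr1n mulr1 subSS coef_cov_mx ?leq_subr// subKn// -ltnS.
Qed.

Lemma det_coefE x m n k : (k <= n)%N -> det_coef (cov_mx x m n) k =
  ecoef 0 x m n (n - k) / \sum_(l < n.+1) ecoef 0 x m n l.
Proof. by move=> kn; rewrite /det_coef coefZ coef_cov_mx// det_cov_mx mulrC. Qed.

End ecoef.

(** * Integrals over independent coordinates *)

Section decoupling.
Context (d d1 d2 : measure_display) (T : measurableType d) (R : realType)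
  (P : probability T R) (T1 : measurableType d1) (T2 : measurableType d2).
Variables (U : {RV P >-> T1}) (V : {RV P >-> T2}).
Hypothesis indep : forall A B, measurable A -> measurable B ->
  P (U @^-1` A `&` V @^-1` B) = (P (U @^-1` A) * P (V @^-1` B))%E.

Let UV w := (U w, V w).

Let mUV : measurable_fun setT UV.
Proof. by apply/measurable_fun_pairP; split; apply: measurable_funPT. Qed.

Let UVp : {RV P >-> (T1 * T2)%type} :=
  HB.pack UV (isMeasurableFun.Build _ _ _ _ _ mUV).

Lemma joint_distribution A : measurable A ->
  (distribution P U \x distribution P V)%E A = distribution P UVp A.
Proof.
apply: product_measure_unique => B C mB mC.
by rewrite /distribution /pushforward /= -indep.
Qed.

(** For independent [U] and [V] the joint law is the product of the laws;
    Tonelli's theorem then turns the second argument into an independent copy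
    without constructing one. *)
Lemma ge0_decouple (F : T1 * T2 -> \bar R) :
  measurable_fun [set: T1 * T2] F -> (forall z, 0 <= F z)%E ->
  (\int[P]_w F (U w, V w) = \int[P]_w \int[P]_w' F (U w, V w'))%E.
Proof.
move=> mF F0.
transitivity (\int[distribution P UVp]_z F z)%E.
  by rewrite ge0_integral_distribution.
transitivity (\int[(distribution P U \x distribution P V)%E]_z F z)%E.
  by apply: eq_measure_integral => A mA _; rewrite /= -joint_distribution.
rewrite fubini_tonelli1// ge0_integral_distribution//; last 2 first.
- exact: measurable_fun_fubini_tonelli_F.
- by move=> y; apply: integral_ge0.
apply: eq_integral => w _; rewrite /= /fubini_F ge0_integral_distribution//.
exact: measurableT_comp.
Qed.

(** The bound on the inner integral is only known at points of the form [U w],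
    which suffices because [U] is onto. *)
Lemma ge0_decouple_le (F : T1 * T2 -> \bar R) (G : T1 -> \bar R) :
  measurable_fun [set: T1 * T2] F -> (forall z, 0 <= F z)%E ->
  measurable_fun setT G -> (forall y, 0 <= G y)%E ->
  (forall w, \int[P]_w' F (U w, V w') <= G (U w))%E ->
  (forall y, exists w, U w = y) ->
  (\int[P]_w F (U w, V w) <= \int[P]_w G (U w))%E.
Proof.
move=> mF F0 mG G0 FG surjU.
have -> : (\int[P]_w G (U w) = \int[distribution P U]_y G y)%E.
  by rewrite ge0_integral_distribution.
have -> : (\int[P]_w F (U w, V w) = \int[distribution P UVp]_z F z)%E.
  by rewrite ge0_integral_distribution.
have -> : (\int[distribution P UVp]_z F z =
    \int[(distribution P U \x distribution P V)%E]_z F z)%E.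
  by apply: eq_measure_integral => A mA _; rewrite /= -joint_distribution.
rewrite fubini_tonelli1//; apply: ge0_le_integral => //.
- by move=> y _; apply: integral_ge0.
- exact: measurable_fun_fubini_tonelli_F.
move=> y _; have [w <-] := surjU y; apply: le_trans (FG w).
by rewrite /fubini_F ge0_integral_distribution//; exact: measurableT_comp.
Qed.

End decoupling.

Section cylinders.
Context d (T : measurableType d) (R : realType) (P : probability T R).
Context (I : choiceType) (X : I -> {RV P >-> R}).

Definition cylinders (S : set I) : set (set T) :=
  [set A | exists (J : {fset I}) (B : I -> set R),
    [/\ forall j, j \in J -> S j, forall j, measurable (B j) &
        A = \bigcap_(j in [set` J]) (X j @^-1` B j)]].

(** The sample space equipped with the sigma-algebra generated by the coordinates
    in [S].  Measurability of a function on this space says that it depends on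
    these coordinates only, so conditioning on them becomes integration over
    a product of two copies of the sample space. *)
Definition sub_sigma (S : set I) := g_sigma_algebraType (cylinders S).

Lemma cylinders_setI S : setI_closed (cylinders S).
Proof.
move=> _ _ [J [B [JS mB ->]]] [J' [B' [JS' mB' ->]]].
pose E j := (if j \in J then B j else setT) `&` (if j \in J' then B' j else setT).
exists (J `|` J')%fset, E; split.
- by move=> j; rewrite inE => /orP[/JS|/JS'].
- by move=> j; rewrite /E; apply: measurableI; case: ifP.
apply/seteqP; split => w.
  by move=> [wJ wJ'] j _; rewrite /E; split; case: ifP => // jJ; [exact: wJ|exact: wJ'].
move=> wE; split=> j /= jJ.
  by have [] := wE j; rewrite /= ?inE ?jJ// /E jJ.
by have [] := wE j; rewrite /= ?inE ?jJ ?orbT// /E jJ.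
Qed.

Lemma measurable_cylinder S A : cylinders S A -> measurable A.
Proof.
move=> [J [B [_ mB ->]]]; apply: fin_bigcap_measurable => // j _.
by rewrite -[_ @^-1` _]setTI; apply: measurable_funPT.
Qed.

Lemma measurable_sub_sigma S (A : set (sub_sigma S)) :
  measurable A -> d.-measurable (A : set T).
Proof.
apply: smallest_sub; first exact: sigma_algebra_measurable.
exact: measurable_cylinder.
Qed.

Lemma measurable_coord S j : S j ->
  measurable_fun (setT : set (sub_sigma S)) (X j : sub_sigma S -> R).
Proof.
move=> Sj _ B mB; rewrite setTI; apply: sub_sigma_algebra.
exists [fset j]%fset, (fun=> B); split => //.
  by move=> k; rewrite inE => /eqP ->.
by rewrite set_fset1 bigcap_set1.
Qed.

Let id_sub S : T -> sub_sigma S := id.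
Let mid_sub S : measurable_fun setT (id_sub S).
Proof. by move=> _ B mB; rewrite setTI; exact: measurable_sub_sigma mB. Qed.
(** The identity, as a random element; it transports the probability to
    [sub_sigma S]. *)
Definition to_sub S : {RV P >-> sub_sigma S} :=
  HB.pack (id_sub S) (isMeasurableFun.Build _ _ _ _ _ (@mid_sub S)).

Hypothesis X_indep : independent_RVs P X.

Lemma cylinders_indep S S' A A' : S `&` S' = set0 ->
  cylinders S A -> cylinders S' A' -> P (A `&` A') = (P A * P A')%E.
Proof.
move=> SS' [J [B [JS mB ->]]] [J' [B' [JS' mB' ->]]].
have dJ j : j \in J -> j \notin J'.
  move=> jJ; apply/negP => jJ'; have : (S `&` S') j by split; [exact: JS|exact: JS'].
  by rewrite SS'.
pose E j := if j \in J then B j else B' j.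
rewrite !X_indep//.
transitivity (P (\bigcap_(j in [set` (J `|` J')%fset]) (X j @^-1` E j))).
  congr (P _); apply/seteqP; split => w.
    move=> [wJ wJ'] j /=; rewrite inE /E.
    by case: ifP => [jJ _|_ /= jJ']; [exact: wJ|exact: wJ'].
  move=> wE; split=> j /= jJ.
    by have := wE j; rewrite /= inE jJ /E jJ => /(_ isT).
  have := wE j; rewrite /= inE jJ orbT /E => /(_ isT).
  by case: ifP => // jJ2; rewrite (negPf (dJ _ jJ2)) in jJ.
rewrite X_indep; last by move=> j _; rewrite /E; case: ifP.
rewrite (perm_big (enum_fset J ++ enum_fset J')) /=; last first.
  apply: uniq_perm; rewrite ?fset_uniq// ?cat_uniq ?fset_uniq ?andbT /=.
    apply/hasPn => j jJ'; apply/negP => jJ; by have := dJ j jJ; rewrite jJ'.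
  by move=> j; rewrite mem_cat inE.
rewrite big_cat /=; congr (_ * _)%E; rewrite big_seq [RHS]big_seq.
  by apply: eq_bigr => j jJ; rewrite /E jJ.
apply: eq_bigr => j jJ; rewrite /E ifF//; apply/negP => jJ2.
by have := dJ j jJ2; rewrite jJ.
Qed.

(** Dynkin's lemma, used twice: from cylinders to measurable sets in each of
    the two factors. *)
Lemma sub_sigma_indep S S' (A : set (sub_sigma S)) (A' : set (sub_sigma S')) :
  S `&` S' = set0 -> measurable A -> measurable A' ->
  P ((A : set T) `&` (A' : set T)) = (P A * P A')%E.
Proof.
move=> SS'; pose H (A : set T) := forall A' : set T, (cylinders S').-sigma.-measurable A' ->
  P (A `&` A') = (P A * P A')%E.
have step (S0 : set I) (Q : set T) : d.-measurable Q ->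
    (forall B, cylinders S0 B -> P (Q `&` B) = (P Q * P B)%E) ->
    forall B, (cylinders S0).-sigma.-measurable B -> P (Q `&` B) = (P Q * P B)%E.
  move=> mQ QE; pose K (B : set T) := P (Q `&` B) = (P Q * P B)%E.
  have sub := @measurable_sub_sigma S0.
  apply: (@dynkin_induction _ (sub_sigma S0) (cylinders S0) K) => //.
  - exact: cylinders_setI.
  - by rewrite /K setIT probability_setT mule1.
  - move=> B /sub mB; rewrite /K => KB.
    rewrite -setDE measureD// ?ltey_eq ?fin_num_measure//.
    transitivity (P Q - P Q * P B)%E; first by congr (_ - _)%E; exact: KB.
    transitivity (P Q * (1 - P B))%E.
      by rewrite muleBr ?fin_num_measure// ?mule1.
    by congr (_ * _)%E; apply/esym; exact: probability_setC.
  - move=> F mF tF KF; rewrite /K setI_bigcupr.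
    have mF' i : d.-measurable (F i : set T) by exact: sub.
    have -> : P (\bigcup_i (F i : set T)) =
        (\sum_(0 <= i <oo) P (F i : set T))%E.
      by rewrite measure_semi_bigcup//; exact: bigcup_measurable.
    rewrite measure_semi_bigcup//; last 3 first.
    + by move=> i; apply: measurableI.
    + exact: trivIset_setIl.
    + by apply: bigcup_measurable => i _; apply: measurableI.
    have PQ : (fine (P Q))%:E = P Q by rewrite fineK// fin_num_measure.
    rewrite -PQ -nneseriesZl//; apply: eq_eseriesr => i _.
    by rewrite PQ; exact: KF.
move=> mA mA'; apply: (step S') => //; first exact: measurable_sub_sigma mA.
move=> B cB; rewrite setIC muleC.
apply: (step S) => //; first exact: measurable_cylinder cB.
by move=> C cC; rewrite setIC muleC; exact: cylinders_indep cC cB.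
Qed.

Lemma ge0_indep_decouple S S' (F : sub_sigma S * sub_sigma S' -> \bar R) :
  S `&` S' = set0 ->
  measurable_fun [set: sub_sigma S * sub_sigma S'] F -> (forall z, 0 <= F z)%E ->
  (\int[P]_w F (w, w) = \int[P]_w \int[P]_w' F (w, w'))%E.
Proof.
move=> SS' mF F0; apply: (@ge0_decouple _ _ _ _ _ _ _ _ (to_sub S) (to_sub S')) => //.
by move=> A B mA mB; exact: (sub_sigma_indep SS' mA mB).
Qed.

Lemma ge0_indep_decouple_le S S' (F : sub_sigma S * sub_sigma S' -> \bar R)
    (G : sub_sigma S -> \bar R) :
  S `&` S' = set0 ->
  measurable_fun [set: sub_sigma S * sub_sigma S'] F -> (forall z, 0 <= F z)%E ->
  measurable_fun setT G -> (forall y, 0 <= G y)%E ->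
  (forall w, \int[P]_w' F (w, w') <= G w)%E ->
  (\int[P]_w F (w, w) <= \int[P]_w G w)%E.
Proof.
move=> SS' mF F0 mG G0 FG.
apply: (@ge0_decouple_le _ _ _ _ _ _ _ _ (to_sub S) (to_sub S')) => //.
  by move=> A B mA mB; exact: (sub_sigma_indep SS' mA mB).
by move=> y; exists y.
Qed.

End cylinders.

(** * Measurability of the coefficients *)

(** On positive reals the inverse is [expR (- ln _)], a composition of
    measurable functions. *)
Lemma measurable_funV_gt0 (d : measure_display) (O : measurableType d) (R : realType)
    (f : O -> R) : measurable_fun setT f -> (forall w, 0 < f w) ->
  measurable_fun setT (fun w => (f w)^-1).
Proof.
move=> mf f0; rewrite (_ : (fun _ => _) = (fun w => expR (- ln (f w)))).
  apply: measurableT_comp; first exact: measurable_expR.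
  apply: measurable_funN.
  by apply: measurableT_comp mf; exact: measurable_ln.
by apply/funext => w; rewrite expRN lnK// posrE.
Qed.

Section measurability.
Context (d : measure_display) (O : measurableType d) (R : realType).

(** Random polynomials are handled through their coefficients, so that the
    polynomial ring needs no sigma-algebra. *)
Definition coef_measurable (p : O -> {poly R}) :=
  forall k, measurable_fun [set: O] (fun w => (p w)`_k).

Lemma coef_measurable_cst p : coef_measurable (fun=> p).
Proof. by move=> k; exact: measurable_cst. Qed.

Lemma coef_measurableD p q : coef_measurable p -> coef_measurable q ->
  coef_measurable (fun w => p w + q w).
Proof.
move=> mp mq k; under eq_fun do rewrite coefD.
by apply: measurable_funD; [exact: mp|exact: mq].
Qed.

Lemma coef_measurableM p q : coef_measurable p -> coef_measurable q ->
  coef_measurable (fun w => p w * q w).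
Proof.
move=> mp mq k; under eq_fun do rewrite coefM.
by apply: measurable_sum => i; apply: measurable_funM; [exact: mp|exact: mq].
Qed.

Lemma coef_measurable_sum (I : Type) (r : seq I) (F : I -> O -> {poly R}) :
  (forall i, coef_measurable (F i)) -> coef_measurable (fun w => \sum_(i <- r) F i w).
Proof.
move=> mF; elim: r => [|i r IH].
  by under eq_fun do rewrite big_nil; exact: coef_measurable_cst.
by under eq_fun do rewrite big_cons; apply: coef_measurableD.
Qed.

Lemma coef_measurable_prod (I : Type) (r : seq I) (F : I -> O -> {poly R}) :
  (forall i, coef_measurable (F i)) -> coef_measurable (fun w => \prod_(i <- r) F i w).
Proof.
move=> mF; elim: r => [|i r IH].
  by under eq_fun do rewrite big_nil; exact: coef_measurable_cst.
by under eq_fun do rewrite big_cons; apply: coef_measurableM.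
Qed.

Lemma coef_measurable_det n (N : O -> 'M[{poly R}]_n) :
  (forall a b, coef_measurable (fun w => N w a b)) ->
  coef_measurable (fun w => \det (N w)).
Proof.
move=> mN; apply: coef_measurable_sum => s; apply: coef_measurableM.
  exact: coef_measurable_cst.
by apply: coef_measurable_prod.
Qed.

Lemma coef_measurable_adj n (N : O -> 'M[{poly R}]_n) :
  (forall a b, coef_measurable (fun w => N w a b)) ->
  forall a b, coef_measurable (fun w => \adj (N w) a b).
Proof.
move=> mN a b; rewrite /adjugate; under eq_fun do rewrite mxE.
apply: coef_measurableM; first exact: coef_measurable_cst.
by apply: coef_measurable_det => c e; under eq_fun do rewrite !mxE; exact: mN.
Qed.

Context (x : O -> nat * nat -> R) (eta : R) (m i : nat).
Hypothesis mx : forall a b, (a < i)%N -> (b < m)%N ->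
  measurable_fun [set: O] (fun w => x w (a, b)).

Let coef_measurable_gram a b :
  coef_measurable (fun w => (map_mx polyC (gram_mx eta (x w) m i) + 'X%:M) a b).
Proof.
rewrite /gram_mx /shifted_gram.
under eq_fun do rewrite !mxE.
apply: coef_measurableD; last exact: coef_measurable_cst.
case=> [|k]; last by under eq_fun do rewrite coefC; exact: measurable_cst.
under eq_fun do rewrite coefC /=.
apply: measurable_funD; first exact: measurable_cst.
apply: measurable_funM; first exact: measurable_cst.
apply: measurable_sum => j.
by apply: measurable_funM; under eq_fun do rewrite !mxE; apply: mx.
Qed.

Lemma measurable_ecoef l : measurable_fun [set: O] (fun w => ecoef eta (x w) m i l).
Proof.
rewrite /ecoef; case: (l <= m)%N; last exact: measurable_cst.
by apply: coef_measurable_det => a b; exact: coef_measurable_gram.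
Qed.

Lemma measurable_row_form l a b :
  measurable_fun [set: O] (fun w => row_form eta (x w) m i l a b).
Proof.
rewrite /row_form /adj_coef; under eq_fun do rewrite mxE.
exact: coef_measurable_adj.
Qed.

End measurability.

(** * Finite expectations *)

Section expectation_calculus.
Context (d : measure_display) (T : measurableType d) (R : realType)
  (P : probability T R).
Implicit Types (f g : T -> R) (u v : R).

(** Integrability together with the value of the integral.  Bundling both makes
    linearity of the expectation a compositional rule without integrability
    side conditions. *)
Definition hasE f u := P.-integrable setT (EFin \o f) /\
  (\int[P]_w (f w)%:E = u%:E)%E.

Lemma hasE_meas f u : hasE f u -> measurable_fun setT f.
Proof. by move=> [/measurable_int/measurable_EFinP]. Qed.

Lemma hasE_unique f u v : hasE f u -> hasE f v -> u = v.
Proof. by move=> [_ fu] [_]; rewrite fu => -[]. Qed.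

Lemma hasE_cst u : hasE (fun=> u) u.
Proof.
split; first exact: finite_measure_integrable_cst.
by rewrite integral_cst// [X in (_ * X)%E]probability_setT mule1.
Qed.

Lemma hasED f g u v : hasE f u -> hasE g v -> hasE (fun w => f w + g w) (u + v).
Proof.
move=> [fi fu] [gi gv]; split.
  by apply: eq_integrable (integrableD measurableT fi gi).
by under eq_integral do rewrite EFinD; rewrite integralD// fu gv.
Qed.

Lemma hasEZ f u (c : R) : hasE f u -> hasE (fun w => c * f w) (c * u).
Proof.
move=> [fi fu]; split.
  by apply: eq_integrable (integrableZl measurableT c fi).
by under eq_integral do rewrite EFinM; rewrite integralZl// fu.
Qed.

Lemma hasE_sum (I : Type) (r : seq I) (F : I -> T -> R) (u : I -> R) :
  (forall i, hasE (F i) (u i)) -> hasE (fun w => \sum_(i <- r) F i w) (\sum_(i <- r) u i).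
Proof.
move=> Fu; elim: r => [|i r IH].
  by rewrite big_nil; under eq_fun do rewrite big_nil; exact: hasE_cst.
by rewrite big_cons; under eq_fun do rewrite big_cons; exact: hasED.
Qed.

Lemma hasE_ext f g u : f =1 g -> hasE f u -> hasE g u.
Proof. by move=> /funext ->. Qed.

Lemma hasE_le f g u v : hasE f u -> hasE g v -> (forall w, f w <= g w) -> u <= v.
Proof.
move=> [fi fu] [gi gv] fg; rewrite -lee_fin -fu -gv.
by apply: le_integral => // w _; rewrite lee_fin.
Qed.

Lemma hasE_ge0 f u : hasE f u -> (forall w, 0 <= f w) -> 0 <= u.
Proof. by move=> fu f0; apply: hasE_le (hasE_cst 0) fu f0. Qed.

Lemma hasE_dom f g v : measurable_fun setT f -> hasE g v ->
  (forall w, `|f w| <= g w) -> exists u, hasE f u.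
Proof.
move=> mf [gi gv] fg.
have fi : P.-integrable setT (EFin \o f).
  apply: le_integrable gi => //; first exact/measurable_EFinP.
  move=> w _ /=; rewrite lee_fin [leRHS]ger0_norm; first exact: fg.
  exact: le_trans (fg w).
exists (fine (\int[P]_w (f w)%:E)); split => //.
by rewrite fineK//; exact: integrable_fin_num.
Qed.

Lemma hasE_pos f u : hasE f u -> exists v, hasE (fun w => Num.max (f w) 0) v.
Proof.
move=> fu; have mf := hasE_meas fu.
have [v nv] : exists v, hasE (fun w => `|f w|) v.
  exists (fine (\int[P]_w (`|f w|)%:E)).
  have [fi _] := fu; have fi' : P.-integrable setT (EFin \o (fun w => `|f w|)).
    by apply: eq_integrable (integrable_abse fi).
  by split => //; rewrite fineK//; exact: integrable_fin_num.
apply: hasE_dom nv _ => [|w].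
  by apply: measurable_maxr => //; exact: measurable_cst.
rewrite ger0_norm ?le_max ?lexx ?orbT// ge_max normr_ge0 andbT.
exact: ler_norm.
Qed.

Lemma hasE_ge0_integral f u : measurable_fun setT f -> (forall w, 0 <= f w) ->
  (\int[P]_w (f w)%:E = u%:E)%E -> hasE f u.
Proof.
move=> mf f0 fu; split => //; apply/integrableP; split; first exact/measurable_EFinP.
rewrite (eq_integral (fun w => (f w)%:E)); first by rewrite fu ltry.
by move=> w _ /=; rewrite ger0_norm.
Qed.

(** A product is dominated by the sum of the squares. *)
Lemma hasE_mulL2 f g u v : measurable_fun setT f -> measurable_fun setT g ->
  hasE (fun w => f w ^+ 2) u -> hasE (fun w => g w ^+ 2) v ->
  exists e, hasE (fun w => f w * g w) e.
Proof.
move=> mf mg fu gv; apply: hasE_dom (hasED fu gv) _ => [|w].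
  exact: measurable_funM.
rewrite ler_norml; set a := f w; set b := g w.
have := sqr_ge0 (a + b); have := sqr_ge0 (a - b); have := sqr_ge0 a; have := sqr_ge0 b.
by move=> *; apply/andP; split; nra.
Qed.

(** Pythagoras. *)
Lemma hasE_orthogonal (I : finType) (phi : I -> T -> R) (c : I -> R) (v : I -> R) :
  (forall p q, hasE (fun w => phi p w * phi q w) (if p == q then v p else 0)) ->
  hasE (fun w => (\sum_p c p * phi p w) ^+ 2) (\sum_p c p ^+ 2 * v p).
Proof.
move=> h; apply: (@hasE_ext (fun w => \sum_p \sum_q (c p * c q) * (phi p w * phi q w))).
  move=> w; rewrite expr2 mulr_suml; apply: eq_bigr => p _.
  by rewrite mulr_sumr; apply: eq_bigr => q _; ring.
apply: hasE_sum => p.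
have -> : c p ^+ 2 * v p = \sum_q (c p * c q) * (if p == q then v p else 0).
  rewrite (bigD1 p)//= eqxx big1 ?addr0 ?expr2// => q qp.
  by rewrite eq_sym (negPf qp) mulr0.
by apply: hasE_sum => q; apply: hasEZ.
Qed.

End expectation_calculus.

Section independent_products.
Context (d : measure_display) (T : measurableType d) (R : realType)
  (P : probability T R) (I : choiceType) (X : I -> {RV P >-> R}).
Hypothesis X_indep : independent_RVs P X.
Variables (S S' : set I).
Hypothesis SS' : S `&` S' = set0.

Let ge0_hasE_mul (f : sub_sigma X S -> R) (g : sub_sigma X S' -> R) u v :
  measurable_fun setT f -> measurable_fun setT g ->
  (forall w, 0 <= f w) -> (forall w, 0 <= g w) ->
  hasE P f u -> hasE P g v -> hasE P (fun w => f w * g w) (u * v).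
Proof.
move=> mf mg f0 g0 fu gv; apply: hasE_ge0_integral.
- by apply: measurable_funM; [exact: hasE_meas fu|exact: hasE_meas gv].
- by move=> w; rewrite mulr_ge0.
rewrite (ge0_indep_decouple X_indep SS' (F := fun z => (f z.1 * g z.2)%:E)); last 2 first.
- apply/measurable_EFinP; apply: measurable_funM.
    by apply: measurableT_comp mf _.
  by apply: measurableT_comp mg _.
- by move=> z; rewrite lee_fin mulr_ge0.
transitivity (\int[P]_w (v * f w)%:E)%E; last by have [_ ->] := hasEZ v fu; rewrite mulrC.
apply: eq_integral => w _ /=.
by have [_ ->] := hasEZ (f w) gv; rewrite mulrC.
Qed.

(** The nonnegative case is decoupling; the general case follows by splitting
    both factors into positive and negative parts. *)
Lemma hasE_mul (f : sub_sigma X S -> R) (g : sub_sigma X S' -> R) u v :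
  measurable_fun setT f -> measurable_fun setT g ->
  hasE P f u -> hasE P g v -> hasE P (fun w => f w * g w) (u * v).
Proof.
move=> mf mg fu gv.
have pm (h : R) : h = Num.max h 0 + (-1) * Num.max (- 1 * h) 0.
  rewrite !mulN1r; have [h0|/ltW h0] := leP h 0.
    by rewrite max_l ?oppr_ge0// add0r opprK.
  by rewrite max_r ?oppr_le0// oppr0 addr0.
have [fp hfp] := hasE_pos fu; have [fn hfn] := hasE_pos (hasEZ (-1) fu).
have [gp hgp] := hasE_pos gv; have [gn hgn] := hasE_pos (hasEZ (-1) gv).
have mpos (d0 : measure_display) (O : measurableType d0) (h : O -> R) :
    measurable_fun setT h -> measurable_fun setT (fun w => Num.max (h w) 0).
  by move=> mh; apply: measurable_maxr => //; exact: measurable_cst.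
have mneg (d0 : measure_display) (O : measurableType d0) (h : O -> R) :
    measurable_fun setT h -> measurable_fun setT (fun w => Num.max (-1 * h w) 0).
  by move=> mh; apply: mpos; apply: measurable_funM => //; exact: measurable_cst.
have pos (h : R) : 0 <= Num.max h 0 by rewrite le_max lexx orbT.
have uE : u = fp + (-1) * fn.
  apply: (hasE_unique fu); apply: hasE_ext (hasED hfp (hasEZ (-1) hfn)) => w.
  by rewrite -pm.
have vE : v = gp + (-1) * gn.
  apply: (hasE_unique gv); apply: hasE_ext (hasED hgp (hasEZ (-1) hgn)) => w.
  by rewrite -pm.
have h1 := ge0_hasE_mul (mpos _ _ _ mf) (mpos _ _ _ mg) (fun w => pos _) (fun w => pos _) hfp hgp.
have h2 := ge0_hasE_mul (mneg _ _ _ mf) (mpos _ _ _ mg) (fun w => pos _) (fun w => pos _) hfn hgp.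
have h3 := ge0_hasE_mul (mpos _ _ _ mf) (mneg _ _ _ mg) (fun w => pos _) (fun w => pos _) hfp hgn.
have h4 := ge0_hasE_mul (mneg _ _ _ mf) (mneg _ _ _ mg) (fun w => pos _) (fun w => pos _) hfn hgn.
have -> : u * v = (fp * gp + (-1) * (fn * gp)) + ((-1) * (fp * gn) + fn * gn).
  by rewrite uE vE; ring.
apply: hasE_ext (hasED (hasED h1 (hasEZ (-1) h2)) (hasED (hasEZ (-1) h3) h4)) => w /=.
by rewrite [in RHS](pm (f w)) [in RHS](pm (g w)); ring.
Qed.

End independent_products.

(** * Entries and quadratic forms of one row *)

Section entries.
Context (d : measure_display) (T : measurableType d) (R : realType)
  (P : probability T R) (I : choiceType) (X : I -> {RV P >-> R}) (sigma : R).
Hypothesis X_indep : independent_RVs P X.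
Hypothesis X_idist : identically_distributed P X.
Hypothesis X_mean : forall j, ('E_P[X j] = 0)%E.
Hypothesis X_var : forall j, ('V_P[X j] = (sigma ^+ 2)%:E)%E.

Lemma hasE_sqr j : hasE P (fun w => X j w ^+ 2) (sigma ^+ 2).
Proof.
apply: hasE_ge0_integral => [|w|].
- exact: measurable_funX.
- exact: sqr_ge0.
rewrite -(X_var j) /variance covariance.unlock X_mean expectation.unlock.
by apply: eq_integral => w _; rewrite /= mulrfctE /= subr0 expr2.
Qed.

Lemma hasE_entry j : hasE P (X j) 0.
Proof.
have [u hu] : exists u, hasE P (X j) u.
  apply: hasE_dom (hasED (hasE_cst P 1) (hasE_sqr j)) _ => [|w]; first by [].
  rewrite ler_norml; set a := X j w.
  by have := sqr_ge0 (a + 1); have := sqr_ge0 (a - 1); move=> *; apply/andP; split; nra.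
have := X_mean j; rewrite expectation.unlock; have [_ ->] := hu.
by case=> u0; rewrite u0 in hu.
Qed.

(** Identical distribution is used through integrals of nonnegative functions
    only. *)
Lemma identically_distributed_integral (h : R -> R) i j :
  measurable_fun setT h -> (forall x, 0 <= h x) ->
  (\int[P]_w (h (X i w))%:E = \int[P]_w (h (X j w))%:E)%E.
Proof.
move=> mh h0.
have mh' : measurable_fun [set: R] (EFin \o h) by exact/measurable_EFinP.
have h0' y : (0 <= (EFin \o h) y)%E by rewrite lee_fin.
transitivity (\int[distribution P (X i)]_x (h x)%:E)%E.
  by rewrite (ge0_integral_distribution _ mh' h0').
transitivity (\int[distribution P (X j)]_x (h x)%:E)%E.
  by apply: eq_measure_integral => A mA _; exact: X_idist.
by rewrite (ge0_integral_distribution _ mh' h0').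
Qed.

(** Truncating the square, and not the entry, keeps the truncated quantity below
    the original one, which preserves lower bounds on positive quadratic forms. *)
Definition cut_sqr (K x : R) : R := Num.min (x ^+ 2) K.

Lemma measurable_cut_sqr K : measurable_fun setT (cut_sqr K).
Proof.
apply: measurable_minr; last exact: measurable_cst.
exact: measurable_funX.
Qed.

Lemma cut_sqr_ge0 K x : 0 <= K -> 0 <= cut_sqr K x.
Proof. by move=> K0; rewrite /cut_sqr le_min sqr_ge0. Qed.

Lemma cut_sqr_le K x : cut_sqr K x <= x ^+ 2.
Proof. by rewrite /cut_sqr ge_min lexx. Qed.

Lemma cut_sqr_leK K x : cut_sqr K x <= K.
Proof. by rewrite /cut_sqr ge_min lexx orbT. Qed.

Lemma hasE_cut_sqr K : 0 <= K ->
  exists s, forall j, hasE P (fun w => cut_sqr K (X j w)) s.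
Proof.
move=> K0; have [[i _]|nI] := pselect (exists i : I, True); last first.
  by exists 0 => j; exfalso; apply: nI; exists j.
have mc j : measurable_fun setT (fun w => cut_sqr K (X j w)).
  by apply: measurableT_comp => //; exact: measurable_cut_sqr.
have [s hs] : exists s, hasE P (fun w => cut_sqr K (X i w)) s.
  apply: hasE_dom (hasE_cst P K) _ => // w.
  by rewrite ger0_norm ?cut_sqr_ge0// cut_sqr_leK.
exists s => j; apply: hasE_ge0_integral => //; first by move=> w; exact: cut_sqr_ge0.
have [_ <-] := hs; apply: identically_distributed_integral; first exact: measurable_cut_sqr.
by move=> x; exact: cut_sqr_ge0.
Qed.

(** Monotone convergence as the truncation level grows.  The expectation [s] is
    common to all entries because they have the same law. *)
Lemma cut_sqr_approx (j0 : I) (eps : R) : 0 < eps ->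
  exists K s, [/\ 0 <= K, sigma ^+ 2 - eps <= s &
    forall j, hasE P (fun w => cut_sqr K (X j w)) s].
Proof.
move=> e0.
pose g (n : nat) w := (cut_sqr n%:R (X j0 w))%:E.
have mg n : measurable_fun setT (g n).
  apply/measurable_EFinP; apply: measurableT_comp => //; exact: measurable_cut_sqr.
have gE : (\int[P]_w limn (g^~ w) = (sigma ^+ 2)%:E)%E.
  have [_ <-] := hasE_sqr j0; apply: eq_integral => w _.
  apply/cvg_lim => //; apply: cvg_near_cst; near=> n.
  rewrite /g /cut_sqr min_l//; near: n; exact: nbhs_infty_ger.
have : (\int[P]_w g n w @[n --> \oo] --> (sigma ^+ 2)%:E)%E.
  rewrite -gE; apply: cvg_monotone_convergence => //.
    by move=> n w _; rewrite lee_fin cut_sqr_ge0.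
  move=> w _ a b ab; rewrite lee_fin /cut_sqr le_min ge_min lexx/= ge_min.
  by rewrite ler_nat ab orbT.
move/fine_cvgP => [_ cv].
have lt_e : sigma ^+ 2 - eps < sigma ^+ 2 by rewrite ltrBlDr ltrDl.
have [N _ /(_ N (leqnn N)) /= hN] := cvgr_gt _ cv _ lt_e.
have [s hs] := hasE_cut_sqr (ler0n R N).
exists N%:R, s; split => //.
by move: hN; rewrite /g; have [_ ->] := hs j0; move/ltW.
Unshelve. all: by end_near.
Qed.

(** An entry is centered and independent of any function of the others. *)
Lemma hasE_entry_mul a (g : sub_sigma X [set k | k != a] -> R) v :
  measurable_fun setT g -> hasE P g v -> hasE P (fun w => X a w * g w) 0.
Proof.
move=> mg gv; rewrite -[0](mul0r v).
apply: (hasE_mul X_indep (S := [set a]) (S' := [set k | k != a])) => //.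
- by apply/seteqP; split => k //= [-> /eqP].
- exact: measurable_coord.
- exact: hasE_entry.
Qed.

Lemma hasE_entry2 a b : hasE P (fun w => X a w * X b w) (if a == b then sigma ^+ 2 else 0).
Proof.
case: eqVneq => [->|ab].
  by apply: hasE_ext (hasE_sqr b) => w; rewrite expr2.
apply: hasE_entry_mul (hasE_entry b).
by apply: measurable_coord; rewrite /= eq_sym.
Qed.

Lemma hasE_sqr_mul a b : a != b ->
  hasE P (fun w => (X a w * X b w) ^+ 2) (sigma ^+ 4).
Proof.
move=> ab; rewrite (_ : sigma ^+ 4 = sigma ^+ 2 * sigma ^+ 2); last by rewrite -exprD.
apply: hasE_ext (_ : hasE P (fun w => X a w ^+ 2 * X b w ^+ 2) _).
  by move=> w; rewrite exprMn.
apply: (hasE_mul X_indep (S := [set a]) (S' := [set b])) => //.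
- by apply/seteqP; split => k //= [-> e]; rewrite e eqxx in ab.
- by apply: measurable_funX; exact: measurable_coord.
- by apply: measurable_funX; exact: measurable_coord.
- exact: hasE_sqr.
- exact: hasE_sqr.
Qed.

(** Four-fold moments in which the first entry occurs once; they are what is
    needed for the orthogonality of off-diagonal products, and require no
    fourth moment of an entry. *)
Lemma hasE_entry4 a b c e : c != e -> a != b -> a != c -> a != e ->
  hasE P (fun w => X a w * (X b w * (X c w * X e w))) 0.
Proof.
move=> ce ab ac ae.
have [v hv] : exists v, hasE P (fun w => X b w * (X c w * X e w)) v.
  apply: (hasE_mulL2 _ _ (hasE_sqr b) (hasE_sqr_mul ce)) => //.
  exact: measurable_funM.
apply: hasE_entry_mul hv.
by do 2?apply: measurable_funM; apply: measurable_coord; rewrite /= eq_sym.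
Qed.

End entries.

Section row.
Context (d : measure_display) (T : measurableType d) (R : realType)
  (P : probability T R) (X : nat * nat -> {RV P >-> R}) (sigma : R).
Hypothesis X_indep : independent_RVs P X.
Hypothesis X_mean : forall j, ('E_P[X j] = 0)%E.
Hypothesis X_var : forall j, ('V_P[X j] = (sigma ^+ 2)%:E)%E.
Variables (i m : nat).

Let r (a : 'I_m) w := X (i, nat_of_ord a) w.
Let x w := fun ij => X ij w.

Let ne (a b : 'I_m) : a != b -> (i, nat_of_ord a) != (i, nat_of_ord b).
Proof. by apply: contra_neq => -[]/val_inj. Qed.

Let eqi (a b : 'I_m) : ((i, nat_of_ord a) == (i, nat_of_ord b)) = (a == b).
Proof. by apply/eqP/eqP => [[/val_inj]|->]. Qed.

Lemma row_formE (B : 'M[R]_m) w :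
  (row_vec (x w) i m *m B *m (row_vec (x w) i m)^T) 0 0 =
  \sum_a \sum_b B a b * (r a w * r b w).
Proof.
rewrite -mulmxA mxE; apply: eq_bigr => a _; rewrite !mxE mulr_sumr.
by apply: eq_bigr => b _; rewrite !mxE /r /x; ring.
Qed.

Lemma hasE_row_form (B : 'M[R]_m) :
  hasE P (fun w => (row_vec (x w) i m *m B *m (row_vec (x w) i m)^T) 0 0)
    (sigma ^+ 2 * \tr B).
Proof.
apply: (@hasE_ext _ _ _ _ (fun w => \sum_a \sum_b B a b * (r a w * r b w))).
  by move=> w; rewrite row_formE.
rewrite /mxtrace mulr_sumr; apply: hasE_sum => a.
have -> : sigma ^+ 2 * B a a = \sum_b B a b * (if a == b then sigma ^+ 2 else 0).
  rewrite (bigD1 a)//= eqxx big1 ?addr0 1?mulrC// => b ba.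
  by rewrite eq_sym (negPf ba) mulr0.
apply: hasE_sum => b; apply: hasEZ.
by have := hasE_entry2 X_indep X_mean X_var (i, nat_of_ord a) (i, nat_of_ord b); rewrite eqi.
Qed.

(* products of two distinct entries, each pair counted once: an orthogonal
   family with second moment [sigma ^+ 4] *)
Let phi (p : 'I_m * 'I_m) w := if (p.1 < p.2)%N then r p.1 w * r p.2 w else 0.

Let hasE_phi p q : hasE P (fun w => phi p w * phi q w)
  (if p == q then (if (p.1 < p.2)%N then sigma ^+ 4 else 0) else 0).
Proof.
move: p q => [a b] [c e]; rewrite /phi /=.
have [ab|ab] := ltnP a b; last first.
  by rewrite if_same; under eq_fun do rewrite mul0r; exact: hasE_cst.
have [ce|ce] := ltnP c e; last first.
  under eq_fun do rewrite mulr0; rewrite ifF; first exact: hasE_cst.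
  by apply/negP => /eqP[ac be]; rewrite ac be ltnNge ce in ab.
have nab : a != b by apply: contraTneq ab => ->; rewrite ltnn.
have nce : c != e by apply: contraTneq ce => ->; rewrite ltnn.
have E4 (a' b' c' e' : 'I_m) : c' != e' -> a' != b' -> a' != c' -> a' != e' ->
    hasE P (fun w => r a' w * (r b' w * (r c' w * r e' w))) 0.
  by move=> /ne h1 /ne h2 /ne h3 /ne h4; exact: (hasE_entry4 X_indep X_mean X_var).
case: eqVneq => [[-> ->]|npq].
  apply: hasE_ext (hasE_sqr_mul X_indep X_mean X_var (ne nce)) => w.
  by rewrite expr2.
have [be|nbe] := eqVneq b e.
  have nac : a != c by apply: contra_neq npq => ->; rewrite be.
  apply: hasE_ext (E4 a b c e nce nab nac _) => [w|]; first ring.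
  by rewrite -be.
have [bc|nbc] := eqVneq b c.
  have nea : e != a.
    by apply: contraTneq ab => <-; rewrite bc -leqNgt ltnW.
  apply: hasE_ext (E4 e c a b nab _ nea _) => [w||]; [ring|by rewrite eq_sym|].
  by rewrite eq_sym.
apply: hasE_ext (E4 b a c e nce _ nbc nbe) => [w|]; first ring.
by rewrite eq_sym.
Qed.

Variables (K s : R).
Hypothesis K_ge0 : 0 <= K.
Hypothesis hs : forall j, hasE P (fun w => cut_sqr K (X j w)) s.

Let s_ge0 : 0 <= s.
Proof. by apply: hasE_ge0 (hs (0, 0)) _ => w; exact: cut_sqr_ge0. Qed.

Let s_leK : s <= K.
Proof. by apply: hasE_le (hs (0, 0)) (hasE_cst P K) _ => w; exact: cut_sqr_leK. Qed.

(* centered truncated squares: independent, centered and bounded *)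
Let tau (a : 'I_m) w := cut_sqr K (r a w) - s.

Let measurable_tau a : measurable_fun (setT : set (sub_sigma X [set (i, nat_of_ord a)])) (tau a).
Proof.
apply: measurable_funB; last exact: measurable_cst.
apply: measurableT_comp; first exact: measurable_cut_sqr.
exact: measurable_coord.
Qed.

Let tau_bound a w : tau a w ^+ 2 <= K ^+ 2.
Proof.
have := cut_sqr_ge0 (r a w) K_ge0; have := cut_sqr_leK K (r a w).
by rewrite /tau; have := s_ge0; have := s_leK; set c := cut_sqr _ _; nra.
Qed.

Let hasE_tau0 a : hasE P (tau a) 0.
Proof.
rewrite -(subrr s); rewrite -[X in _ - X]mul1r -mulNr.
by apply: hasE_ext (hasED (hs (i, nat_of_ord a)) (hasEZ (-1) (hasE_cst P s))) => w; rewrite mulN1r.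
Qed.

Let hasE_tau : exists v : 'I_m -> R, (forall a, v a <= K ^+ 2) /\
  forall a b, hasE P (fun w => tau a w * tau b w) (if a == b then v a else 0).
Proof.
have ex (a : 'I_m) : exists v, hasE P (fun w => tau a w * tau a w) v.
  apply: hasE_dom (hasE_cst P (K ^+ 2)) _ => [|w].
    by apply: measurable_funM; exact: hasE_meas (hasE_tau0 a).
  by rewrite ger0_norm -expr2 ?sqr_ge0// tau_bound.
have [v hv] := choice ex; exists v; split => [a|a b].
  apply: hasE_le (hv a) (hasE_cst P (K ^+ 2)) _ => w.
  by rewrite -expr2 tau_bound.
case: eqVneq => [<-//|/ne nab].
rewrite -[0](mul0r 0).
apply: (hasE_mul X_indep (S := [set (i, nat_of_ord a)]) (S' := [set (i, nat_of_ord b)])).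
- by apply/seteqP; split => k //= [-> e]; rewrite e eqxx in nab.
- exact: measurable_tau.
- exact: measurable_tau.
- exact: hasE_tau0.
- exact: hasE_tau0.
Qed.

(** Second-order expansion of [1 / y] at [mu], with an error that remains
    integrable because [y] is bounded below by [A].  The lower bound [Q'] of [Q]
    may be negative: where [A + Q'] falls below [A], the bound [1 / A] is used
    instead. *)
Lemma invD_le_quadratic (A Q Q' mu : R) : 0 < A -> A <= mu -> 0 <= Q -> Q' <= Q ->
  (A + Q)^-1 <= mu^-1 - (A + Q' - mu) / mu ^+ 2 + (A + Q' - mu) ^+ 2 / (A * mu ^+ 2).
Proof.
move=> A0 Amu Q0 Q'Q; have mu0 : 0 < mu by apply: lt_le_trans Amu.
set y := A + Q'.
have -> : mu^-1 - (y - mu) / mu ^+ 2 + (y - mu) ^+ 2 / (A * mu ^+ 2) =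
   (A * (2 * mu - y) + (y - mu) ^+ 2) / (A * mu ^+ 2).
  by field; rewrite !gt_eqF.
rewrite ler_pdivlMr ?mulr_gt0 ?exprn_gt0// mulrC.
have AQ : A <= A + Q by rewrite lerDl.
have AQ0 : 0 < A + Q by apply: lt_le_trans AQ.
have yQ : y <= A + Q by rewrite lerD2l.
have Amu0 : 0 <= A * mu ^+ 2 by rewrite mulr_ge0 ?sqr_ge0// ltW.
have [Ay|yA] := leP A y.
  have y0 : 0 < y by apply: lt_le_trans Ay.
  apply: (@le_trans _ _ (A * mu ^+ 2 / y)).
    by rewrite ler_wpM2l// lef_pV2 ?posrE.
  rewrite ler_pdivrMr// -subr_ge0.
  have -> : (A * (2 * mu - y) + (y - mu) ^+ 2) * y - A * mu ^+ 2 = (y - A) * (y - mu) ^+ 2.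
    by ring.
  by rewrite mulr_ge0 ?sqr_ge0// subr_ge0.
apply: (@le_trans _ _ (A * mu ^+ 2 / A)).
  by rewrite ler_wpM2l// lef_pV2 ?posrE.
rewrite mulrAC divff ?gt_eqF// mul1r -subr_ge0.
have -> : A * (2 * mu - y) + (y - mu) ^+ 2 - mu ^+ 2 = (A - y) * (2 * mu - y) by ring.
rewrite mulr_ge0 ?subr_ge0 ?ltW//; lra.
Qed.

(** Bounds the variance of the truncated row form per unit of squared Frobenius
    norm: off-diagonal products contribute [sigma ^+ 4] and diagonal terms at
    most [K ^+ 2]; the factors account for the two orders of a pair and for
    [(u + v) ^+ 2 <= 2 * (u ^+ 2 + v ^+ 2)]. *)
Definition row_variance := 8 * sigma ^+ 4 + 2 * K ^+ 2.

Lemma row_variance_ge0 : 0 <= row_variance.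
Proof.
have s4 : 0 <= sigma ^+ 4 by rewrite (exprM sigma 2 2) sqr_ge0.
by rewrite /row_variance addr_ge0// mulr_ge0// sqr_ge0.
Qed.

(** The row form is bounded below by its off-diagonal part plus the diagonal with
    truncated squares.  This lower bound has mean [s \tr B / m] and small
    variance, so the quadratic bound on the inverse has an expectation close to
    the inverse [mu^-1] of the mean. *)
Lemma row_form_inv_le (B : 'M[R]_m) (A V mu : R) : 0 < A ->
  (forall a b, B a b = B b a) ->
  (forall u : 'rV[R]_m, 0 <= (u *m B *m u^T) 0 0) ->
  (forall a, 0 <= B a a) ->
  \sum_a \sum_b B a b ^+ 2 <= V ->
  mu = A + s * (m%:R^-1 * \tr B) ->
  (\int[P]_w ((A + m%:R^-1 * (row_vec (x w) i m *m B *m (row_vec (x w) i m)^T) 0 0)^-1)%:E <=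
    (mu^-1 * (1 + m%:R^-1 ^+ 2 * row_variance * V / (A * mu)))%:E)%E.
Proof.
move=> A0 symB psdB diagB BV muE.
have [v [vK tauE]] := hasE_tau.
have im0 : 0 <= m%:R^-1 :> R by rewrite invr_ge0 ler0n.
have trB0 : 0 <= \tr B by apply: sumr_ge0 => a _.
have Amu : A <= mu by rewrite muE lerDl !mulr_ge0.
have mu0 : 0 < mu by apply: lt_le_trans Amu.
pose c (p : 'I_m * 'I_m) := 2 * B p.1 p.2.
pose off w := \sum_p c p * phi p w.
pose dia w := \sum_a B a a * tau a w.
have formE w : (row_vec (x w) i m *m B *m (row_vec (x w) i m)^T) 0 0 =
    off w + \sum_a B a a * r a w ^+ 2.
  rewrite row_formE.
  pose F (a b : 'I_m) := if (a < b)%N then B a b * (r a w * r b w) else 0.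
  have -> : off w = \sum_a \sum_b F a b + \sum_a \sum_b F b a.
    rewrite [X in _ = _ + X]exchange_big /= pair_big /= -big_split.
    by apply: eq_bigr => -[a b] _; rewrite /c /phi /F /=; case: ifP => _; ring.
  rewrite -!big_split; apply: eq_bigr => a _ /=.
  rewrite -big_split /= (bigD1 a)//= [X in _ = X + _](bigD1 a)//= /F ltnn.
  rewrite -expr2 !add0r addrC; congr (_ + _); apply: eq_bigr => b ba.
  have [ab|ba'|/val_inj e] := ltngtP a b; last by rewrite e eqxx in ba.
    by rewrite addr0.
  by rewrite add0r symB mulrC (mulrC (r b w)) mulrC.
have hoff : hasE P off 0.
  have <- : \sum_(p : 'I_m * 'I_m) (0 : R) = 0 by rewrite big1.
  apply: hasE_sum => -[a b]; rewrite -[0](mulr0 (c (a, b))); apply: hasEZ.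
  rewrite /phi /=; case: ltnP => ab; last exact: hasE_cst.
  have := hasE_entry2 X_indep X_mean X_var (i, nat_of_ord a) (i, nat_of_ord b).
  by rewrite eqi ifF//; apply: contraTF ab => /eqP ->; rewrite ltnn.
have hoff2 := hasE_orthogonal c hasE_phi.
have hdia2 := hasE_orthogonal (fun a => B a a) tauE.
have hdia : hasE P dia 0.
  have <- : \sum_(a < m) (0 : R) = 0 by rewrite big1.
  by apply: hasE_sum => a; rewrite -[0](mulr0 (B a a)); exact: hasEZ.
pose k2 := 2 * m%:R^-1 ^+ 2 / (A * mu ^+ 2).
pose k1 := - (m%:R^-1 / mu ^+ 2).
have hG := hasED (hasE_cst P mu^-1)
  (hasED (hasEZ k1 (hasED hoff hdia)) (hasEZ k2 (hasED hoff2 hdia2))).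
apply: (@le_trans _ _ (mu^-1 + (k1 * (0 + 0) +
  k2 * (\sum_p c p ^+ 2 * (if (p.1 < p.2)%N then sigma ^+ 4 else 0) +
        \sum_a B a a ^+ 2 * v a)))%:E); last first.
  rewrite lee_fin addr0 mulr0 add0r [leRHS]mulrDr mulr1 lerD2l.
  have -> : mu^-1 * (m%:R^-1 ^+ 2 * row_variance * V / (A * mu)) =
     k2 * (4 * sigma ^+ 4 * V + K ^+ 2 * V).
    by rewrite /k2 /row_variance; set z := m%:R^-1; field; rewrite !gt_eqF.
  apply: ler_wpM2l.
    by rewrite /k2 !mulr_ge0// ?invr_ge0 ?mulr_ge0 ?sqr_ge0// ltW.
  apply: lerD.
    apply: (@le_trans _ _ (4 * sigma ^+ 4 * \sum_a \sum_b B a b ^+ 2)); last first.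
      by rewrite ler_wpM2l// mulr_ge0// (exprM sigma 2 2) sqr_ge0.
    rewrite pair_big /= mulr_sumr; apply: ler_sum => -[a b] _ /=.
    rewrite /c /= exprMn; have s4 : 0 <= sigma ^+ 4 by rewrite (exprM sigma 2 2) sqr_ge0.
    have b2 := sqr_ge0 (B a b).
    case: ifP => _; first by rewrite le_eqVlt; apply/orP; left; apply/eqP; ring.
    by rewrite mulr0 mulr_ge0// mulr_ge0.
  apply: (@le_trans _ _ (K ^+ 2 * \sum_a \sum_b B a b ^+ 2)); last first.
    by rewrite ler_wpM2l// sqr_ge0.
  rewrite mulr_sumr; apply: ler_sum => a _; rewrite mulrC.
  apply: ler_pM; rewrite ?sqr_ge0//; last first.
    by rewrite (bigD1 a)//= lerDl; apply: sumr_ge0 => b _; exact: sqr_ge0.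
  by have := hasE_ge0 (tauE a a); rewrite eqxx => h; apply: h => w; rewrite -expr2 sqr_ge0.
have [iG <-] := hG.
have invE w : 0 < A + m%:R^-1 * (row_vec (x w) i m *m B *m (row_vec (x w) i m)^T) 0 0.
  by rewrite ltr_wpDr// mulr_ge0.
apply: ge0_le_integral => //.
- by move=> w _; rewrite lee_fin invr_ge0 ltW.
- apply/measurable_EFinP; apply: measurable_funV_gt0 invE.
  by apply: measurable_funD => //; apply: measurable_funM => //;
    apply: (hasE_meas (hasE_row_form B)).
- exact: (measurable_int _ iG).
move=> w _; rewrite lee_fin.
set Q := m%:R^-1 * _.
pose Q' := m%:R^-1 * (off w + \sum_a B a a * cut_sqr K (r a w)).
have Q'Q : Q' <= Q.
  rewrite /Q /Q' formE ler_wpM2l// lerD2l; apply: ler_sum => a _.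
  by rewrite ler_wpM2l// cut_sqr_le.
apply: le_trans (invD_le_quadratic A0 Amu _ Q'Q) _; first by rewrite mulr_ge0.
have -> : A + Q' - mu = m%:R^-1 * (off w + dia w).
  have -> : dia w = \sum_a B a a * cut_sqr K (r a w) - s * \tr B.
    rewrite /dia /mxtrace mulr_sumr -sumrB; apply: eq_bigr => a _.
    by rewrite /tau mulrBr (mulrC s).
  by rewrite /Q' muE; ring.
have -> : mu^-1 - m%:R^-1 * (off w + dia w) / mu ^+ 2 = mu^-1 + k1 * (off w + dia w).
  by rewrite /k1; ring.
rewrite -addrA lerD2l lerD2l exprMn /k2.
have -> : 2 * m%:R^-1 ^+ 2 / (A * mu ^+ 2) * (off w ^+ 2 + dia w ^+ 2) =
  m%:R^-1 ^+ 2 * (2 * (off w ^+ 2 + dia w ^+ 2)) / (A * mu ^+ 2) by ring.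
rewrite ler_wpM2r// ?invr_ge0 ?mulr_ge0 ?sqr_ge0 ?(ltW A0) ?(ltW mu0)//.
rewrite ler_wpM2l ?sqr_ge0// -subr_ge0.
have -> : 2 * (off w ^+ 2 + dia w ^+ 2) - (off w + dia w) ^+ 2 = (off w - dia w) ^+ 2 by ring.
exact: sqr_ge0.
Qed.

End row.

(** * Expectation of the coefficients and of their inverses *)

Section laguerre.
Context (R : realType).

(** The expectation of [ecoef 0] for entries of variance [s]; up to scaling
    these are the coefficients of a Laguerre polynomial. *)
Definition laguerre_coef (s : R) (m i l : nat) : R :=
  'C(i, l)%:R * ((m ^_ l)%:R / m%:R ^+ l) * s ^+ l.

Lemma laguerre_coef0 s m i : laguerre_coef s m i 0 = 1.
Proof. by rewrite /laguerre_coef bin0 ffactn0 expr0 divr1 !mulr1. Qed.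

Lemma laguerre_coef_ge0 s m i l : 0 <= s -> 0 <= laguerre_coef s m i l.
Proof.
by move=> s0; rewrite /laguerre_coef !mulr_ge0 ?ler0n ?exprn_ge0// invr_ge0 exprn_ge0.
Qed.

(** The recursion satisfied by [ecoef] on average, as the trace of the row form
    is [(m - l)] times the previous coefficient. *)
Lemma laguerre_coefS s m i l : (l < m)%N -> laguerre_coef s m i.+1 l.+1 =
  laguerre_coef s m i l.+1 + s * (m%:R^-1 * (m - l)%:R) * laguerre_coef s m i l.
Proof.
move=> lm; rewrite /laguerre_coef binS natrD ffactnSr natrM !exprS invfM.
by ring.
Qed.

End laguerre.

Section ecoef_expectation.
Context (d : measure_display) (T : measurableType d) (R : realType)
  (P : probability T R) (X : nat * nat -> {RV P >-> R}) (sigma : R).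
Hypothesis X_indep : independent_RVs P X.
Hypothesis X_mean : forall j, ('E_P[X j] = 0)%E.
Hypothesis X_var : forall j, ('V_P[X j] = (sigma ^+ 2)%:E)%E.
Variable m : nat.

Let x w := fun ij => X ij w.
(* indices of the rows before row [i], and of row [i] itself *)
Let past i := [set ij : nat * nat | (ij.1 < i)%N].
Let present i := [set ij : nat * nat | ij.1 = i].

Let past_present i : past i `&` present i = set0.
Proof. by apply/seteqP; split => // -[a b] [/= ai e]; move: ai; rewrite /past /present /= in e *; rewrite e ltnn. Qed.

Let mfst i ij : past i ij -> measurable_fun setT
  (fun z : sub_sigma X (past i) * sub_sigma X (present i) => X ij z.1).
Proof. by move=> h; exact: (measurableT_comp (measurable_coord (X := X) (S := past i) h) measurable_fst). Qed.

Let msnd i ij : present i ij -> measurable_fun setT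
  (fun z : sub_sigma X (past i) * sub_sigma X (present i) => X ij z.2).
Proof. by move=> h; exact: (measurableT_comp (measurable_coord (X := X) (S := present i) h) measurable_snd). Qed.

Let measurable_past_ecoef eta i l :
  measurable_fun (setT : set (sub_sigma X (past i))) (fun w => ecoef eta (x w) m i l).
Proof. by apply: measurable_ecoef => a b ai bm; exact: measurable_coord. Qed.

Let measurable_joint_ecoef eta i l : measurable_fun setT
  (fun z : sub_sigma X (past i) * sub_sigma X (present i) => ecoef eta (x z.1) m i l).
Proof. by apply: measurable_ecoef => a b ai bm; exact: mfst. Qed.

Let measurable_joint_form eta i l : measurable_fun setT
  (fun z : sub_sigma X (past i) * sub_sigma X (present i) =>
    (row_vec (x z.2) i m *m row_form eta (x z.1) m i l *m (row_vec (x z.2) i m)^T) 0 0).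
Proof.
under eq_fun do rewrite row_formE.
apply: measurable_sum => a; apply: measurable_sum => b; apply: measurable_funM.
  apply: measurable_row_form => c e ci em; exact: mfst.
by apply: measurable_funM; exact: msnd.
Qed.

Lemma measurable_ecoefT eta i l : measurable_fun setT (fun w => ecoef eta (x w) m i l).
Proof. by apply: measurable_ecoef => a b ai bm; exact: measurable_funPT. Qed.

(** Average the row recursion [ecoefS] over the new row, with the earlier rows
    fixed, and use the trace of the row form. *)
Lemma hasE_ecoef i l : (l <= m)%N ->
  hasE P (fun w => ecoef 0 (x w) m i l) (laguerre_coef (sigma ^+ 2) m i l).
Proof.
elim: i l => [|i IH] [|l] lm; rewrite ?laguerre_coef0; do ?
  by apply: (@hasE_ext _ _ _ _ (fun=> 1)) => [w|]; [rewrite ecoef0|exact: hasE_cst].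
  rewrite /laguerre_coef bin0n !mul0r; apply: (@hasE_ext _ _ _ _ (fun=> 0)); last exact: hasE_cst.
  move=> w; rewrite /ecoef lm /gram_mx /shifted_gram.
  have -> : (data_mx (x w) 0 m)^T *m data_mx (x w) 0 m = 0.
    by apply/matrixP => a b; rewrite !mxE big_ord0.
  rewrite raddf0 scaler0 addr0 /det_shift map_mx0 add0r det_scalar coefXn.
  by rewrite (_ : (m - l.+1 == m)%N = false) //; apply/eqP; lia.
have hA := IH l.+1 lm; have hB := IH l (ltnW lm).
rewrite laguerre_coefS//.
apply: (@hasE_ext _ _ _ _ (fun w => ecoef 0 (x w) m i l.+1 + m%:R^-1 *
  (row_vec (x w) i m *m row_form 0 (x w) m i l *m (row_vec (x w) i m)^T) 0 0)).
  by move=> w; rewrite ecoefS.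
apply: hasED => //.
pose F (z : sub_sigma X (past i) * sub_sigma X (present i)) := m%:R^-1 *
  (row_vec (x z.2) i m *m row_form 0 (x z.1) m i l *m (row_vec (x z.2) i m)^T) 0 0.
have F0 z : 0 <= F z by rewrite mulr_ge0 ?invr_ge0// row_form_psd.
have mF : measurable_fun setT F.
  by apply: measurable_funM => //; exact: measurable_joint_form.
apply: hasE_ge0_integral => [|w|].
- apply: measurable_funM => //; under eq_fun do rewrite row_formE.
  apply: measurable_sum => a; apply: measurable_sum => b; apply: measurable_funM.
    by apply: measurable_row_form => c e ci em; exact: measurable_funPT.
  by apply: measurable_funM; exact: measurable_funPT.
- exact: (F0 (w, w)).
rewrite (ge0_indep_decouple X_indep (past_present i) (F := fun z => (F z)%:E)); last 2 first.
- exact/measurable_EFinP.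
- by move=> z; rewrite lee_fin.
have [_ <-] := hasEZ (sigma ^+ 2 * (m%:R^-1 * (m - l)%:R)) hB.
apply: eq_integral => w _; rewrite /F /=.
have [_ ->] := hasEZ m%:R^-1 (hasE_row_form X_indep X_mean X_var i (row_form 0 (x w) m i l)).
by rewrite row_form_tr//; congr (_%:E); ring.
Qed.

Section lower.
Variables (K s eta delta : R).
Hypothesis K_ge0 : 0 <= K.
Hypothesis hs : forall j, hasE P (fun w => cut_sqr K (X j w)) s.
Hypothesis eta_gt0 : 0 < eta.
Hypothesis delta_gt0 : 0 < delta.
Hypothesis m_gt0 : (0 < m)%N.

Let kappa := 1 + m%:R^-1 * (row_variance sigma K / (eta ^+ 2 * delta ^+ 2)).

Let s_ge0 : 0 <= s.
Proof. by apply: hasE_ge0 (hs (0, 0)) _ => w; exact: cut_sqr_ge0. Qed.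

Let kappa_ge1 : 1 <= kappa.
Proof.
rewrite /kappa lerDl; apply: mulr_ge0; first by rewrite invr_ge0.
by apply: divr_ge0; rewrite ?row_variance_ge0// mulr_ge0 ?sqr_ge0.
Qed.

Let hasE_inv_ecoef i l : (l <= m)%N ->
  exists u, hasE P (fun w => (ecoef eta (x w) m i l)^-1) u.
Proof.
move=> lm; have [c c0 hc] : exists2 c, 0 < c & forall w, c <= ecoef eta (x w) m i l.
  elim: l lm => [|l IH] lm; first by exists 1 => // w; rewrite ecoef0.
  have [c c0 hc] := IH (ltnW lm).
  exists (eta * (m - l)%:R * c / l.+1%:R).
    by rewrite divr_gt0// !mulr_gt0// ltr0n subn_gt0.
  move=> w; rewrite ler_pdivrMr// [leRHS]mulrC.
  apply: le_trans (ecoef_ratio (x w) i lm (ltW eta_gt0)).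
  by rewrite ler_wpM2l// mulr_ge0// ltW.
apply: hasE_dom (hasE_cst P c^-1) _ => [|w].
  apply: measurable_funV_gt0; first exact: measurable_ecoefT.
  by move=> w; apply: lt_le_trans (hc w).
by rewrite ger0_norm ?invr_ge0 ?lef_pV2 ?posrE// ?(lt_le_trans c0 (hc w))// ltW// (lt_le_trans c0 (hc w)).
Qed.

(** Cauchy-Schwarz in Engel form, for two terms with weights [1] and [c]. *)
Lemma titu (fA fB A B c : R) : 0 < A -> 0 < B -> 0 <= c ->
  (fA + c * fB) ^+ 2 / (A + c * B) <= fA ^+ 2 / A + c * fB ^+ 2 / B.
Proof.
move=> A0 B0 c0; have D0 : 0 < A + c * B by rewrite ltr_wpDr// mulr_ge0// ltW.
rewrite ler_pdivrMr// -subr_ge0.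
have -> : (fA ^+ 2 / A + c * fB ^+ 2 / B) * (A + c * B) - (fA + c * fB) ^+ 2 =
   c * (fA * B - fB * A) ^+ 2 / (A * B) by field; rewrite !gt_eqF.
by apply: divr_ge0; rewrite mulr_ge0 ?sqr_ge0// ltW.
Qed.

(** Induction on the number of rows.  For fixed earlier rows,
    [row_form_inv_le] bounds the inverse moment over the new row by
    [kappa / (A + c * B)], with [A] and [B] the two coefficients that enter the
    recursion; [titu] splits this fraction into inverse moments of [A] and of
    [B], weighted so that the induction hypotheses recombine into
    [laguerre_coefS].  The ratio bound [ecoef_ratio] is what makes the relative
    variance [O(1/m)]. *)
Lemma inv_ecoef_expectation i l : (l <= m)%N -> delta * m%:R <= (m - l)%:R ->
  exists2 u, hasE P (fun w => (ecoef eta (x w) m i l)^-1) u &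
    laguerre_coef s m i l ^+ 2 * u <= kappa ^+ i * laguerre_coef s m i l.
Proof.
have k0 j : 0 <= kappa ^+ j by rewrite exprn_ge0// (le_trans _ kappa_ge1).
elim: i l => [|i IH] [|l] lm dl; do ?
  by exists 1; rewrite ?laguerre_coef0 ?expr1n ?mulr1 ?exprn_ege1//;
   apply: (@hasE_ext _ _ _ _ (fun=> 1)) => [w|]; [rewrite ecoef0 invr1|exact: hasE_cst].
  have [u hu] := hasE_inv_ecoef 0 lm; exists u => //.
  by rewrite /laguerre_coef bin0n !mul0r expr0n mul0r mulr0.
have dl' : delta * m%:R <= (m - l)%:R by apply: le_trans dl _; rewrite ler_nat; lia.
have [uA hA leA] := IH l.+1 lm dl; have [uB hB leB] := IH l (ltnW lm) dl'.
have [u hu] := hasE_inv_ecoef i.+1 lm; exists u => //.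
set fA := laguerre_coef s m i l.+1 in leA *; set fB := laguerre_coef s m i l in leB *.
have fA0 : 0 <= fA by exact: laguerre_coef_ge0.
have fB0 : 0 <= fB by exact: laguerre_coef_ge0.
pose c := s * (m%:R^-1 * (m - l)%:R); have c0 : 0 <= c by rewrite !mulr_ge0 ?invr_ge0.
set f := laguerre_coef s m i.+1 l.+1; have fE : f = fA + c * fB by rewrite /f laguerre_coefS.
pose A w := ecoef eta (x w) m i l.+1; pose B w := ecoef eta (x w) m i l.
have A0 w : 0 < A w by exact: ecoef_gt0.
have B0 w : 0 < B w by apply: ecoef_gt0 => //; exact: ltnW.
pose G w := kappa * (fA ^+ 2 * (A w)^-1 + c * fB ^+ 2 * (B w)^-1).
have hG : hasE P G (kappa * (fA ^+ 2 * uA + c * fB ^+ 2 * uB)).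
  by apply: hasEZ; apply: hasED; apply: hasEZ.
apply: (@le_trans _ _ (kappa * (fA ^+ 2 * uA + c * fB ^+ 2 * uB))); last first.
rewrite [kappa ^+ i.+1]exprS -[leRHS]mulrA ler_wpM2l ?(le_trans _ kappa_ge1)// fE mulrDr lerD//.
  by rewrite -mulrA [leRHS]mulrCA ler_wpM2l.
have [_ hGE] := hG; rewrite -lee_fin -hGE.
have [_ <-] := hasEZ (f ^+ 2) hu.
pose F (z : sub_sigma X (past i) * sub_sigma X (present i)) :=
  f ^+ 2 * (ecoef eta (x z.1) m i l.+1 + m%:R^-1 *
  (row_vec (x z.2) i m *m row_form eta (x z.1) m i l *m (row_vec (x z.2) i m)^T) 0 0)^-1.
have D0 (z : sub_sigma X (past i) * sub_sigma X (present i)) :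
    0 < ecoef eta (x z.1) m i l.+1 + m%:R^-1 *
  (row_vec (x z.2) i m *m row_form eta (x z.1) m i l *m (row_vec (x z.2) i m)^T) 0 0.
  by rewrite ltr_wpDr ?A0// mulr_ge0 ?invr_ge0// row_form_psd// ltW.
rewrite (eq_integral (fun w : T => (F (w, w))%:E)); last first.
  by move=> w _; rewrite /F /= ecoefS.
apply: (ge0_indep_decouple_le X_indep (past_present i) (F := fun z => (F z)%:E)
  (G := fun w => (G w)%:E)).
- apply/measurable_EFinP; apply: measurable_funM => //.
  apply: measurable_funV_gt0 D0; apply: measurable_funD.
    exact: measurable_joint_ecoef.
  by apply: measurable_funM => //; exact: measurable_joint_form.
- by move=> z; rewrite lee_fin mulr_ge0 ?sqr_ge0// invr_ge0 ltW.
- apply/measurable_EFinP; apply: measurable_funM => //; apply: measurable_funD;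
  (apply: measurable_funM => //; apply: measurable_funV_gt0 => //;
   exact: measurable_past_ecoef).
- move=> w; rewrite lee_fin; apply: mulr_ge0; first exact: le_trans kappa_ge1.
  have hA' : 0 <= (A w)^-1 by rewrite invr_ge0 ltW.
  have hB' : 0 <= (B w)^-1 by rewrite invr_ge0 ltW.
  by apply: addr_ge0; apply: mulr_ge0 => //; rewrite ?sqr_ge0// mulr_ge0 ?sqr_ge0.
move=> w.
have rV : \sum_a \sum_b row_form eta (x w) m i l a b ^+ 2 <= m%:R * B w ^+ 2.
  by apply: row_form_sqsum => //; exact: ltW.
pose mu := A w + c * B w.
have muE : mu = A w + s * (m%:R^-1 * \tr (row_form eta (x w) m i l)).
  by rewrite row_form_tr// /mu /c /B; ring.
have mu_ge : A w <= mu by rewrite /mu lerDl mulr_ge0// ltW.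
have mu0 : 0 < mu by apply: lt_le_trans mu_ge.
have := row_form_inv_le X_indep X_mean X_var i K_ge0 hs (A0 w)
  (fun a b => row_form_sym eta (x w) i l a b)
  (fun u => row_form_psd (x w) i l u (ltW eta_gt0))
  (fun a => row_form_diag_ge0 (x w) i l a (ltW eta_gt0)) rV muE.
set q := (mu^-1 * _) => hq.
rewrite /F /=; under eq_integral do rewrite EFinM.
rewrite ge0_integralZl//; last 3 first.
- apply/measurable_EFinP; apply: measurable_funV_gt0 => [|w']; last exact: (D0 (w, w')).
  apply: measurable_funD => //; apply: measurable_funM => //.
  exact: hasE_meas (hasE_row_form X_indep X_mean X_var i _).
- by move=> w' _; rewrite lee_fin invr_ge0 ltW//; exact: (D0 (w, w')).
- by rewrite lee_fin sqr_ge0.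
apply: (@le_trans _ _ ((f ^+ 2)%:E * q%:E)%E).
  by apply: lee_wpmul2l => //; rewrite lee_fin sqr_ge0.
rewrite -EFinM lee_fin /q /G.
have rv0 := row_variance_ge0 sigma K.
have hk : 1 + m%:R^-1 ^+ 2 * row_variance sigma K * (m%:R * B w ^+ 2) / (A w * mu) <= kappa.
  rewrite /kappa lerD2l.
  have mR0 : 0 < m%:R :> R by rewrite ltr0n.
  have AB : eta * delta * B w <= A w.
    have h1 : eta * (m - l)%:R * B w <= l.+1%:R * A w by apply: ecoef_ratio => //; exact: ltW.
    have h2 : eta * (delta * m%:R) * B w <= m%:R * A w.
      apply: (@le_trans _ _ (eta * (m - l)%:R * B w)).
        by rewrite ler_wpM2r ?ler_wpM2l// ltW.
      apply: le_trans h1 _; rewrite ler_wpM2r ?ler_nat//; exact: ltW.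
    rewrite -(ler_pM2l mR0); apply: le_trans h2; rewrite le_eqVlt; apply/orP; left.
    by apply/eqP; ring.
  have -> : m%:R^-1 ^+ 2 * row_variance sigma K * (m%:R * B w ^+ 2) / (A w * mu) =
     (m%:R^-1 * row_variance sigma K) * (B w ^+ 2 / (A w * mu)).
    by field; rewrite !gt_eqF.
  rewrite [leRHS]mulrA ler_wpM2l ?mulr_ge0 ?invr_ge0//.
  rewrite ler_pdivrMr ?mulr_gt0// [leRHS]mulrC ler_pdivlMr ?mulr_gt0 ?exprn_gt0//.
  apply: (@le_trans _ _ (A w ^+ 2)); last by rewrite expr2 ler_wpM2l// ltW.
  have eB : 0 <= eta * delta * B w by rewrite mulr_ge0 ?mulr_ge0// ltW.
  by rewrite -exprMn mulrC -exprMn ler_sqr ?nnegrE// ltW.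
apply: (@le_trans _ _ (f ^+ 2 * (mu^-1 * kappa))).
  by rewrite ler_wpM2l ?sqr_ge0// ler_wpM2l// invr_ge0 ltW.
rewrite mulrA [leLHS]mulrC ler_wpM2l ?(le_trans _ kappa_ge1)// fE.
exact: titu.
Qed.

End lower.
End ecoef_expectation.

(** * Almost sure exponential bounds *)

Section first_moment_borel_cantelli.
Context (d : measure_display) (T : measurableType d) (R : realType)
  (P : probability T R).

Lemma measurable_superlevel (f : T -> R) (t : R) : measurable_fun setT f ->
  measurable [set w | t <= f w].
Proof.
move=> mf; rewrite (_ : [set w | _] = setT `&` f @^-1` `[t, +oo[); first exact: mf.
by rewrite setTI; apply/seteqP; split => w /=; rewrite in_itv/= andbT.
Qed.

Lemma hasE_markov (f : T -> R) (u t : R) : hasE P f u -> (forall w, 0 <= f w) -> 0 < t ->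
  (P [set w | (t <= f w)%R] <= (u / t)%:E)%E.
Proof.
move=> fu f0 t0; have mf := hasE_meas fu.
have mA : measurable [set w | t <= f w] by exact: measurable_superlevel.
have [_ <-] : hasE P (fun w => t^-1 * f w) (u / t) by rewrite mulrC; exact: hasEZ.
rewrite -[X in P X]setIT -integral_indic//; apply: ge0_le_integral => //.
- exact/measurable_EFinP.
- by apply/measurable_EFinP; apply: measurable_funM.
move=> w _; rewrite lee_fin indicE mulrC ler_pdivlMr//.
by case: (boolP (w \in _)) => [/[!inE]|_]; rewrite ?mul1r ?mul0r.
Qed.

Lemma geometric_nneseries_lty (q : R) : 0 <= q -> q < 1 ->
  (\sum_(0 <= n <oo) (q ^+ n)%:E < +oo)%E.
Proof.
move=> q0 q1; have q0' : 0 < 1 - q by rewrite subr_gt0.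
apply: (@le_lt_trans _ _ ((1 - q)^-1)%:E); last exact: ltry.
apply: lime_le; first by apply: is_cvg_nneseries => n _ _; rewrite lee_fin exprn_ge0.
apply: nearW => n; rewrite sumEFin lee_fin.
rewrite -[leRHS]mul1r ler_pdivlMr// big_mkord.
have -> : (\sum_(i < n) q ^+ i) * (1 - q) = 1 - q ^+ n.
  by rewrite -[1 - q]opprB mulrN mulrC -subrX1 opprB.
by rewrite lerBlDr lerDl exprn_ge0.
Qed.

Lemma succn_le_expR (c : R) : 0 < c -> exists2 C : R, 0 < C &
  forall n, n.+1%:R <= C * expR (c * n%:R).
Proof.
move=> c0; exists (1 + c^-1); first by rewrite addr_gt0 ?invr_gt0.
move=> n; have h := expR_ge1Dx (c * n%:R).
apply: (@le_trans _ _ ((1 + c^-1) * (1 + c * n%:R))); last first.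
  by rewrite ler_wpM2l// addr_ge0// invr_ge0 ltW.
have -> : (1 + c^-1) * (1 + c * n%:R) = n.+1%:R + (c^-1 + c * n%:R).
  by rewrite -natr1; field; rewrite gt_eqF.
by rewrite lerDl addr_ge0 ?invr_ge0 ?mulr_ge0// ltW.
Qed.

(** Bounded first moments, Markov's inequality at height [expR (eps * n)] and a
    union over the [n + 1] values of [l] give summable probabilities. *)
Lemma ae_eventually_le_expR (Z : nat -> nat -> T -> R) (C eps : R) (N0 : nat) :
  0 < eps -> (forall n l w, 0 <= Z n l w) ->
  (forall n l, (N0 <= n)%N -> (l <= n)%N -> exists2 u, hasE P (Z n l) u & u <= C) ->
  {ae P, forall w, exists N, forall n l, (N <= n)%N -> (l <= n)%N ->
    Z n l w <= expR (eps * n%:R)}.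
Proof.
move=> e0 Z0 ZE.
pose W n w := \sum_(l < n.+1) Z n l w.
have W0 n w : 0 <= W n w by apply: sumr_ge0.
have WE n : (N0 <= n)%N -> exists2 u, hasE P (W n) u & u <= n.+1%:R * C.
  move=> Nn; have ex (l : 'I_n.+1) : exists u, hasE P (Z n l) u /\ u <= C.
    have [|u hu uC] := ZE n l Nn; first by rewrite -ltnS.
    by exists u.
  have [u hu] := choice ex; exists (\sum_(l < n.+1) u l).
    by apply: hasE_sum => l; have [] := hu l.
  have -> : n.+1%:R * C = \sum_(l < n.+1) C by rewrite sumr_const card_ord mulr_natl.
  by apply: ler_sum => l _; have [] := hu l.
pose F n := if (N0 <= n)%N then [set w | expR (eps * n%:R) <= W n w] else set0.
have mF n : measurable (F n).
  rewrite /F; case: ifPn => // Nn; have [u hu _] := WE n Nn.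
  exact: measurable_superlevel (hasE_meas hu).
have e20 : 0 < eps / 2 by rewrite divr_gt0.
have [D D0 hD] := succn_le_expR e20.
pose C' := Num.max C 0.
(* half of [eps] absorbs the number [n + 1] of terms, the other half gives a
   geometric series *)
pose q := expR (- (eps / 2)).
have PF n : (P (F n) <= (D * C' * q ^+ n)%:E)%E.
  have q0 : 0 <= q ^+ n by rewrite exprn_ge0// expR_ge0.
  have C'0 : 0 <= C' by rewrite le_max lexx orbT.
  rewrite /F; case: ifPn => Nn; last by rewrite measure0 lee_fin !mulr_ge0// ltW.
  have [u hu uC] := WE n Nn.
  apply: le_trans (hasE_markov hu (W0 n) (expR_gt0 _)) _; rewrite lee_fin.
  rewrite ler_pdivrMr ?expR_gt0//; apply: le_trans uC _.
  apply: (@le_trans _ _ (n.+1%:R * C')); first by rewrite ler_wpM2l// le_max lexx.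
  have -> : D * C' * q ^+ n * expR (eps * n%:R) = (D * expR (eps / 2 * n%:R)) * C'.
    rewrite /q -expRM_natr -mulrA -expRD mulrAC; congr (_ * expR _ * _).
    by field.
  by rewrite ler_wpM2r.
have lim0 : P (lim_sup_set F) = 0%E.
  apply: lim_sup_set_cvg0 => //.
  apply: (@le_lt_trans _ _ (\sum_(0 <= n <oo) (D * C')%:E * (q ^+ n)%:E)%E).
    by apply: lee_nneseries => [n _ _|n _ ]; [exact: measure_ge0|rewrite -EFinM; exact: PF].
  rewrite nneseriesZl; last by move=> n _; rewrite lee_fin exprn_ge0// expR_ge0.
  have q1 : q < 1 by rewrite /q expR_lt1 oppr_lt0.
  have := geometric_nneseries_lty (expR_ge0 _) q1.
  set S := (\sum_(0 <= n <oo) _)%E => hS.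
  have S0 : (0 <= S)%E by apply: nneseries_ge0 => n _ _; rewrite lee_fin exprn_ge0// expR_ge0.
  by rewrite -(@fineK _ S) ?ge0_fin_numE// -EFinM ltry.
exists (lim_sup_set F); split => //.
  by apply: bigcapT_measurable => n; apply: bigcup_measurable.
move=> w /= nw; apply: contrapT => nF; apply: nw.
have [N hN] : exists N, forall n, (N <= n)%N -> ~ F n w.
  apply: contrapT => h; apply: nF => n _; apply: contrapT => h'; apply: h.
  by exists n => k nk Fk; apply: h'; exists k.
exists (maxn N N0) => n l; rewrite geq_max => /andP[Nn N0n] ln.
have := hN n Nn; rewrite /F N0n /= => /negP; rewrite -ltNge => /ltW.
apply: le_trans; have ln' : (l < n.+1)%N by rewrite ltnS.
by rewrite /W (bigD1 (Ordinal ln'))//= lerDl sumr_ge0.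
Qed.

End first_moment_borel_cantelli.

Section almost_sure_bounds.
Context (d : measure_display) (T : measurableType d) (R : realType)
  (P : probability T R) (X : nat * nat -> {RV P >-> R}) (sigma lambda : R).
Variable m : nat -> nat.
Hypothesis sigma_gt0 : 0 < sigma.
Hypothesis X_indep : independent_RVs P X.
Hypothesis X_mean : forall j, ('E_P[X j] = 0)%E.
Hypothesis X_var : forall j, ('V_P[X j] = (sigma ^+ 2)%:E)%E.
Hypothesis m_gt0 : forall n, (0 < n)%N -> (0 < m n)%N.
Hypothesis m_lim : (fun n : nat => n%:R / (m n)%:R : R) @ \oo --> lambda.

Let x w := fun ij => X ij w.

Lemma laguerre_coef_gt0 (s : R) M n l : 0 < s -> (0 < M)%N -> (l <= n)%N -> (l <= M)%N ->
  0 < laguerre_coef s M n l.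
Proof.
move=> s0 M0 ln lM; rewrite /laguerre_coef !mulr_gt0 ?exprn_gt0 ?invr_gt0 ?exprn_gt0 ?ltr0n//.
  by rewrite bin_gt0.
by rewrite ffact_gt0.
Qed.

Lemma ae_ecoef_le eps : 0 < eps -> {ae P, forall w, exists N, forall n l,
  (N <= n)%N -> (l <= n)%N ->
  ecoef 0 (x w) (m n) n l <= expR (eps * n%:R) * laguerre_coef (sigma ^+ 2) (m n) n l}.
Proof.
move=> e0; pose f n l := laguerre_coef (sigma ^+ 2) (m n) n l.
pose Z n l w := if (l <= m n)%N then (f n l)^-1 * ecoef 0 (x w) (m n) n l else 0.
have f0 n l : 0 <= f n l by apply: laguerre_coef_ge0; exact: sqr_ge0.
have fp n l : (0 < n)%N -> (l <= n)%N -> (l <= m n)%N -> 0 < f n l.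
  by move=> n0 ln lm; apply: laguerre_coef_gt0 => //; [exact: exprn_gt0|exact: m_gt0].
have Z0 n l w : 0 <= Z n l w.
  by rewrite /Z; case: ifP => // _; rewrite mulr_ge0 ?invr_ge0// ecoef_ge0.
have ZE n l : (1 <= n)%N -> (l <= n)%N -> exists2 u, hasE P (Z n l) u & u <= 1.
  move=> n0 ln; rewrite /Z; case: (leqP l (m n)) => lm; last first.
    by exists 0; [exact: hasE_cst|].
  exists ((f n l)^-1 * f n l); last by rewrite mulVf// gt_eqF// fp.
  by apply: hasEZ; exact: hasE_ecoef.
have := ae_eventually_le_expR e0 Z0 ZE; apply: filterS => w [N hN].
exists (maxn N 1) => n l; rewrite geq_max => /andP[Nn n0] ln.
have := hN n l Nn ln; rewrite /Z; case: leqP => lm.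
  by rewrite ler_pdivrMl ?fp// mulrC.
by move=> _; rewrite /ecoef leqNgt lm /= mulr_ge0 ?expR_ge0// f0.
Qed.

(** Apply the first moment method to the ratio of [laguerre_coef] and [ecoef].
    Its expectation is at most [(1 + c / m) ^+ n], which stays bounded as
    [n / m] converges. *)
Lemma ae_ecoef_ge (K s eta delta eps : R) :
  0 <= K -> (forall j, hasE P (fun w => cut_sqr K (X j w)) s) -> 0 < s ->
  0 < eta -> 0 < delta -> 0 < eps ->
  {ae P, forall w, exists N, forall n l, (N <= n)%N -> (l <= n)%N -> (l <= m n)%N ->
    delta * (m n)%:R <= (m n - l)%:R ->
    laguerre_coef s (m n) n l <= expR (eps * n%:R) * ecoef eta (x w) (m n) n l}.
Proof.
move=> K0 hs s0 eta0 delta0 e0; pose f n l := laguerre_coef s (m n) n l.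
pose ok n l := (l <= m n)%N && (delta * (m n)%:R <= (m n - l)%:R).
pose Z n l w := if ok n l then f n l * (ecoef eta (x w) (m n) n l)^-1 else 0.
have f0 n l : 0 <= f n l by apply: laguerre_coef_ge0; exact: ltW.
have fp n l : (0 < n)%N -> (l <= n)%N -> (l <= m n)%N -> 0 < f n l.
  by move=> n0 ln lm; apply: laguerre_coef_gt0 => //; exact: m_gt0.
have Z0 n l w : 0 <= Z n l w.
  by rewrite /Z; case: ifP => // _; rewrite mulr_ge0 ?invr_ge0// ecoef_ge0// ltW.
pose c := row_variance sigma K / (eta ^+ 2 * delta ^+ 2).
have c0 : 0 <= c by apply: divr_ge0; [exact: row_variance_ge0|rewrite mulr_ge0 ?sqr_ge0].
have [N0 _ hN0] : \forall n \near \oo, n%:R / (m n)%:R <= lambda + 1.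
  by apply: (cvgr_le lambda); [exact: m_lim|rewrite ltrDl].
have ZE n l : (maxn N0 1 <= n)%N -> (l <= n)%N ->
    exists2 u, hasE P (Z n l) u & u <= expR ((lambda + 1) * c).
  rewrite geq_max => /andP[N0n n0] ln; rewrite /Z; case: (boolP (ok n l)); last first.
    by exists 0; [exact: hasE_cst|exact: expR_ge0].
  move=> /andP[lm dl].
  have [u hu le_u] := inv_ecoef_expectation X_indep X_mean X_var K0 hs eta0 delta0
    (m_gt0 n0) n lm dl.
  exists (f n l * u); first exact: hasEZ.
  have fnl := fp n l n0 ln lm.
  apply: (@le_trans _ _ ((1 + (m n)%:R^-1 * c) ^+ n)).
    by rewrite -(ler_pM2r fnl); apply: le_trans le_u; rewrite /f mulrAC expr2.
  apply: (@le_trans _ _ (expR ((m n)%:R^-1 * c) ^+ n)).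
    by apply: lerXn2r; rewrite ?nnegrE ?expR_ge0 ?expR_ge1Dx// addr_ge0// mulr_ge0// invr_ge0.
  rewrite -expRM_natr ler_expR mulrAC ler_wpM2r// mulrC; exact: hN0.
have := ae_eventually_le_expR e0 Z0 ZE; apply: filterS => w [N hN].
exists (maxn N 1) => n l; rewrite geq_max => /andP[Nn n0] ln lm dl.
have := hN n l Nn ln; rewrite /Z /ok lm dl /= ler_pdivrMr//; exact: ecoef_gt0.
Qed.

End almost_sure_bounds.

(** * The limit profile *)

Section elementary_functions.
Context (R : realType) (l u : R).

(** A class of functions containing the profile and closed under
    differentiation, which yields derivatives of every order at once. *)
Inductive elementary : (R -> R) -> Prop :=
| elementary_cst c : elementary (fun=> c)
| elementary_id : elementary (fun x => x)
| elementary_add f g : elementary f -> elementary g -> elementary (fun x => f x + g x)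
| elementary_mul f g : elementary f -> elementary g -> elementary (fun x => f x * g x)
| elementary_inv f : elementary f -> (forall x, l < x < u -> 0 < f x) ->
    elementary (fun x => (f x)^-1)
| elementary_ln f : elementary f -> (forall x, l < x < u -> 0 < f x) ->
    elementary (fun x => ln (f x)).

Lemma elementary_derive f : elementary f ->
  exists2 f', elementary f' & forall x, l < x < u -> is_derive x 1 f (f' x).
Proof.
elim=> {f} [c||f g _ [f' ef' ff'] _ [g' eg' gg']|f g ef [f' ef' ff'] eg [g' eg' gg']
  |f ef [f' ef' ff'] f0|f ef [f' ef' ff'] f0].
- by exists (fun=> 0) => [|x _]; [exact: elementary_cst|exact: is_derive_cst].
- by exists (fun=> 1) => [|x _]; [exact: elementary_cst|exact: is_derive_id].
- exists (fun x => f' x + g' x) => [|x xlu]; first exact: elementary_add.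
  exact: (is_deriveD (ff' x xlu) (gg' x xlu)).
- exists (fun x => f x * g' x + g x * f' x) => [|x xlu].
    by apply: elementary_add; exact: elementary_mul.
  exact: (is_deriveM (ff' x xlu) (gg' x xlu)).
- exists (fun x => (-1 * ((f x)^-1 * (f x)^-1)) * f' x) => [|x xlu].
    apply: elementary_mul => //; apply: elementary_mul; first exact: elementary_cst.
    by apply: elementary_mul; exact: elementary_inv.
  have fx0 : f x != 0 by rewrite gt_eqF// f0.
  apply: is_derive_eq (is_deriveV fx0 (ff' x xlu)) _.
  by rewrite /GRing.scale /= -exprVn expr2; ring.
- exists (fun x => (f x)^-1 * f' x) => [|x xlu].
    by apply: elementary_mul => //; exact: elementary_inv.
  exact: (is_derive1_comp (is_derive1_ln (f0 x xlu)) (ff' x xlu)).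
Qed.

Lemma elementary_smooth f : elementary f -> smooth_on l u f.
Proof.
move=> ef.
have h p : exists2 h, elementary h & forall x, l < x < u -> (f^`(p))%classic x = h x.
  elim: p => [|p [h eh fh]]; first by exists f.
  have [h' eh' hh'] := elementary_derive eh; exists h' => // x xlu.
  rewrite derive1nS derive1E.
  have near_h : \forall y \near x, (f^`(p))%classic y = h y.
    have := @near_in_itvoo R l u x; rewrite in_itv /= xlu => /(_ isT).
    by apply: filterS => y; rewrite in_itv /=; exact: fh.
  by rewrite (near_eq_derive _ near_h); have [_ ->] := hh' x xlu.
move=> p x xlu; have [k ek fk] := h p.
have [k' _ kk'] := elementary_derive ek.
have near_k : \forall y \near x, k y = (f^`(p))%classic y.
  have := @near_in_itvoo R l u x; rewrite in_itv /= xlu => /(_ isT).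
  by apply: filterS => y; rewrite in_itv /= => yl; rewrite fk.
by apply: near_eq_derivable near_k _; have [] := kk' x xlu.
Qed.

End elementary_functions.

Section profile_properties.
Context (R : realType) (sigma lambda : R).
Hypothesis sigma_gt0 : 0 < sigma.
Hypothesis lambda_gt0 : 0 < lambda.

Local Notation ls := (lambda_star lambda).

Let y a := lambda * a + 1 - lambda.

Lemma lambda_star_range a : ls < a < 1 -> [/\ 0 < a, a < 1 & 0 < y a].
Proof.
rewrite /lambda_star gt_max => /andP[/andP[la a0] a1]; split => //.
have : lambda * (1 - lambda^-1) < lambda * a by rewrite ltr_pM2l.
by rewrite mulrBr mulr1 divff ?gt_eqF// /y; lra.
Qed.

Lemma lambda_star_ge0 : 0 <= ls.
Proof. by rewrite /lambda_star le_max lexx orbT. Qed.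

Lemma lambda_star_lt1 : ls < 1.
Proof. by rewrite /lambda_star gt_max ltr01 andbT ltrBlDr ltrDl invr_gt0. Qed.

Lemma lambda_star_le : 1 - lambda^-1 <= ls.
Proof. by rewrite /lambda_star le_max lexx. Qed.

(** The equation is a polynomial one, with a sign change on the interval;
    uniqueness holds since [a * y a] increases. *)
Lemma alpha_star_exists : exists astar, unique (is_alpha_star sigma lambda) astar.
Proof.
pose p : {poly R} := (sigma ^+ 2)%:P * ('X * (lambda%:P * 'X + (1 - lambda)%:P)) + ('X - 1%:P).
have pE a : p.[a] = sigma ^+ 2 * (a * y a) - (1 - a).
  rewrite /p !(hornerD, hornerM, hornerC, hornerX, hornerN) /y; ring.
have s2 : 0 < sigma ^+ 2 by rewrite exprn_gt0.
have pls : p.[ls] < 0.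
  have -> : p.[ls] = ls - 1.
    rewrite pE /lambda_star; have [h|h] := leP (1 - lambda^-1) 0; first by rewrite mul0r; ring.
    by rewrite /y; field; rewrite gt_eqF.
  by rewrite subr_lt0 lambda_star_lt1.
have p1 : 0 < p.[1] by rewrite pE subrr subr0 mulr_gt0// mul1r /y; lra.
have [|a] := polyrcf.poly_ivtoo (ltW lambda_star_lt1) (_ : p.[ls] * p.[1] < 0).
  by rewrite nmulr_rlt0.
rewrite in_itv /= => aI; rewrite /root pE subr_eq0 => /eqP pa.
have [a0 a1 ya0] := lambda_star_range aI.
exists a; split.
  split => //; rewrite -pa -/(y a); field.
  by rewrite !gt_eqF.
move=> b [bI]; have [b0 b1 yb0] := lambda_star_range bI.
rewrite -/(y b) => eb.
have pb : sigma ^+ 2 * (b * y b) = 1 - b.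
  by rewrite -eb divfK// mulf_neq0 ?gt_eqF.
have mono u v : 0 < u -> 0 < y u -> u < v -> u * y u < v * y v.
  move=> u0 yu uv; have yuv : y u < y v by rewrite /y ltrD2r ltrD2r ltr_pM2l.
  by apply: ltr_pM => //; exact: ltW.
have [ab|ba|//] := ltgtP a b.
  by have := mono a b a0 ya0 ab; rewrite -(ltr_pM2l s2) pa pb; lra.
by have := mono b a b0 yb0 ba; rewrite -(ltr_pM2l s2) pa pb; lra.
Qed.

(** The derivative of [g_M]. *)
Definition g_slope a := ln (1 - a) - ln a - ln (y a) - 2 * ln sigma.

(** [x * ln x] lies strictly above its tangent lines; this is
    [1 + t < expR t] with [t = ln (v / u)]. *)
Lemma xlnx_tangent (v u : R) : 0 < v -> 0 < u -> u != v ->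
  v * ln v + (1 + ln v) * (u - v) < u * ln u.
Proof.
move=> v0 u0 uv.
have l0 : ln (v / u) != 0.
  apply/eqP => /(congr1 expR); rewrite lnK ?posrE ?divr_gt0// expR0 => h.
  by case/eqP: uv; rewrite -[v](divfK (lt0r_neq0 u0)) h mul1r.
have := expR_gt1Dx l0; rewrite lnK ?posrE ?divr_gt0// ln_div ?posrE//.
rewrite ltr_pdivlMr// => h.
by rewrite -subr_gt0; move: h; rewrite -subr_gt0 => h; apply: lt_le_trans h _; lra.
Qed.

(** Up to affine terms, [g_M] is minus a sum of three functions of the form
    [x * ln x] at [a], [1 - a] and [lambda * a + 1 - lambda]; add the tangent
    inequalities. *)
Lemma g_tangent astar x0 x : ls < x0 < 1 -> ls < x < 1 -> x != x0 ->
  g_M sigma lambda astar x < g_M sigma lambda astar x0 + g_slope x0 * (x - x0).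
Proof.
move=> x0I xI xx0.
have [x00 x01 yx0] := lambda_star_range x0I; have [x_0 x_1 yx] := lambda_star_range xI.
have h1 := xlnx_tangent x00 x_0 xx0.
have h2 : (1 - x0) * ln (1 - x0) + (1 + ln (1 - x0)) * ((1 - x) - (1 - x0)) < (1 - x) * ln (1 - x).
  apply: xlnx_tangent; rewrite ?subr_gt0//; apply: contra_neq xx0; lra.
have h3 : y x0 * ln (y x0) + (1 + ln (y x0)) * (y x - y x0) < y x * ln (y x).
  apply: xlnx_tangent => //; apply: contra_neq xx0; rewrite /y => h.
  by apply: (mulfI (lt0r_neq0 lambda_gt0)); lra.
have h3' : lambda^-1 * (y x0 * ln (y x0) + (1 + ln (y x0)) * (y x - y x0)) <
    lambda^-1 * (y x * ln (y x)) by rewrite ltr_pM2l ?invr_gt0.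
have e a : (- a + 1 - lambda^-1) = - (lambda^-1 * y a).
  by rewrite /y; field; rewrite gt_eqF.
rewrite /g_M -/(y x) -/(y x0) !e /g_slope.
have e2 : lambda^-1 * (y x0 * ln (y x0) + (1 + ln (y x0)) * (y x - y x0)) =
   lambda^-1 * y x0 * ln (y x0) + (1 + ln (y x0)) * (x - x0).
  by rewrite /y; field; rewrite gt_eqF.
rewrite e2 mulrA in h3'.
move: h1 h2 h3'; set A := lambda^-1 * y x; set A0 := lambda^-1 * y x0.
set L := ln (y x); set L0 := ln (y x0); set S := ln sigma.
set M := ln x; set M0 := ln x0; set N := ln (1 - x); set N0 := ln (1 - x0).
set Cc := g_const _ _ _ => h1 h2 h3'; lra.
Qed.

Lemma g_strictly_concave astar : strictly_concave_on ls 1 (g_M sigma lambda astar).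
Proof.
move=> x1 x2 t x1I x2I nx /andP[t0 t1].
set z := t * x1 + (1 - t) * x2.
have t1' : 0 < 1 - t by rewrite subr_gt0.
have zI : ls < z < 1.
  move: x1I x2I => /andP[lx1 x11] /andP[lx2 x21]; rewrite /z; apply/andP; split; nra.
have nz1 : x1 != z.
  apply: contra_neq nx; rewrite /z => h.
  by apply: (mulfI (lt0r_neq0 t1')); lra.
have nz2 : x2 != z.
  apply: contra_neq nx; rewrite /z => h.
  by apply: (mulfI (lt0r_neq0 t0)); lra.
have h1 := g_tangent astar zI x1I nz1; have h2 := g_tangent astar zI x2I nz2.
set g := g_M _ _ _ in h1 h2 *.
have h1' : t * g x1 < t * (g z + g_slope z * (x1 - z)) by rewrite ltr_pM2l.
have h2' : (1 - t) * g x2 < (1 - t) * (g z + g_slope z * (x2 - z)) by rewrite ltr_pM2l.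
have e : t * (g z + g_slope z * (x1 - z)) + (1 - t) * (g z + g_slope z * (x2 - z)) = g z.
  by rewrite /z; ring.
by rewrite -e; exact: ltrD.
Qed.

Lemma g_slope_alpha_star astar : is_alpha_star sigma lambda astar -> g_slope astar = 0.
Proof.
move=> [aI]; have [a0 a1 ya] := lambda_star_range aI; rewrite -/(y astar) => e.
have a1p : 0 < 1 - astar by rewrite subr_gt0.
have := congr1 (@ln R) e; rewrite ln_div ?posrE ?mulr_gt0// lnM ?posrE//.
by rewrite lnXn// -mulr_natl /g_slope => h; lra.
Qed.

(** The constant [g_const] is precisely the one that normalizes the maximum to
    [0]. *)
Lemma g_alpha_star astar : is_alpha_star sigma lambda astar ->
  g_M sigma lambda astar astar = 0.
Proof.
move=> h; have := g_slope_alpha_star h; rewrite /g_slope /g_M /g_const -/(y astar) => e.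
have -> : ln (y astar) = ln (1 - astar) - ln astar - 2 * ln sigma by lra.
by ring.
Qed.

Lemma g_lt0 astar a : is_alpha_star sigma lambda astar -> ls < a < 1 -> a != astar ->
  g_M sigma lambda astar a < 0.
Proof.
move=> h aI na; have [sI _] := h.
have := g_tangent astar sI aI na.
by rewrite g_alpha_star// g_slope_alpha_star// mul0r addr0.
Qed.

Lemma g_le0 astar a : is_alpha_star sigma lambda astar -> ls < a < 1 ->
  g_M sigma lambda astar a <= 0.
Proof.
move=> h aI; have [->|na] := eqVneq a astar; first by rewrite g_alpha_star.
exact/ltW/g_lt0.
Qed.

Let elementary_y : elementary ls 1 y.
Proof.
apply: elementary_add; last exact: elementary_cst.
apply: elementary_add; last exact: elementary_cst.
by apply: elementary_mul; [exact: elementary_cst|exact: elementary_id].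
Qed.

Let elementary_1B : elementary ls 1 (fun a => 1 - a).
Proof.
rewrite (_ : (fun a => _) = (fun a => 1 + (-1) * a)); last by apply/funext => a; ring.
apply: elementary_add; first exact: elementary_cst.
by apply: elementary_mul; [exact: elementary_cst|exact: elementary_id].
Qed.

Lemma g_smooth astar : smooth_on ls 1 (g_M sigma lambda astar).
Proof.
apply: elementary_smooth.
have ec c := @elementary_cst R ls 1 c.
have ei := @elementary_id R ls 1.
have eln : elementary ls 1 (fun a => ln a).
  by apply: elementary_ln => // x /lambda_star_range[].
have eln1 : elementary ls 1 (fun a => ln (1 - a)).
  by apply: elementary_ln => // x /lambda_star_range[_ x1 _]; rewrite subr_gt0.
have elny : elementary ls 1 (fun a => ln (y a)).
  by apply: elementary_ln => // x /lambda_star_range[].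
rewrite (_ : g_M sigma lambda astar = (fun a => (-2 * ln sigma) * a
  + ((-1) * a + (1 - lambda^-1)) * ln (y a) + (a + (-1) * (a * ln a))
  + ((-1) * (1 - a)) * ln (1 - a) + g_const sigma lambda astar)); last first.
  by apply/funext => a; rewrite /g_M -/(y a); ring.
by repeat first [exact: ec|exact: ei|exact: eln|exact: eln1|exact: elny|exact: elementary_1B
  |apply: elementary_add|apply: elementary_mul].
Qed.

Lemma g_derive astar a : ls < a < 1 ->
  expR (- ((g_M sigma lambda astar)^`())%classic a) =
  sigma ^+ 2 * a * (lambda * a + 1 - lambda) / (1 - a).
Proof.
move=> aI; have [a0 a1 ya] := lambda_star_range aI.
have a1' : 0 < 1 - a by rewrite subr_gt0.
have -> : ((g_M sigma lambda astar)^`())%classic a = g_slope a.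
  rewrite derive1E.
  have d1 : is_derive a 1 (fun x : R => 1 + (-1) * x) (-1).
    apply: is_derive_eq (is_deriveD (is_derive_cst _ _ _)
      (is_deriveM (is_derive_cst _ _ _) (is_derive_id _ _))) _.
    by change (0 + ((-1) * 1 + a * 0) = -1 :> R); ring.
  have dy : is_derive a 1 (fun x : R => lambda * x + (1 - lambda)) lambda.
    apply: is_derive_eq (is_deriveD (is_deriveM (is_derive_cst _ _ _) (is_derive_id _ _))
      (is_derive_cst _ _ _)) _.
    by change (lambda * 1 + a * 0 + 0 = lambda); ring.
  have a1'' : 0 < 1 + (-1) * a by rewrite mulN1r.
  have ya'' : 0 < lambda * a + (1 - lambda) by move: ya; rewrite /y addrA.
  have dl1 := is_derive1_comp (f := @ln R) (g := fun x : R => 1 + (-1) * x) (is_derive1_ln a1'') d1.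
  have dly := is_derive1_comp (f := @ln R) (g := fun x : R => lambda * x + (1 - lambda))
    (is_derive1_ln ya'') dy.
  have dl := is_derive1_ln a0.
  have -> : g_M sigma lambda astar = (fun a => (g_const sigma lambda astar + (-2 * ln sigma) * a)
  + (- (lambda^-1) * (lambda * a + (1 - lambda))) * (@ln R \o (fun x => lambda * x + (1 - lambda))) a + (a + (-1) * (a * ln a))
  + ((-1) * (1 + (-1) * a)) * (@ln R \o (fun x => 1 + (-1) * x)) a).
    apply/funext => b; rewrite /g_M [(@ln R \o _) b]/= [(@ln R \o _) b]/=.
    rewrite (_ : 1 + (-1) * b = 1 - b); last by ring.
    rewrite (_ : lambda * b + (1 - lambda) = lambda * b + 1 - lambda); last by ring.
    have -> : (- b + 1 - lambda^-1) = - (lambda^-1) * (lambda * b + 1 - lambda).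
      by field; rewrite gt_eqF.
    by ring.
  have D := is_deriveD (is_deriveD (is_deriveD
    (is_deriveD (is_derive_cst (g_const sigma lambda astar) _ _)
      (is_deriveM (is_derive_cst (-2 * ln sigma : R) _ _) (is_derive_id _ _)))
    (is_deriveM (is_deriveM (is_derive_cst (- lambda^-1) _ _) dy) dly))
    (is_deriveD (is_derive_id _ _) (is_deriveM (is_derive_cst (-1 : R) _ _)
      (is_deriveM (is_derive_id _ _) dl))))
    (is_deriveM (is_deriveM (is_derive_cst (-1 : R) _ _) d1) dl1).
  have [_ ->] := D.
  change ((0 + (-2 * ln sigma * 1 + a * 0)) +
    ((- lambda^-1 * (lambda * a + (1 - lambda))) * ((lambda * a + (1 - lambda))^-1 * lambda)
     + ln (lambda * a + (1 - lambda)) * (- lambda^-1 * lambda + (lambda * a + (1 - lambda)) * 0)) +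
    (1 + ((-1) * (a * a^-1 + ln a * 1) + (a * ln a) * 0)) +
    (((-1) * (1 + (-1) * a)) * ((1 + (-1) * a)^-1 * (-1)) +
     ln (1 + (-1) * a) * ((-1) * (-1) + (1 + (-1) * a) * 0)) = g_slope a).
  have e1 : y a = lambda * a + (1 - lambda) by rewrite /y addrA.
  have e2 : 1 + (-1) * a = 1 - a by ring.
  rewrite /g_slope e1 e2.
  by field; rewrite !gt_eqF.
rewrite /g_slope.
have -> : - (ln (1 - a) - ln a - ln (y a) - 2 * ln sigma) =
  ln (sigma ^+ 2 * a * y a / (1 - a)).
  rewrite ln_div ?posrE ?mulr_gt0 ?exprn_gt0// lnM ?posrE ?mulr_gt0 ?exprn_gt0//.
  by rewrite lnM ?posrE ?exprn_gt0// lnXn// -mulr_natl; ring.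
by rewrite lnK ?posrE ?divr_gt0 ?mulr_gt0 ?exprn_gt0.
Qed.

End profile_properties.

(** * Logarithmic asymptotics of the expected coefficients *)

Section stirling.
Context (R : realType).

Lemma ln_le_subr1 (t : R) : 0 < t -> ln t <= t - 1.
Proof. by move=> t0; have := expR_ge1Dx (ln t); rewrite lnK ?posrE//; lra. Qed.

Lemma ln_ge_1subV (t : R) : 0 < t -> 1 - t^-1 <= ln t.
Proof.
move=> t0; have ti : 0 < t^-1 by rewrite invr_gt0.
by have := ln_le_subr1 ti; rewrite lnV ?posrE//; lra.
Qed.

Definition stirling_main (j : nat) : R := j%:R * ln j%:R - j%:R.

(** Elementary bounds suffice: the errors are divided by [n], so an error
    [O(ln n)] is harmless. *)
Lemma ln_fact_ge j : stirling_main j <= ln (j`!%:R : R).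
Proof.
rewrite /stirling_main; elim: j => [|j IH]; first by rewrite mul0r subr0 fact0 ln1.
rewrite factS natrM lnM ?posrE ?ltr0n ?fact_gt0//.
have [->|j0] := posnP j; first by rewrite fact0 ln1 mulr0; lra.
have jR : 0 < j%:R :> R by rewrite ltr0n.
have h : j%:R * (ln j.+1%:R - ln j%:R) <= 1 :> R.
  rewrite -ln_div ?posrE ?ltr0n//.
  have q0 : 0 < j.+1%:R / j%:R :> R by rewrite divr_gt0 ?ltr0n.
  apply: (@le_trans _ _ (j%:R * (j.+1%:R / j%:R - 1))).
    by rewrite ler_wpM2l ?ler0n// ln_le_subr1.
  rewrite le_eqVlt; apply/orP; left; apply/eqP; rewrite -natr1.
  by field; rewrite gt_eqF.
by move: IH h; rewrite -natr1; set A := ln (j%:R + 1); set B := ln j%:R; set F := ln _; nra.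
Qed.

Lemma ln_fact_le j : ln (j`!%:R : R) <= j.+1%:R * ln j.+1%:R - j%:R.
Proof.
elim: j => [|j IH]; first by rewrite fact0 !ln1 mulr0 subr0.
rewrite factS natrM lnM ?posrE ?ltr0n ?fact_gt0//.
have h : 1 <= j.+2%:R * (ln j.+2%:R - ln j.+1%:R) :> R.
  rewrite -ln_div ?posrE ?ltr0n//.
  have q0 : 0 < j.+2%:R / j.+1%:R :> R by rewrite divr_gt0 ?ltr0n.
  apply: (@le_trans _ _ (j.+2%:R * (1 - (j.+2%:R / j.+1%:R)^-1))); last first.
    by rewrite ler_wpM2l ?ler0n// ln_ge_1subV.
  by rewrite invf_div mulrBr mulr1 [in leRHS]mulrC divfK ?pnatr_eq0// -natrB// subSnn.
have e2 : j.+2%:R = j.+1%:R + 1 :> R by rewrite natr1.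
have e1 : j.+1%:R = j%:R + 1 :> R by rewrite natr1.
by move: IH h; rewrite e2 e1; set A := ln (j%:R + 1); set B := ln (_ + 1 + 1); set F := ln _; nra.
Qed.

Lemma stirling j : `|ln (j`!%:R : R) - stirling_main j| <= ln j.+1%:R + 1.
Proof.
have h1 := ln_fact_ge j; have h2 := ln_fact_le j.
have h : j%:R * (ln j.+1%:R - ln j%:R) <= 1 :> R.
  have [->|j0] := posnP j; first by rewrite mul0r.
  have jR : 0 < j%:R :> R by rewrite ltr0n.
  rewrite -ln_div ?posrE ?ltr0n//.
  have q0 : 0 < j.+1%:R / j%:R :> R by rewrite divr_gt0 ?ltr0n.
  apply: (@le_trans _ _ (j%:R * (j.+1%:R / j%:R - 1))).
    by rewrite ler_wpM2l ?ler0n// ln_le_subr1.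
  rewrite le_eqVlt; apply/orP; left; apply/eqP; rewrite -natr1.
  by field; rewrite gt_eqF.
rewrite ger0_norm ?subr_ge0//; move: h2 h1; rewrite /stirling_main.
move: h; rewrite -natr1; set A := ln (j%:R + 1); set B := ln j%:R; set F := ln _; nra.
Qed.

(** [laguerre_coef] consists of five factorials, powers of [m] and of [s]. *)
Lemma ln_laguerre_coef (s : R) (m n k : nat) : 0 < s -> (0 < m)%N -> (k <= n)%N ->
  (n - k <= m)%N ->
  `|ln (laguerre_coef s m n (n - k)) -
    (stirling_main n - stirling_main (n - k) - stirling_main k +
     (stirling_main m - stirling_main (m - (n - k))) -
     (n - k)%:R * ln m%:R + (n - k)%:R * ln s)| <= 5 * (ln (n + m).+1%:R + 1).
Proof.
move=> s0 m0 kn lm; set l := (n - k)%N.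
have ln_ : (l <= n)%N by rewrite leq_subr.
have fR j : 0 < j`!%:R :> R by rewrite ltr0n fact_gt0.
have eC : ln ('C(n, l)%:R : R) = ln n`!%:R - ln l`!%:R - ln k`!%:R.
  have := bin_fact ln_; rewrite subKn// => /(congr1 (fun z : nat => ln (z%:R : R))).
  rewrite natrM lnM ?posrE ?ltr0n ?bin_gt0 ?muln_gt0 ?fact_gt0//.
  by rewrite natrM lnM ?posrE//; lra.
have eF : ln ((m ^_ l)%:R : R) = ln m`!%:R - ln (m - l)`!%:R.
  have := ffact_fact lm => /(congr1 (fun z : nat => ln (z%:R : R))).
  by rewrite natrM lnM ?posrE ?ltr0n ?ffact_gt0 ?fact_gt0//; lra.
have mR : 0 < m%:R :> R by rewrite ltr0n.
have CR : 0 < 'C(n, l)%:R :> R by rewrite ltr0n bin_gt0.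
have FR : 0 < (m ^_ l)%:R :> R by rewrite ltr0n ffact_gt0.
have -> : ln (laguerre_coef s m n l) = ln n`!%:R - ln l`!%:R - ln k`!%:R +
    (ln m`!%:R - ln (m - l)`!%:R) - l%:R * ln m%:R + l%:R * ln s.
  rewrite /laguerre_coef lnM ?posrE ?mulr_gt0 ?invr_gt0 ?exprn_gt0//.
  rewrite lnM ?posrE ?mulr_gt0 ?invr_gt0 ?exprn_gt0// ln_div ?posrE ?exprn_gt0//.
  have lX (z : R) : 0 < z -> ln (z ^+ l) = l%:R * ln z by move=> z0; rewrite lnXn// mulr_natl.
  by rewrite !lX// eC eF; ring.
have mono j : (j <= n + m)%N -> `|ln (j`!%:R : R) - stirling_main j| <= ln (n + m).+1%:R + 1.
  move=> jnm; apply: le_trans (stirling j) _.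
  by rewrite lerD2r ler_ln ?posrE ?ltr0n// ler_nat.
have h1 := mono n (leq_addr _ _); have h2 := mono l (leq_trans ln_ (leq_addr _ _)).
have h3 := mono k (leq_trans kn (leq_addr _ _)); have h4 := mono m (leq_addl _ _).
have h5 : `|ln ((m - l)`!%:R : R) - stirling_main (m - l)| <= ln (n + m).+1%:R + 1.
  by apply: mono; apply: leq_trans (leq_addl n m); rewrite leq_subr.
move: h1 h2 h3 h4 h5; rewrite !ler_norml.
set E := ln (n + m).+1%:R.
move=> /andP[? ?] /andP[? ?] /andP[? ?] /andP[? ?] /andP[? ?].
by apply/andP; split; lra.
Qed.

End stirling.

Section log_profile.
Context (R : realType) (sigma lambda : R) (m : nat -> nat).
Hypothesis sigma_gt0 : 0 < sigma.
Hypothesis lambda_gt0 : 0 < lambda.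
Hypothesis m_gt0 : forall n, (0 < n)%N -> (0 < m n)%N.
Hypothesis m_lim : (fun n : nat => n%:R / (m n)%:R : R) @ \oo --> lambda.

Local Notation ls := (lambda_star lambda).

Lemma near_ratio (e : R) : 0 < e -> exists N, forall n, (N <= n)%N ->
  `|n%:R / (m n)%:R - lambda| <= e.
Proof.
move=> e0; have /cvgrPdist_le/(_ e e0)[N _ hN] := m_lim.
by exists N => n Nn; rewrite distrC; exact: hN.
Qed.

Lemma near_inv_ratio (e : R) : 0 < e -> exists N, forall n, (N <= n)%N ->
  `|(m n)%:R / n%:R - lambda^-1| <= e.
Proof.
move=> e0; have : (fun n : nat => (n%:R / (m n)%:R : R)^-1) @ \oo --> lambda^-1.
  by apply: cvgV => //; rewrite gt_eqF.
move=> /cvgrPdist_le/(_ e e0)[N _ hN].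
by exists N => n Nn; rewrite distrC -[(m n)%:R / n%:R]invf_div; exact: hN.
Qed.

Lemma near_le_mul (c : R) : 0 < c -> forall b : R, exists N, forall n, (N <= n)%N -> b <= c * n%:R.
Proof.
move=> c0 b; have [N _ hN] := @nbhs_infty_ger R (b / c).
by exists N => n Nn; rewrite mulrC -ler_pdivrMr//; exact: hN.
Qed.

Lemma near_log_error (tol : R) : 0 < tol -> exists N, forall n, (N <= n)%N ->
  5 * (ln (n + m n).+1%:R + 1) <= tol * n%:R.
Proof.
move=> t0; have il : 0 < lambda^-1 + 1 by rewrite addr_gt0 ?invr_gt0.
have [N1 h1] := near_inv_ratio ltr01.
pose th := tol / (20 * (lambda^-1 + 3)).
have th0 : 0 < th by rewrite divr_gt0// mulr_gt0// addr_gt0 ?invr_gt0.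
have t2 : 0 < tol / 2 by rewrite divr_gt0.
have [N2 h2] := near_le_mul t2 (5 * (1 - ln th)).
exists (maxn 1 (maxn N1 N2)) => n; rewrite !geq_max => /and3P[n0 /h1 n1 /h2 n2].
have nR : 1 <= n%:R :> R by rewrite ler1n.
have nR0 : 0 < n%:R :> R by lra.
have mle : (m n)%:R <= (lambda^-1 + 1) * n%:R :> R.
  by rewrite -ler_pdivrMr//; move: n1; rewrite ler_norml => /andP[_]; lra.
have le1 : (n + m n).+1%:R <= (lambda^-1 + 3) * n%:R :> R.
  by rewrite -natr1 natrD; lra.
have l0 : 0 < (n + m n).+1%:R :> R by rewrite ltr0n.
have lnle : ln (n + m n).+1%:R <= th * (n + m n).+1%:R - ln th.
  have p0 : 0 < th * (n + m n).+1%:R by rewrite mulr_gt0.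
  by have := ln_le_subr1 p0; rewrite lnM ?posrE//; lra.
have h3 : th * (n + m n).+1%:R <= th * ((lambda^-1 + 3) * n%:R) by rewrite ler_wpM2l// ltW.
have e3 : th * ((lambda^-1 + 3) * n%:R) = tol / 20 * n%:R.
  have w0 : 0 < lambda^-1 + 3 by rewrite addr_gt0 ?invr_gt0.
  by rewrite /th; move: w0; set w := _ + 3 => w0; field; rewrite gt_eqF.
rewrite e3 in h3.
have h4 : tol / 20 * n%:R = (tol * n%:R) / 20 by ring.
have h5 : tol / 2 * n%:R = (tol * n%:R) / 2 by ring.
rewrite h4 in h3; rewrite h5 in n2; have t3 : 0 <= tol * n%:R by rewrite mulr_ge0// ltW.
move: lnle h3 n2 t3; set Y := tol * n%:R; set Z := th * _; set A := ln (n + m n).+1%:R; set B := ln th; lra.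
Qed.

Let Phi (t : R) := t * ln t.

Let Phi_bound t : 0 < t -> t <= 1 -> `|Phi t| <= 1.
Proof.
move=> t0 t1; rewrite ler_norml /Phi.
have h := ln_ge_1subV t0; have h2 : ln t <= 0 by rewrite ln_le0.
have h3 : t * (1 - t^-1) <= t * ln t by rewrite ler_wpM2l// ltW.
rewrite mulrBr mulr1 divff ?gt_eqF// in h3.
have h4 : t * ln t <= 0 by rewrite mulr_ge0_le0// ltW.
by apply/andP; split; lra.
Qed.

Let Phi_lipschitz (dl t u : R) : 0 < dl -> dl <= t -> t <= 1 -> dl <= u -> u <= 1 ->
  Phi t - Phi u <= (1 + `|ln dl|) * `|t - u|.
Proof.
move=> d0 dt t1 du u1; have t0 : 0 < t by apply: lt_le_trans dt.
have u0 : 0 < u by apply: lt_le_trans du.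
have [->|ut] := eqVneq u t; first by rewrite !subrr mulr_ge0.
have h := xlnx_tangent t0 u0 ut.
apply: (@le_trans _ _ ((1 + ln t) * (t - u))); first by rewrite /Phi; lra.
apply: le_trans (ler_norm _) _; rewrite normrM ler_wpM2r//.
have lt0 : ln t <= 0 by rewrite ln_le0.
have ld : ln dl <= ln t by rewrite ler_ln ?posrE.
rewrite (ler0_norm (le_trans ld lt0)) ler_norml; apply/andP; split; lra.
Qed.

(** The additive constant between the profile of [laguerre_coef] and [g_M]; it
    is also the exponential growth rate of the sum of the [ecoef]. *)
Definition log_shift (astar : R) := 2 * ln sigma - 1 - g_const sigma lambda astar.

(** In the bulk the index [l = n - k] stays away from [m] by a positive fraction
    of [m], as [lambda_star] is the limit of [1 - m / n] when that is positive. *)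
Lemma bulk_margin (eps : R) : 0 < eps -> exists N, forall n k, (N <= n)%N ->
  (ls + eps) * n%:R <= k%:R -> k%:R <= n%:R :> R ->
  [/\ (0 < n)%N, (n - k <= m n)%N, lambda * eps / 2 <= 1 - n%:R / (m n)%:R * (1 - k%:R / n%:R) &
  lambda * eps / 2 * (m n)%:R <= (m n - (n - k))%:R].
Proof.
move=> e0; have d0 : 0 < lambda * eps / 2 by rewrite divr_gt0// mulr_gt0.
have [N1 h1] := near_ratio d0.
exists (maxn 1 N1) => n k; rewrite geq_max => /andP[n0 /h1 n1] lk kn.
have nR : 0 < n%:R :> R by rewrite ltr0n.
have mR : 0 < (m n)%:R :> R by rewrite ltr0n m_gt0.
have knN : (k <= n)%N by rewrite -(ler_nat R).
have a1 : k%:R / n%:R <= 1 :> R by rewrite ler_pdivrMr// mul1r.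
have al : ls + eps <= k%:R / n%:R by rewrite ler_pdivlMr.
have lsl := lambda_star_le lambda; have ls0 := lambda_star_ge0 lambda.
have r_ge : lambda * eps / 2 <= 1 - n%:R / (m n)%:R * (1 - k%:R / n%:R).
  have h : lambda * (1 - lambda^-1 + eps) <= lambda * (k%:R / n%:R).
    by rewrite ler_wpM2l ?(ltW lambda_gt0)//; lra.
  rewrite mulrDr mulrBr mulr1 divff ?gt_eqF// in h.
  move: n1; rewrite ler_norml => /andP[_ n1].
  set a := k%:R / n%:R in a1 al h *; set rho := n%:R / (m n)%:R in n1 *.
  have a0 : 0 <= a by lra.
  have : rho * (1 - a) <= (lambda + lambda * eps / 2) * (1 - a).
    by rewrite ler_wpM2r//; lra.
  have : lambda * eps / 2 * (1 - a) <= lambda * eps / 2.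
    by rewrite ler_piMr ?(ltW d0)//; lra.
  by move=> *; lra.
have lE : (n - k)%:R = n%:R / (m n)%:R * (1 - k%:R / n%:R) * (m n)%:R :> R.
  by rewrite natrB//; field; rewrite !gt_eqF.
have lm : (n - k <= m n)%N.
  rewrite -(ler_nat R) lE -[leRHS]mul1r ler_wpM2r ?(ltW mR)//; lra.
split => //; rewrite natrB// lE.
have -> : (m n)%:R - n%:R / (m n)%:R * (1 - k%:R / n%:R) * (m n)%:R =
  (1 - n%:R / (m n)%:R * (1 - k%:R / n%:R)) * (m n)%:R :> R by ring.
by rewrite ler_wpM2r// ltW.
Qed.

(** With [k = a n], the main terms of Stirling's formula combine into values of
    [t ln t] at [a], [1 - a] and [1 - (n / m)(1 - a)]; the last argument
    converges to [lambda a + 1 - lambda] uniformly in [a], away from [0], where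
    [t ln t] is Lipschitz. *)
Lemma log_laguerre_coef (astar eps tol : R) : 0 < eps -> 0 < tol ->
  exists N, forall n k, (N <= n)%N ->
  (ls + eps) * n%:R <= k%:R -> k%:R <= (1 - eps) * n%:R ->
  `|n%:R^-1 * ln (laguerre_coef (sigma ^+ 2) (m n) n (n - k)) -
    (g_M sigma lambda astar (k%:R / n%:R) + log_shift astar)| <= tol.
Proof.
move=> e0 t0.
pose dl := lambda * eps / 2; have d0 : 0 < dl by rewrite divr_gt0// mulr_gt0.
pose K := 1 + `|ln dl|; have K0 : 0 < K by rewrite ltr_pwDl.
have t3 : 0 < tol / 3 by rewrite divr_gt0.
have tK : 0 < tol / 3 * lambda / K by rewrite divr_gt0// mulr_gt0.
have [N1 h1] := near_ratio tK; have [N2 h2] := near_inv_ratio t3.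
have [N3 h3] := near_log_error t3; have [N4 h4] := bulk_margin e0.
exists (maxn (maxn N1 N2) (maxn N3 N4)) => n k; rewrite !geq_max.
move=> /andP[/andP[/h1 n1 /h2 n2] /andP[/h3 n3 N4n]] lk ku.
have ls0 := lambda_star_ge0 lambda.
have kn : k%:R <= n%:R :> R.
  by apply: le_trans ku _; rewrite ler_piMl// lerBlDr lerDl ltW.
have [n0 lm r_ge _] := h4 n k N4n lk kn.
have nR : 0 < n%:R :> R by rewrite ltr0n.
have mN := m_gt0 n0.
have mR : 0 < (m n)%:R :> R by rewrite ltr0n.
have knN : (k <= n)%N by rewrite -(ler_nat R).
pose a : R := k%:R / n%:R; pose rho : R := n%:R / (m n)%:R.
pose r := 1 - rho * (1 - a); pose y := lambda * a + 1 - lambda.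
have al : ls + eps <= a by rewrite /a ler_pdivlMr.
have a1 : a <= 1 - eps by rewrite /a ler_pdivrMr.
have a0 : 0 < a by lra.
have b0 : 0 < 1 - a by lra.
have s2 : 0 < sigma ^+ 2 by rewrite exprn_gt0.
have rho0 : 0 < rho by rewrite divr_gt0.
have r1 : r <= 1 by rewrite /r lerBlDr lerDl mulr_ge0// ltW.
have r0 : 0 < r by apply: lt_le_trans r_ge.
have y_ge : dl <= y.
  have lsl := lambda_star_le lambda.
  have h : lambda * (1 - lambda^-1 + eps) <= lambda * a by rewrite ler_wpM2l ?(ltW lambda_gt0)//; lra.
  rewrite mulrDr mulrBr mulr1 divff ?gt_eqF// in h.
  have : 0 < lambda * eps by rewrite mulr_gt0.
  by rewrite /dl /y; lra.
have y1 : y <= 1.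
  have : lambda * a <= lambda * 1 by rewrite ler_wpM2l ?(ltW lambda_gt0)//; lra.
  by rewrite /y; lra.
have ry : `|r - y| <= tol / 3 * lambda / K.
  have -> : r - y = (lambda - rho) * (1 - a) by rewrite /r /y; ring.
  rewrite normrM (ger0_norm (ltW b0)) distrC.
  by apply: le_trans n1; rewrite ler_piMr//; lra.
have main := ln_laguerre_coef s2 mN knN lm.
have kE : k%:R = a * n%:R :> R by rewrite /a divfK// gt_eqF.
have lE : (n - k)%:R = (1 - a) * n%:R :> R by rewrite natrB// mulrBl mul1r -kE.
have mlE : (m n - (n - k))%:R = r * (m n)%:R :> R.
  rewrite natrB// lE /r /rho; by field; rewrite gt_eqF.
pose c : R := (m n)%:R / n%:R.
have mainE : n%:R^-1 * (stirling_main R n - stirling_main R (n - k) - stirling_main R k +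
     (stirling_main R (m n) - stirling_main R (m n - (n - k))) -
     (n - k)%:R * ln (m n)%:R + (n - k)%:R * ln (sigma ^+ 2)) =
   - Phi (1 - a) - Phi a - c * Phi r - (1 - a) + (1 - a) * (2 * ln sigma).
  have l1 : ln ((1 - a) * n%:R) = ln (1 - a) + ln n%:R by apply: lnM; rewrite posrE.
  have l2 : ln (a * n%:R) = ln a + ln n%:R by apply: lnM; rewrite posrE.
  have l3 : ln (r * (m n)%:R) = ln r + ln (m n)%:R by apply: lnM; rewrite posrE.
  have l4 : ln (sigma ^+ 2) = ln sigma + ln sigma by apply: lnM; rewrite posrE.
  rewrite /stirling_main mlE lE kE l1 l2 l3 l4 /Phi /c.
  have -> : r = ((m n)%:R - (1 - a) * n%:R) / (m n)%:R.
    by rewrite /r /rho; field; rewrite gt_eqF.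
  set lr := ln (_ / (m n)%:R).
  by field; rewrite !gt_eqF.
have gE : g_M sigma lambda astar a + log_shift astar =
   - Phi (1 - a) - Phi a - lambda^-1 * Phi y - (1 - a) + (1 - a) * (2 * ln sigma).
  rewrite /g_M /log_shift -/y /Phi.
  have -> : (- a + 1 - lambda^-1) = - (lambda^-1 * y).
    by rewrite /y; field; rewrite gt_eqF.
  by ring.
have err : `|c * Phi r - lambda^-1 * Phi y| <= tol / 3 + tol / 3.
  have -> : c * Phi r - lambda^-1 * Phi y = (c - lambda^-1) * Phi r + lambda^-1 * (Phi r - Phi y) by ring.
  apply: le_trans (ler_normD _ _) (lerD _ _).
    rewrite normrM; apply: le_trans n2; rewrite -[leRHS]mulr1 ler_wpM2l//.
    exact: Phi_bound.
  rewrite normrM (ger0_norm (ltW (_ : 0 < lambda^-1))) ?invr_gt0//.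
  have hP : `|Phi r - Phi y| <= K * `|r - y|.
    rewrite ler_norml; apply/andP; split; last exact: Phi_lipschitz.
    by rewrite lerNl opprB distrC; exact: Phi_lipschitz.
  rewrite ler_pdivrMl//; apply: le_trans hP _.
  by rewrite mulrC -ler_pdivlMr// [lambda * _]mulrC.
have := main => /(ler_wpM2l (ltW (_ : 0 < n%:R^-1))); rewrite invr_gt0 => /(_ nR).
rewrite -[X in X * `|_|](ger0_norm (ltW (_ : 0 < n%:R^-1))) ?invr_gt0// -normrM mulrBr mainE.
have : n%:R^-1 * (5 * (ln (n + m n).+1%:R + 1)) <= tol / 3.
  by rewrite ler_pdivrMl// [leRHS]mulrC.
move=> hh /le_trans/(_ hh).
rewrite gE -/a; move: err; rewrite !ler_norml => /andP[? ?] /andP[? ?].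
by apply/andP; split; lra.
Qed.

End log_profile.

(** * Removing the shift *)

Section crude_bounds.
Context (R : realType).

Lemma bin_mul_expr_le (eta : R) M j : 0 <= eta -> 'C(M, j)%:R * eta ^+ j <= (1 + eta) ^+ M.
Proof.
move=> e0; have [jM|Mj] := leqP j M; last by rewrite bin_small// mul0r exprn_ge0// addr_ge0.
rewrite exprDn (bigD1 (inord j : 'I_M.+1))//= inordK ?ltnS// expr1n mul1r mulr_natl.
by rewrite lerDl sumr_ge0// => i _; rewrite mulrn_wge0// expr1n mul1r exprn_ge0.
Qed.

Lemma ffact_ge M j a : (a + j <= M)%N -> (a ^ j <= M ^_ j)%N.
Proof.
elim: j => [|j IH] h; first by rewrite ffactn0 expn0.
by rewrite ffactnSr expnSr leq_mul//; [apply: IH; lia|lia].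
Qed.

Lemma ffact_le M j : (M ^_ j <= M ^ j)%N.
Proof.
by elim: j => [|j IH]; rewrite ?ffactn0// ffactnSr expnSr leq_mul// leq_subr.
Qed.

Lemma laguerre_coef_le (s : R) M n l : 0 < s -> (l <= n)%N ->
  laguerre_coef s M n l <= (2 * Num.max s 1) ^+ n.
Proof.
move=> s0 ln; rewrite /laguerre_coef.
have h1 : 'C(n, l)%:R <= 2 ^+ n :> R.
  by have := bin_mul_expr_le n l (@ler01 R); rewrite expr1n mulr1.
have h2 : (M ^_ l)%:R / M%:R ^+ l <= 1 :> R.
  have [->|M0] := posnP M.
    by case: (l) => [|l']; rewrite ?expr0 ?ffactn0 ?divr1// ffact0n mul0r.
  by rewrite ler_pdivrMr ?exprn_gt0 ?ltr0n// mul1r -natrX ler_nat ffact_le.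
have h3 : s ^+ l <= Num.max s 1 ^+ n.
  apply: (@le_trans _ _ (Num.max s 1 ^+ l)).
    by rewrite lerXn2r ?nnegrE ?le_max ?lexx ?ler01 ?orbT// ltW.
  by rewrite ler_weXn2l// le_max lexx orbT.
have s0' := ltW s0.
rewrite exprMn ler_pM ?exprn_ge0 ?mulr_ge0 ?invr_ge0 ?exprn_ge0//.
by rewrite -[leRHS]mulr1 ler_pM// mulr_ge0 ?invr_ge0 ?exprn_ge0.
Qed.

Lemma laguerre_coef_ge (s dl : R) M n l : 0 < s -> 0 < dl -> (0 < M)%N -> (l <= n)%N ->
  (l <= M)%N -> dl * M%:R <= (M - l)%:R ->
  Num.min (dl * s) 1 ^+ n <= laguerre_coef s M n l.
Proof.
move=> s0 d0 M0 ln lM dM; have MR : 0 < M%:R :> R by rewrite ltr0n.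
set c := Num.min _ _; have c0 : 0 < c by rewrite lt_min mulr_gt0/=.
have c1 : c <= 1 by rewrite ge_min lexx orbT.
apply: (@le_trans _ _ (c ^+ l)); first by rewrite ler_wiXn2l// ltW.
apply: (@le_trans _ _ ((dl * s) ^+ l)).
  have cds : c <= dl * s by rewrite ge_min lexx.
  by apply: lerXn2r => //; rewrite nnegrE ltW// (lt_le_trans c0).
rewrite exprMn /laguerre_coef ler_wpM2r ?exprn_ge0 ?(ltW s0)//.
apply: (@le_trans _ _ ((M ^_ l)%:R / M%:R ^+ l)).
  rewrite ler_pdivlMr ?exprn_gt0// -exprMn.
  apply: (@le_trans _ _ ((M - l)%:R ^+ l)).
    by rewrite lerXn2r ?nnegrE ?mulr_ge0// ltW.
  by rewrite -natrX ler_nat ffact_ge// subnK.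
rewrite -[leLHS]mul1r ler_wpM2r ?mulr_ge0 ?invr_ge0 ?exprn_ge0//.
by rewrite ler1n bin_gt0.
Qed.

Lemma laguerre_coef_step (s : R) M n l : (0 < M)%N -> (l < n)%N ->
  l.+1%:R * M%:R * laguerre_coef s M n l.+1 =
  (n - l)%:R * (M - l)%:R * s * laguerre_coef s M n l.
Proof.
move=> M0 ln; have MR : M%:R != 0 :> R by rewrite pnatr_eq0 -lt0n.
rewrite /laguerre_coef ffactnSr natrM.
have h : l.+1%:R * 'C(n, l.+1)%:R = (n - l)%:R * 'C(n, l)%:R :> R.
  by rewrite -!natrM mul_bin_left.
transitivity ((l.+1%:R * 'C(n, l.+1)%:R) * (M%:R * ((M ^_ l)%:R * (M - l)%:R / M%:R ^+ l.+1)) * s ^+ l.+1).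
  by ring.
rewrite h !exprS; field; by rewrite expf_neq0 ?MR.
Qed.

(** In the bulk the ratio of consecutive coefficients is bounded below. *)
Lemma laguerre_coef_growth (s c dl : R) M n l t : 0 < s -> 0 <= c -> 0 <= dl -> (0 < M)%N ->
  (l + t <= n)%N -> c * n%:R <= (n - (l + t))%:R -> dl * M%:R <= (M - (l + t))%:R ->
  (c * dl * s) ^+ t * laguerre_coef s M n l <= laguerre_coef s M n (l + t).
Proof.
move=> s0 c0 d0 M0; have MR : 0 < M%:R :> R by rewrite ltr0n.
elim: t => [|t IH] ltn cn dM; first by rewrite expr0 mul1r addn0.
have nR : 0 < n%:R :> R by rewrite ltr0n (leq_trans _ ltn)// addnS.
have h1 : (c * dl * s) ^+ t * laguerre_coef s M n l <= laguerre_coef s M n (l + t).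
  apply: IH; first by rewrite (leq_trans _ ltn)// leq_add2l.
    by apply: le_trans cn _; rewrite ler_nat leq_sub2l// leq_add2l.
  by apply: le_trans dM _; rewrite ler_nat leq_sub2l// leq_add2l.
have lt : (l + t < n)%N by rewrite -addnS.
have st := laguerre_coef_step s M0 lt.
have f0 : 0 <= laguerre_coef s M n (l + t) by apply: laguerre_coef_ge0; exact: ltW.
have f1 : 0 <= laguerre_coef s M n (l + t).+1 by apply: laguerre_coef_ge0; exact: ltW.
rewrite addnS exprS -mulrA.
apply: (@le_trans _ _ (c * dl * s * laguerre_coef s M n (l + t))).
  by rewrite ler_wpM2l// !mulr_ge0// ltW.
have nM0 : 0 < n%:R * M%:R :> R by rewrite mulr_gt0.
rewrite -(ler_pM2l nM0).
apply: (@le_trans _ _ ((n - (l + t))%:R * (M - (l + t))%:R * s * laguerre_coef s M n (l + t))).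
  have -> : n%:R * M%:R * (c * dl * s * laguerre_coef s M n (l + t)) =
     (c * n%:R) * (dl * M%:R) * s * laguerre_coef s M n (l + t) by ring.
  rewrite ler_wpM2r// ler_wpM2r ?(ltW s0)// ler_pM ?mulr_ge0//.
    by apply: le_trans cn _; rewrite ler_nat leq_sub2l// leq_add2l.
  by apply: le_trans dM _; rewrite ler_nat leq_sub2l// leq_add2l.
by rewrite -st ler_wpM2r// ler_wpM2r// ler_nat.
Qed.

End crude_bounds.

Section deregularization.
Context (R : realType) (sigma lambda : R) (m : nat -> nat) (x : nat * nat -> R).
Hypothesis sigma_gt0 : 0 < sigma.
Hypothesis lambda_gt0 : 0 < lambda.
Hypothesis m_gt0 : forall n, (0 < n)%N -> (0 < m n)%N.
Hypothesis m_lim : (fun n : nat => n%:R / (m n)%:R : R) @ \oo --> lambda.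
Hypothesis ecoef_le : forall eps, 0 < eps -> exists N, forall n l, (N <= n)%N -> (l <= n)%N ->
  ecoef 0 x (m n) n l <= expR (eps * n%:R) * laguerre_coef (sigma ^+ 2) (m n) n l.
Hypothesis ecoef_ge : forall (eps dl : R) (p : nat), 0 < eps -> 0 < dl ->
  exists2 s, sigma ^+ 2 - eps <= s & exists N, forall n l,
    (N <= n)%N -> (l <= n)%N -> (l <= m n)%N -> dl * (m n)%:R <= (m n - l)%:R ->
    laguerre_coef s (m n) n l <= expR (eps * n%:R) * ecoef p.+1%:R^-1 x (m n) n l.

Local Notation ls := (lambda_star lambda).
Local Notation f n l := (laguerre_coef (sigma ^+ 2) (m n) n l).
Local Notation e n l := (ecoef 0 x (m n) n l).

Let s2_gt0 : 0 < sigma ^+ 2. Proof. by rewrite exprn_gt0. Qed.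

Lemma small_inv_succ (t : R) : 0 < t -> exists p : nat, p.+1%:R^-1 <= t.
Proof.
move=> t0; have [N _ hN] := @nbhs_infty_ger R t^-1.
exists N; rewrite -[leRHS]invrK lef_pV2 ?posrE ?invr_gt0//.
by apply: (hN N.+1 (leqnSn N)).
Qed.

(** Suppose that [ecoef 0] were small at all indices in a window of length
    [th * n] below [l = n - k].  In the expansion of the regularized coefficient
    [ecoef eta] at [l], the terms in the window would then be small because
    [eta] is small compared with [tol], and the others because they carry a
    factor [eta ^+ j] with [j > th * n], which beats the exponential upper bound.
    This contradicts the lower bound on [ecoef eta]. *)
Lemma window (eps th tol : R) : 0 < eps -> 0 < th -> 0 < tol ->
  exists N, forall n k, (N <= n)%N -> (ls + eps) * n%:R <= k%:R -> k%:R <= n%:R :> R ->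
  exists l1, [/\ (l1 <= n - k)%N, (n - k)%:R <= l1%:R + th * n%:R :> R &
    expR (- tol * n%:R) * f n (n - k) <= e n l1].
Proof.
move=> eps0 th0 tol0; pose t := tol / 5; have t0 : 0 < t by rewrite divr_gt0.
(* every [laguerre_coef] is at most [B ^+ n], and those of the bulk are at
   least [c ^+ n]; [C0] bounds [m / n] *)
pose dl := lambda * eps / 2; have dl0 : 0 < dl by rewrite divr_gt0// mulr_gt0.
pose B := 2 * Num.max (sigma ^+ 2) 1; pose c := Num.min (dl * sigma ^+ 2) 1.
have B0 : 0 < B by rewrite mulr_gt0// lt_max s2_gt0.
have c0 : 0 < c by rewrite lt_min mulr_gt0/=.
pose C0 := lambda^-1 + 1; have C00 : 0 < C0 by rewrite addr_gt0 ?invr_gt0.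
(* [eta ^+ j] with [j > th * n] is at most [expR (- La * n)], which compensates
   the binomial coefficient, the upper bound and the ratio [B / c] *)
pose La := C0 * ln 2 + t + ln B - ln c + 4 * t.
have [p hp] : exists p : nat, p.+1%:R^-1 <= Num.min (t / C0) (expR (- (La / th))).
  by apply: small_inv_succ; rewrite lt_min divr_gt0//= expR_gt0.
pose eta : R := p.+1%:R^-1; have eta0 : 0 < eta by rewrite invr_gt0 ltr0n.
have /andP[eta1 eta2] : (eta <= t / C0) && (eta <= expR (- (La / th))).
  by move: hp; rewrite le_min.
have etale1 : eta <= 1 by rewrite invf_le1 ?ltr0n// ler1n.
have lneta : th * ln eta <= - La.
  rewrite mulrC -ler_pdivlMr// -ler_expR lnK ?posrE//.
  by apply: le_trans eta2 _; rewrite mulNr.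
have e10 : 0 < sigma ^+ 2 * (1 - expR (- t)).
  by rewrite mulr_gt0// subr_gt0 expR_lt1 oppr_lt0.
have emin : 0 < Num.min t (sigma ^+ 2 * (1 - expR (- t))) by rewrite lt_min t0.
have [s sge [N1 h1]] := ecoef_ge p emin dl0.
have [N2 h2] := ecoef_le t0.
have [N3 h3] := bulk_margin lambda_gt0 m_gt0 m_lim eps0.
have [N4 h4] := near_inv_ratio lambda_gt0 m_lim (@ltr01 R).
have [D D0 hD] := succn_le_expR t0.
have [N5 h5] := near_le_mul t0 (1 + ln (2 * D)).
exists (maxn (maxn N1 N2) (maxn N3 (maxn N4 N5))) => n k; rewrite !geq_max.
move=> /andP[/andP[N1n N2n] /and3P[N3n /h4 n4 /h5 n5]] lk kn.
have [n0 lm _ dm] := h3 n k N3n lk kn.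
have nR : 0 < n%:R :> R by rewrite ltr0n.
set l := (n - k)%N in lm dm *; have lln : (l <= n)%N by rewrite leq_subr.
have mN := m_gt0 n0.
have mle : (m n)%:R <= C0 * n%:R :> R.
  by rewrite -ler_pdivrMr//; move: n4; rewrite ler_norml /C0 => /andP[_]; lra.
have fc : c ^+ n <= f n l by apply: laguerre_coef_ge.
have f0 : 0 < f n l by apply: lt_le_trans fc; rewrite exprn_gt0.
(* replacing [sigma ^+ 2] by the truncated variance [s] costs [expR (t * n)] *)
have s_ge : sigma ^+ 2 * expR (- t) <= s.
  apply: le_trans sge; rewrite lerBrDr.
  apply: (@le_trans _ _ (sigma ^+ 2 * expR (- t) + sigma ^+ 2 * (1 - expR (- t)))).
    by rewrite lerD2l ge_min lexx orbT.
  by rewrite -mulrDr addrC subrK mulr1.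
have fs : expR (- t * n%:R) * f n l <= laguerre_coef s (m n) n l.
  rewrite /laguerre_coef mulrCA ler_wpM2l ?mulr_ge0 ?invr_ge0 ?exprn_ge0//.
  apply: (@le_trans _ _ ((sigma ^+ 2 * expR (- t)) ^+ l)); last first.
    have q0 : 0 <= sigma ^+ 2 * expR (- t) by rewrite mulr_ge0 ?expR_ge0// ltW.
    by apply: lerXn2r => //; rewrite nnegrE// (le_trans q0).
  have -> : (sigma ^+ 2 * expR (- t)) ^+ l = (sigma ^+ 2) ^+ l * expR (- t) ^+ l by exact: exprMn.
  have q0 : 0 <= (sigma ^+ 2) ^+ l by rewrite exprn_ge0// ltW.
  rewrite [leLHS]mulrC; apply: ler_wpM2l => //; rewrite -expRM_natr ler_expR.
  by rewrite !mulNr lerN2 ler_wpM2l ?ler_nat// ltW.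
have low : f n l <= expR (2 * t * n%:R) * ecoef eta x (m n) n l.
  have hl := h1 n l N1n lln lm dm.
  have -> : 2 * t * n%:R = t * n%:R + t * n%:R by ring.
  rewrite expRD -mulrA -ler_pdivrMl ?expR_gt0// -expRN -mulNr.
  apply: le_trans fs _; apply: le_trans hl _; rewrite ler_wpM2r ?ecoef_ge0 ?(ltW eta0)//.
  by rewrite ler_expR ler_wpM2r// ge_min lexx.
(* from here on every coefficient in the window is assumed to be small *)
apply: contrapT => nowin.
have small l1 : (l1 <= l)%N -> l%:R <= l1%:R + th * n%:R :> R ->
    e n l1 <= expR (- tol * n%:R) * f n l.
  move=> l1l hl; rewrite leNgt; apply/negP => h; apply: nowin.
  by exists l1; split => //; exact: ltW.
have pow_m (b : R) : 0 <= b -> expR b ^+ m n <= expR (b * C0 * n%:R).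
  by move=> b0; rewrite -expRM_natr ler_expR -mulrA ler_wpM2l.
have term j : (j <= l)%N ->
    'C(m n - l + j, j)%:R * eta ^+ j * e n (l - j) <= 2 * (expR (- 4 * t * n%:R) * f n l).
  move=> jl; have Mle : (m n - l + j <= m n)%N by rewrite -[leqRHS](subnK lm) leq_add2l.
  have e0 : 0 <= e n (l - j) by exact: ecoef_ge0.
  have P0 : 0 <= expR (- 4 * t * n%:R) * f n l by rewrite mulr_ge0 ?expR_ge0// ltW.
  apply: (@le_trans _ _ (expR (- 4 * t * n%:R) * f n l)); last by lra.
  have [jth|thj] := leP j%:R (th * n%:R).
    have sm : e n (l - j) <= expR (- tol * n%:R) * f n l.
      by apply: small; [exact: leq_subr|rewrite (natrB R jl); lra].
    have big1 : 'C(m n - l + j, j)%:R * eta ^+ j <= expR (t * n%:R).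
      apply: le_trans (bin_mul_expr_le _ _ (ltW eta0)) _.
      apply: (@le_trans _ _ ((1 + eta) ^+ m n)).
        by rewrite ler_weXn2l// lerDl ltW.
      apply: (@le_trans _ _ (expR eta ^+ m n)).
        by rewrite lerXn2r ?nnegrE ?expR_ge0 ?expR_ge1Dx// addr_ge0// ltW.
      apply: le_trans (pow_m _ (ltW eta0)) _; rewrite ler_expR ler_wpM2r//.
      by rewrite -ler_pdivlMr.
    apply: (@le_trans _ _ (expR (t * n%:R) * (expR (- tol * n%:R) * f n l))).
      by rewrite ler_pM// mulr_ge0// exprn_ge0// ltW.
    rewrite mulrA -expRD le_eqVlt; apply/orP; left; apply/eqP; congr (expR _ * _).
    by rewrite /t; field.
  have ljn : (l - j <= n)%N by apply: leq_trans lln; exact: leq_subr.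
  have hU := h2 n (l - j)%N N2n ljn.
  have hB := laguerre_coef_le (m n) s2_gt0 ljn.
  have eU : e n (l - j) <= expR (t * n%:R) * B ^+ n.
    by apply: le_trans hU _; rewrite ler_wpM2l ?expR_ge0.
  have b2 : 'C(m n - l + j, j)%:R <= expR (ln 2) ^+ m n :> R.
    rewrite lnK ?posrE//.
    have := bin_mul_expr_le (m n - l + j) j (@ler01 R); rewrite expr1n mulr1 => /le_trans; apply.
    by rewrite (_ : 1 + 1 = 2 :> R)// ler_weXn2l// ler1n.
  have l20 : 0 <= ln 2 :> R by rewrite ln_ge0// ler1n.
  have b3 := le_trans b2 (pow_m _ l20).
  have p3 : eta ^+ j <= expR (- La * n%:R).
    rewrite -[eta]lnK ?posrE// -expRM_natr ler_expR.
    apply: (@le_trans _ _ (ln eta * (th * n%:R))).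
      by rewrite ler_wnM2l ?ln_le0// ltW.
    by rewrite mulrA (mulrC (ln eta)) ler_wpM2r.
  apply: (@le_trans _ _ ((expR (ln 2 * C0 * n%:R) * expR (- La * n%:R)) *
     (expR (t * n%:R) * expR (ln B * n%:R)))).
    apply: ler_pM => //; first by rewrite mulr_ge0// exprn_ge0// ltW.
      by rewrite ler_pM// exprn_ge0// ltW.
    by apply: le_trans eU _; rewrite [expR (ln B * _)]expRM_natr lnK ?posrE.
  apply: (@le_trans _ _ (expR (- 4 * t * n%:R) * c ^+ n)); last by rewrite ler_wpM2l ?expR_ge0.
  rewrite -[c]lnK ?posrE// -expRM_natr -!expRD ler_expR /La.
  by rewrite le_eqVlt; apply/orP; left; apply/eqP; ring.
have sum_le : ecoef eta x (m n) n l <= n.+1%:R * (2 * (expR (- 4 * t * n%:R) * f n l)).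
  rewrite (ecoef_shift eta x n lm).
  apply: (@le_trans _ _ (\sum_(j < l.+1) (2 * (expR (- 4 * t * n%:R) * f n l)))).
    by apply: ler_sum => j _; apply: term; rewrite -ltnS.
  rewrite sumr_const card_ord -[leLHS]mulr_natl ler_wpM2r ?ler_nat//.
  by apply: mulr_ge0 => //; apply: mulr_ge0; [exact: expR_ge0|exact: ltW].
have : f n l <= 2 * D * expR (- (t * n%:R)) * f n l.
  apply: le_trans low _.
  apply: (@le_trans _ _ (expR (2 * t * n%:R) *
    ((D * expR (t * n%:R)) * (2 * (expR (- 4 * t * n%:R) * f n l))))).
    rewrite ler_wpM2l ?expR_ge0//; apply: le_trans sum_le _.
    apply: ler_wpM2r => //; apply: mulr_ge0 => //.
    by apply: mulr_ge0; [exact: expR_ge0|exact: ltW].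
  rewrite le_eqVlt; apply/orP; left; apply/eqP.
  have -> : - (t * n%:R) = 2 * t * n%:R + t * n%:R + (- 4 * t * n%:R) by ring.
  by rewrite !expRD; ring.
rewrite -{1}[f n l]mul1r ler_pM2r//; apply/negP; rewrite -ltNge.
rewrite expRN ltr_pdivrMr ?expR_gt0// mul1r.
have D20 : 0 < 2 * D by rewrite mulr_gt0.
by rewrite -[ltLHS]lnK ?posrE// ltr_expR; lra.
Qed.

(** Use [window] at [n - k] and at a slightly larger index; this produces large
    coefficients on both sides of [n - k], and unimodality transfers the bound
    to [n - k].  Moving the index costs only a small exponential factor by
    [laguerre_coef_growth]. *)
Lemma ecoef_bulk_ge (eps tol : R) : 0 < eps -> 0 < tol -> exists N, forall n k, (N <= n)%N ->
  (ls + eps) * n%:R <= k%:R -> k%:R <= n%:R :> R ->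
  expR (- tol * n%:R) * f n (n - k) <= e n (n - k).
Proof.
move=> eps0 tol0.
have e20 : 0 < eps / 2 by rewrite divr_gt0.
pose dl := lambda * (eps / 2) / 2; have dl0 : 0 < dl by rewrite divr_gt0// mulr_gt0.
(* [c1] bounds from below the ratio of consecutive coefficients in the bulk, and
   [th] is such that [2 * th * n] of these ratios cost at most
   [expR (tol / 2 * n)] *)
pose c1 := Num.min 1 (eps / 2 * dl * sigma ^+ 2).
have c10 : 0 < c1 by rewrite lt_min ltr01 !mulr_gt0.
have c11 : c1 <= 1 by rewrite ge_min lexx.
have lc1 : ln c1 <= 0 by rewrite ln_le0.
pose K := 1 - ln c1; have K0 : 0 < K by rewrite /K; lra.
pose th := Num.min (eps / 4) (tol / (4 * K)).
have th0 : 0 < th by rewrite lt_min !divr_gt0// mulr_gt0.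
have t20 : 0 < tol / 2 by rewrite divr_gt0.
have [N1 h1] := window e20 th0 t20.
have [N2 h2] := bulk_margin lambda_gt0 m_gt0 m_lim e20.
have [N3 h3] := near_le_mul th0 1.
exists (maxn N1 (maxn N2 N3)) => n k; rewrite !geq_max => /and3P[N1n N2n /h3 n3] lk kn.
have ls0 := lambda_star_ge0 lambda.
have knN : (k <= n)%N by rewrite -(ler_nat R).
have nR0 : 0 <= n%:R :> R by [].
have lk2 : (ls + eps / 2) * n%:R <= k%:R.
  apply: le_trans lk; rewrite ler_wpM2r// lerD2l.
  by move: eps0; clear -sigma_gt0 lambda_gt0 m_gt0 m_lim ecoef_le ecoef_ge; lra.
have [l1 [l1l _ el1]] := h1 n k N1n lk2 kn.
have tn0 : 0 <= th * n%:R by rewrite mulr_ge0// ltW.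
pose t := (Num.truncn (th * n%:R)).+1.
have /andP[tlo thi] : (th * n%:R < t%:R) && (t%:R <= th * n%:R + 1).
  have /andP[a b] := truncn_itv tn0.
  by rewrite /t b /= -natr1 lerD2r.
have tle : t%:R <= eps / 2 * n%:R.
  have : th * n%:R <= eps / 4 * n%:R by rewrite ler_wpM2r// ge_min lexx.
  have -> : eps / 2 * n%:R = eps / 4 * n%:R + eps / 4 * n%:R by field.
  by move: thi n3; clear -sigma_gt0 lambda_gt0 m_gt0 m_lim ecoef_le ecoef_ge; lra.
have kt : (t <= k)%N.
  rewrite -(ler_nat R); apply: le_trans tle _; by apply: le_trans lk2; rewrite ler_wpM2r// lerDr.
have lk3 : (ls + eps / 2) * n%:R <= (k - t)%:R.
  rewrite natrB//; move: lk tle; rewrite !mulrDl.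
  have -> : eps / 2 * n%:R = (eps * n%:R) / 2 by ring.
  by set A := ls * _; set B := eps * _; clear -sigma_gt0 lambda_gt0 m_gt0 m_lim ecoef_le ecoef_ge; lra.
have kn3 : (k - t)%:R <= n%:R :> R by apply: le_trans kn; rewrite ler_nat leq_subr.
have [l2 [l2l ll2 el2]] := h1 n (k - t)%N N1n lk3 kn3.
have [n0 lm _ dm] := h2 n (k - t)%N N2n lk3 kn3.
have lt : (n - (k - t) = n - k + t)%N by rewrite subnBA// addnBAC.
rewrite lt in l2l ll2 el2 lm dm.
have ll2' : (n - k <= l2)%N.
  by rewrite -(ler_nat R); move: ll2 tlo; rewrite natrD; clear -sigma_gt0 lambda_gt0 m_gt0 m_lim ecoef_le ecoef_ge; lra.
have fgrow : (eps / 2 * dl * sigma ^+ 2) ^+ t * f n (n - k) <= f n (n - k + t).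
  apply: laguerre_coef_growth => //; rewrite ?(ltW e20) ?(ltW dl0)//.
  - exact: m_gt0.
  - by rewrite -lt leq_subr.
  have -> : (n - (n - k + t) = k - t)%N by rewrite -lt subKn// (leq_trans (leq_subr _ _)).
  by apply: le_trans lk3; rewrite ler_wpM2r// lerDr.
have f0 : 0 <= f n (n - k) by apply: laguerre_coef_ge0; exact: sqr_ge0.
have c1t : expR (- (tol / 2) * n%:R) <= c1 ^+ t.
  rewrite -[c1]lnK ?posrE// -expRM_natr ler_expR.
  apply: (@le_trans _ _ (ln c1 * (2 * (th * n%:R)))); last first.
    by apply: ler_wnM2l => //; rewrite mulr_natl mulr2n (le_trans thi)// lerD2l.
  have hK : - ln c1 * th <= tol / 4.
    apply: (@le_trans _ _ (K * th)); first by rewrite ler_wpM2r ?(ltW th0)// /K lerDr.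
    apply: (@le_trans _ _ (K * (tol / (4 * K)))).
      by rewrite ler_wpM2l ?(ltW K0)// ge_min lexx orbT.
    by rewrite le_eqVlt; apply/orP; left; apply/eqP; field; rewrite gt_eqF.
  have := ler_wpM2r nR0 hK.
  have -> : - ln c1 * th * n%:R = - (ln c1 * (th * n%:R)) by ring.
  have -> : ln c1 * (2 * (th * n%:R)) = 2 * (ln c1 * (th * n%:R)) by ring.
  have -> : tol / 4 * n%:R = tol * n%:R / 4 by ring.
  have -> : - (tol / 2) * n%:R = - (tol * n%:R / 2) by ring.
  by set A := ln c1 * _; set C := tol * _; clear -sigma_gt0 lambda_gt0 m_gt0 m_lim ecoef_le ecoef_ge; lra.
have e2f : expR (- tol * n%:R) * f n (n - k) <= e n l2.
  apply: le_trans el2.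
  have -> : - tol * n%:R = - (tol / 2) * n%:R + - (tol / 2) * n%:R by field.
  rewrite expRD -mulrA ler_wpM2l ?expR_ge0//.
  apply: le_trans fgrow; rewrite ler_wpM2r//; apply: le_trans c1t _.
  have c1b : c1 <= eps / 2 * dl * sigma ^+ 2 by rewrite ge_min lexx orbT.
  by apply: lerXn2r => //; rewrite nnegrE ltW// (lt_le_trans c10).
have e1f : expR (- tol * n%:R) * f n (n - k) <= e n l1.
  apply: le_trans el1; rewrite ler_wpM2r// ler_expR ler_wpM2r// lerN2.
  by move: tol0; clear -sigma_gt0 lambda_gt0 m_gt0 m_lim ecoef_le ecoef_ge; lra.
have h : (l1 <= n - k <= l2)%N by rewrite l1l.
apply: le_trans (ecoef_unimodal x (m n) n (lexx 0) h).
by rewrite le_min e1f.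
Qed.

End deregularization.

(** * The profile of the normalized coefficients *)

Section deterministic_profile.
Context (R : realType) (sigma lambda : R) (m : nat -> nat) (x : nat * nat -> R).
Hypothesis sigma_gt0 : 0 < sigma.
Hypothesis lambda_gt0 : 0 < lambda.
Hypothesis m_gt0 : forall n, (0 < n)%N -> (0 < m n)%N.
Hypothesis m_lim : (fun n : nat => n%:R / (m n)%:R : R) @ \oo --> lambda.
Hypothesis ecoef_le : forall eps, 0 < eps -> exists N, forall n l, (N <= n)%N -> (l <= n)%N ->
  ecoef 0 x (m n) n l <= expR (eps * n%:R) * laguerre_coef (sigma ^+ 2) (m n) n l.
Hypothesis ecoef_ge : forall (eps dl : R) (p : nat), 0 < eps -> 0 < dl ->
  exists2 s, sigma ^+ 2 - eps <= s & exists N, forall n l,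
    (N <= n)%N -> (l <= n)%N -> (l <= m n)%N -> dl * (m n)%:R <= (m n - l)%:R ->
    laguerre_coef s (m n) n l <= expR (eps * n%:R) * ecoef p.+1%:R^-1 x (m n) n l.
Variable astar : R.
Hypothesis astarP : is_alpha_star sigma lambda astar.

Local Notation ls := (lambda_star lambda).
Local Notation f n l := (laguerre_coef (sigma ^+ 2) (m n) n l).
Local Notation e n l := (ecoef 0 x (m n) n l).
Local Notation g := (g_M sigma lambda astar).
Local Notation h0 := (log_shift sigma lambda astar).

Let e_ge0 n l : 0 <= e n l. Proof. exact: ecoef_ge0. Qed.

Lemma log_near (a b c t : R) n : (0 < n)%N -> 0 < a ->
  expR (- t * n%:R) * a <= b -> b <= expR (t * n%:R) * a ->
  `|n%:R^-1 * ln a - c| <= t -> 0 < b /\ `|n%:R^-1 * ln b - c| <= t + t.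
Proof.
move=> n0 a0 ab ba h; have nR : 0 < n%:R :> R by rewrite ltr0n.
have b0 : 0 < b by apply: lt_le_trans ab; rewrite mulr_gt0// expR_gt0.
split=> //.
have lo : - t * n%:R + ln a <= ln b.
  rewrite -[X in X + _ <= _]expRK -lnM ?posrE ?expR_gt0// ler_ln ?posrE//.
  by rewrite mulr_gt0// expR_gt0.
have hi : ln b <= t * n%:R + ln a.
  rewrite -[X in _ <= X + _]expRK -lnM ?posrE ?expR_gt0// ler_ln ?posrE//.
  by rewrite mulr_gt0// expR_gt0.
have lo' : - t + n%:R^-1 * ln a <= n%:R^-1 * ln b.
  by rewrite ler_pdivlMl// mulrDr mulrA divff ?gt_eqF// mul1r mulrC.
have hi' : n%:R^-1 * ln b <= t + n%:R^-1 * ln a.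
  by rewrite ler_pdivrMl// mulrDr mulrA divff ?gt_eqF// mul1r mulrC.
move: h lo' hi'; rewrite !ler_norml; set u := _ * ln b; set v := _ * ln a.
by move=> /andP[? ?] *; apply/andP; split; lra.
Qed.

Lemma log_ecoef (eps tol : R) : 0 < eps -> 0 < tol -> exists N, forall n k, (N <= n)%N ->
  (ls + eps) * n%:R <= k%:R -> k%:R <= (1 - eps) * n%:R ->
  0 < e n (n - k) /\ `|n%:R^-1 * ln (e n (n - k)) - (g (k%:R / n%:R) + h0)| <= tol.
Proof.
move=> eps0 tol0; have t0 : 0 < tol / 2 by rewrite divr_gt0.
have [N1 h1] := ecoef_le t0.
have [N2 h2] := ecoef_bulk_ge sigma_gt0 lambda_gt0 m_gt0 m_lim ecoef_le ecoef_ge eps0 t0.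
have [N3 h3] := log_laguerre_coef sigma_gt0 lambda_gt0 m_gt0 m_lim astar eps0 t0.
have [N4 h4] := bulk_margin lambda_gt0 m_gt0 m_lim eps0.
exists (maxn (maxn N1 N2) (maxn N3 N4)) => n k; rewrite !geq_max.
move=> /andP[/andP[N1n N2n] /andP[N3n N4n]] lk ku.
have kn : k%:R <= n%:R :> R.
  by apply: le_trans ku _; rewrite ler_piMl// lerBlDr lerDl ltW.
have [n0 lm _ _] := h4 n k N4n lk kn.
have f0 : 0 < f n (n - k).
  apply: (laguerre_coef_gt0 _ (m_gt0 n0) (leq_subr _ _) lm).
  by rewrite exprn_gt0.
rewrite [tol]splitr; apply: (log_near n0 f0 (h2 n k N2n lk kn)).
  by apply: h1 => //; exact: leq_subr.
exact: h3.
Qed.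

Let g_continuous a : ls < a < 1 -> {for a, continuous g}.
Proof.
move=> aI; apply/differentiable_continuous/derivable1_diffP.
exact: (@g_smooth R sigma lambda lambda_gt0 astar 0 a aI).
Qed.

Lemma near_truncn (a tol : R) : ls < a < 1 -> 0 < tol -> exists N, forall n, (N <= n)%N ->
  `|g ((Num.truncn (a * n%:R))%:R / n%:R) - g a| <= tol.
Proof.
move=> aI tol0; have := g_continuous aI.
move/cvgrPdist_le => /(_ tol tol0) /nbhs_ballP[d /= d0 hd].
have [N hN] := near_le_mul d0 2.
exists (maxn 1 N) => n; rewrite geq_max => /andP[n0 /hN n1].
have nR : 0 < n%:R :> R by rewrite ltr0n.
rewrite distrC; apply: hd; rewrite /ball /=.
have a0 : 0 <= a * n%:R.
  by rewrite mulr_ge0// ltW// (le_lt_trans (lambda_star_ge0 lambda))//; case/andP: aI.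
have /andP[lo hi] := truncn_itv a0.
set k := (Num.truncn _)%:R in lo *; rewrite -natr1 -/k in hi.
have -> : a - k / n%:R = (a * n%:R - k) / n%:R by field; rewrite gt_eqF.
rewrite normrM ger0_norm ?subr_ge0// gtr0_norm ?invr_gt0//.
by rewrite ltr_pdivrMr//; move: hi n1; set q := a * _; set q' := d * _; lra.
Qed.

Lemma truncn_bulk (a eps : R) : ls + 2 * eps <= a -> a <= 1 - eps -> 0 < eps ->
  exists N, forall n, (N <= n)%N ->
  (ls + eps) * n%:R <= (Num.truncn (a * n%:R))%:R /\
  (Num.truncn (a * n%:R))%:R <= (1 - eps) * n%:R.
Proof.
move=> la a1 eps0; have [N hN] := near_le_mul eps0 1.
exists N => n /hN n1; have ls0 := lambda_star_ge0 lambda.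
have nR : 0 <= n%:R :> R by [].
have a0 : 0 <= a * n%:R by rewrite mulr_ge0//; lra.
have /andP[lo hi] := truncn_itv a0; rewrite -natr1 in hi.
split; last by apply: le_trans lo _; rewrite ler_wpM2r.
have : (ls + 2 * eps) * n%:R <= a * n%:R by rewrite ler_wpM2r.
have -> : (ls + 2 * eps) * n%:R = ls * n%:R + 2 * (eps * n%:R) by ring.
rewrite (mulrDl ls); move: hi n1.
by set A := ls * _; set B := eps * _; set C := a * _; set D := (Num.truncn _)%:R; lra.
Qed.

Lemma log_ecoef_at (a tol : R) : ls < a < 1 -> 0 < tol -> exists N, forall n, (N <= n)%N ->
  0 < e n (n - Num.truncn (a * n%:R)) /\
  `|n%:R^-1 * ln (e n (n - Num.truncn (a * n%:R))) - (g a + h0)| <= tol.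
Proof.
move=> aI tol0; have t0 : 0 < tol / 2 by rewrite divr_gt0.
have /andP[la a1] := aI.
pose eps := Num.min ((a - ls) / 2) (1 - a).
have eps0 : 0 < eps by rewrite lt_min divr_gt0 ?subr_gt0.
have e1 : eps <= (a - ls) / 2 by rewrite ge_min lexx.
have e2 : eps <= 1 - a by rewrite ge_min lexx orbT.
have la' : ls + 2 * eps <= a by lra.
have a1' : a <= 1 - eps by lra.
have [N1 h1] := truncn_bulk la' a1' eps0.
have [N2 h2] := near_truncn aI t0; have [N3 h3] := log_ecoef eps0 t0.
exists (maxn N1 (maxn N2 N3)) => n; rewrite !geq_max => /and3P[/h1[k1 k2] /h2 g1 N3n].
have [p0 hp] := h3 n _ N3n k1 k2; split => //.
move: hp g1; set q := n%:R^-1 * _; set u := g (_ / _); rewrite !ler_norml.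
by move=> /andP[? ?] /andP[? ?]; apply/andP; split; lra.
Qed.

(** The largest coefficient gives the lower bound.  For the upper bound choose
    [a1 < astar < a2]: the coefficients at [n - a1 n] and [n - a2 n] are smaller
    than the one at [n - astar n], so by unimodality those outside this range
    are smaller too, while those inside are controlled by [log_ecoef] and
    [g <= 0].  There are only [n + 1] terms. *)
Lemma log_det_sum (tol : R) : 0 < tol -> exists N, forall n, (N <= n)%N ->
  [/\ (0 < n)%N, 0 < \sum_(l < n.+1) e n l &
  `|n%:R^-1 * ln (\sum_(l < n.+1) e n l) - h0| <= tol].
Proof.
move=> tol0.
have [sI _] := astarP; have /andP[ls_a a_1] := sI.
(* [th] is so small that estimates with precision [th] separate [g a1] and
   [g a2] from [g astar = 0] *)
pose a1 := (ls + astar) / 2; pose a2 := (astar + 1) / 2.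
have a1I : ls < a1 < 1 by rewrite /a1; apply/andP; split; lra.
have a2I : ls < a2 < 1 by rewrite /a2; apply/andP; split; lra.
have g1 : g a1 < 0 by apply: g_lt0 => //; rewrite lt_eqF// /a1; lra.
have g2 : g a2 < 0 by apply: g_lt0 => //; rewrite gt_eqF// /a2; lra.
have gs : g astar = 0 by exact: g_alpha_star.
pose th := Num.min (tol / 3) (Num.min (- g a1 / 3) (- g a2 / 3)).
have th0 : 0 < th by rewrite !lt_min !divr_gt0// oppr_gt0.
have th1 : th <= tol / 3 by rewrite ge_min lexx.
have th2 : th <= - g a1 / 3 by rewrite !ge_min lexx orbT.
have th3 : th <= - g a2 / 3 by rewrite !ge_min lexx !orbT.
have [N0 hs] := log_ecoef_at sI th0.
have [N1 h1] := log_ecoef_at a1I th0; have [N2 h2] := log_ecoef_at a2I th0.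
pose eps := Num.min ((a1 - ls) / 2) (1 - a2).
have eps0 : 0 < eps.
  by rewrite lt_min divr_gt0 ?subr_gt0//; [case/andP: a2I|case/andP: a1I].
have e1 : eps <= (a1 - ls) / 2 by rewrite ge_min lexx.
have e2 : eps <= 1 - a2 by rewrite ge_min lexx orbT.
have a12 : a1 <= a2 by rewrite /a1 /a2; lra.
have la1 : ls + 2 * eps <= a1 by lra.
have a1e : a1 <= 1 - eps by lra.
have la2 : ls + 2 * eps <= a2 by lra.
have a2e : a2 <= 1 - eps by lra.
have [N3 h3] := truncn_bulk la1 a1e eps0; have [N4 h4] := truncn_bulk la2 a2e eps0.
have [N5 h5] := log_ecoef eps0 th0.
have [D D0 hD] := succn_le_expR th0.
have [N6 h6] := near_le_mul th0 (ln D).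
exists (maxn (maxn 1 (maxn N0 N1)) (maxn (maxn N2 N3) (maxn N4 (maxn N5 N6)))) => n.
rewrite !geq_max => /andP[/andP[n0 /andP[/hs[ps es] /h1[p1 es1]]]].
move=> /andP[/andP[/h2[p2 es2] /h3[lk1 _]] /andP[/h4[_ k2u] /andP[N5n /h6 n6]]].
have nR : 0 < n%:R :> R by rewrite ltr0n.
set k1 := Num.truncn (a1 * n%:R) in p1 es1 lk1.
set ks := Num.truncn (astar * n%:R) in ps es.
set k2 := Num.truncn (a2 * n%:R) in p2 es2 k2u.
have k1s : (k1 <= ks)%N by apply: le_truncn; rewrite ler_wpM2r// /a1; lra.
have ks2 : (ks <= k2)%N by apply: le_truncn; rewrite ler_wpM2r// /a2; lra.
have ln_lt (u v : R) : 0 < u -> 0 < v -> n%:R^-1 * ln u < n%:R^-1 * ln v -> u < v.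
  by move=> u0 v0; rewrite ltr_pM2l ?invr_gt0// ltr_ln ?posrE.
have e1s : e n (n - k1) < e n (n - ks).
  apply: ln_lt => //; move: es es1; rewrite gs add0r !ler_norml.
  by move=> /andP[? ?] /andP[? ?]; lra.
have e2s : e n (n - k2) < e n (n - ks).
  apply: ln_lt => //; move: es es2; rewrite gs add0r !ler_norml.
  by move=> /andP[? ?] /andP[? ?]; lra.
have ln_le_exp (u : R) : 0 < u -> n%:R^-1 * ln u - h0 <= th -> u <= expR ((h0 + th) * n%:R).
  move=> u0 hu; rewrite -[u]lnK ?posrE// ler_expR mulrC -ler_pdivrMl//.
  by rewrite addrC -lerBlDr.
have bound l : (l <= n)%N -> e n l <= expR ((h0 + th) * n%:R).
  move=> lln; have esb : e n (n - ks) <= expR ((h0 + th) * n%:R).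
    apply: ln_le_exp => //; move: es; rewrite gs add0r => es; exact: le_trans (ler_norm _) es.
  have lE : (n - (n - l) = l)%N by rewrite subKn.
  have [lk|kl] := ltnP (n - l) k1.
    have hh : (n - ks <= n - k1 <= l)%N.
      by apply/andP; split; [exact: leq_sub2l|rewrite -[leqRHS]lE leq_sub2l// ltnW].
    have := ecoef_unimodal x (m n) n (lexx 0) hh; rewrite ge_min => /orP[|el].
      by move=> /(lt_le_trans e1s); rewrite ltxx.
    by apply: le_trans el _; apply: le_trans (ltW e1s) esb.
  have [lk|kl2] := ltnP k2 (n - l).
    have hh : (l <= n - k2 <= n - ks)%N.
      by apply/andP; split; [rewrite -[leqLHS]lE leq_sub2l// ltnW|exact: leq_sub2l].
    have := ecoef_unimodal x (m n) n (lexx 0) hh; rewrite ge_min => /orP[el|].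
      by apply: le_trans el _; apply: le_trans (ltW e2s) esb.
    by move=> /(lt_le_trans e2s); rewrite ltxx.
  have lk : (ls + eps) * n%:R <= (n - l)%:R by apply: le_trans lk1 _; rewrite ler_nat.
  have ku : (n - l)%:R <= (1 - eps) * n%:R by apply: le_trans k2u; rewrite ler_nat.
  have [p0] := h5 n (n - l)%N N5n lk ku; rewrite lE in p0 * => hl.
  apply: ln_le_exp => //; have gl : g ((n - l)%:R / n%:R) <= 0.
    apply: g_le0 => //; rewrite ltr_pdivlMr// ltr_pdivrMr//; apply/andP; split.
      by apply: lt_le_trans lk; rewrite ltr_pM2r// ltrDl.
    by apply: le_lt_trans ku _; rewrite ltr_pM2r// ltrBlDr ltrDl.
  by move: hl; rewrite ler_norml => /andP[_ ?]; lra.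
have S0 : 0 < \sum_(l < n.+1) e n l.
  have lt : (n - ks < n.+1)%N by rewrite ltnS leq_subr.
  by rewrite (bigD1 (Ordinal lt))//= ltr_pwDl// sumr_ge0.
split => //.
have lo : ln (e n (n - ks)) <= ln (\sum_(l < n.+1) e n l).
  rewrite ler_ln ?posrE//; have lt : (n - ks < n.+1)%N by rewrite ltnS leq_subr.
  by rewrite (bigD1 (Ordinal lt))//= lerDl sumr_ge0.
have hi : ln (\sum_(l < n.+1) e n l) <= (h0 + 3 * th) * n%:R.
  rewrite -[leRHS]expRK ler_ln ?posrE ?expR_gt0//.
  apply: (@le_trans _ _ (n.+1%:R * expR ((h0 + th) * n%:R))).
    have -> : n.+1%:R * expR ((h0 + th) * n%:R) = \sum_(l < n.+1) expR ((h0 + th) * n%:R).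
      by rewrite sumr_const card_ord mulr_natl.
    by apply: ler_sum => l _; apply: bound; rewrite -ltnS.
  apply: (@le_trans _ _ ((expR (th * n%:R) * expR (th * n%:R)) * expR ((h0 + th) * n%:R))).
    rewrite ler_wpM2r ?expR_ge0//; apply: le_trans (hD n) _.
    by rewrite ler_wpM2r ?expR_ge0// -[leLHS]lnK ?posrE// ler_expR.
  by rewrite -!expRD ler_expR le_eqVlt; apply/orP; left; apply/eqP; ring.
have lo' : n%:R^-1 * ln (e n (n - ks)) <= n%:R^-1 * ln (\sum_(l < n.+1) e n l).
  by rewrite ler_wpM2l// invr_ge0 ltW.
have hi' : n%:R^-1 * ln (\sum_(l < n.+1) e n l) <= h0 + 3 * th.
  by rewrite ler_pdivrMl// mulrC.
move: es lo' hi'; rewrite gs add0r !ler_norml.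
set u := n%:R^-1 * _; set v := n%:R^-1 * _ => /andP[? ?] ? ?.
by apply/andP; split; lra.
Qed.

Lemma log_det_coef (eps tol : R) : 0 < eps -> 0 < tol -> exists N, forall n k, (N <= n)%N ->
  (ls + eps) * n%:R <= k%:R -> k%:R <= (1 - eps) * n%:R ->
  [/\ (0 < n)%N, 0 < det_coef (cov_mx x (m n) n) k &
   `|n%:R^-1 * ln (det_coef (cov_mx x (m n) n) k) - g (k%:R / n%:R)| <= tol].
Proof.
move=> eps0 tol0; have t0 : 0 < tol / 2 by rewrite divr_gt0.
have [N1 h1] := log_ecoef eps0 t0; have [N2 h2] := log_det_sum t0.
exists (maxn N1 N2) => n k; rewrite geq_max => /andP[N1n /h2[n0 S0 hS]] lk ku.
have [p0 hp] := h1 n k N1n lk ku.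
have kn : (k <= n)%N.
  rewrite -(ler_nat R); apply: le_trans ku _.
  by rewrite ler_piMl// lerBlDr lerDl ltW.
rewrite det_coefE//; split => //; first by rewrite divr_gt0.
rewrite ln_div ?posrE// mulrBr; move: hp hS.
set u := n%:R^-1 * _; set v := n%:R^-1 * _; rewrite !ler_norml.
by move=> /andP[? ?] /andP[? ?]; apply/andP; split; lra.
Qed.

(** If [lambda_star > 0], then [n - k] exceeds [m], the largest possible rank of
    the covariance matrix.  If [lambda_star = 0] there is no such [k]. *)
Lemma det_coef_eq0 (eps : R) : 0 < eps -> exists N, forall n k, (N <= n)%N ->
  k%:R <= (ls - eps) * n%:R -> (0 < n)%N /\ det_coef (cov_mx x (m n) n) k = 0.
Proof.
move=> eps0; have e20 : 0 < eps / 2 by rewrite divr_gt0.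
have [N hN] := near_inv_ratio lambda_gt0 m_lim e20.
exists (maxn 1 N) => n k; rewrite geq_max => /andP[n0 /hN n1] ku; split => //.
have nR : 0 < n%:R :> R by rewrite ltr0n.
have ls1 := lambda_star_lt1 lambda_gt0.
have kn : (k <= n)%N.
  rewrite -(ler_nat R); apply: le_trans ku _.
  by rewrite ler_piMl ?ltW//; lra.
have k0 : 0 <= (ls - eps) * n%:R by apply: le_trans ku.
have lse : 0 <= ls - eps by move: k0; rewrite pmulr_lge0.
have lsE : ls = 1 - lambda^-1.
  move: lse; rewrite /lambda_star; case: (leP (1 - lambda^-1) 0) => //; lra.
rewrite det_coefE// /ecoef ifF ?mul0r//.
apply/negP => h; have : (n - k)%:R <= (m n)%:R :> R by rewrite ler_nat.
have : (m n)%:R / n%:R <= lambda^-1 + eps / 2.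
  by move: n1; rewrite ler_norml => /andP[_]; lra.
rewrite ler_pdivrMr// natrB//; move: ku; rewrite lsE.
have -> : (1 - lambda^-1 - eps) * n%:R = n%:R - lambda^-1 * n%:R - eps * n%:R by ring.
have -> : (lambda^-1 + eps / 2) * n%:R = lambda^-1 * n%:R + eps * n%:R / 2 by ring.
have : 0 < eps * n%:R by rewrite mulr_gt0.
by set A := lambda^-1 * _; set B := eps * _; lra.
Qed.

End deterministic_profile.

(** * Almost sure convergence *)

Lemma cvg_ereal_sup0 (R : realType) (F : nat -> nat -> \bar R) (S : nat -> set nat) :
  (forall tol : R, 0 < tol -> exists N, forall n, (N <= n)%N -> S n !=set0 /\
     forall k, S n k -> exists2 r, F n k = r%:E & 0 <= r <= tol) ->
  (fun n => ereal_sup [set F n k | k in S n]) @ \oo --> 0%E.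
Proof.
move=> h; have b (tol : R) : 0 < tol -> \forall n \near \oo,
    (0%:E <= ereal_sup [set F n k | k in S n] <= tol%:E)%E.
  move=> /h[N hN]; exists N => // n /hN[[k Snk] hF]; apply/andP; split.
    apply: le_ereal_sup_tmp; exists (F n k); first by exists k.
    by have [r -> /andP[r0 _]] := hF k Snk; rewrite lee_fin.
  apply: ge_ereal_sup => _ [j Snj <-].
  by have [r -> /andP[_ rt]] := hF j Snj; rewrite lee_fin.
apply/fine_cvgP; split.
  apply: filterS (b 1 ltr01) => n /andP[lo hi].
  by rewrite fin_numElt (lt_le_trans _ lo) ?ltNyr// (le_lt_trans hi) ?ltry.
apply/cvgrPdist_le => tol tol0; apply: filterS (b tol tol0) => n /andP[lo hi] /=.
have fn : ereal_sup [set F n k | k in S n] \is a fin_num.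
  by rewrite fin_numElt (lt_le_trans _ lo) ?ltNyr// (le_lt_trans hi) ?ltry.
move: lo hi; rewrite -(fineK fn) !lee_fin /= => lo hi.
by rewrite sub0r normrN ger0_norm.
Qed.

Section almost_sure_events.
Context d (T : measurableType d) (R : realType) (P : probability T R).
Context (X : nat * nat -> {RV P >-> R}) (sigma lambda : R) (m : nat -> nat).
Hypothesis sigma_gt0 : 0 < sigma.
Hypothesis X_indep : independent_RVs P X.
Hypothesis X_idist : identically_distributed P X.
Hypothesis X_mean : forall j, ('E_P[X j] = 0)%E.
Hypothesis X_var : forall j, ('V_P[X j] = (sigma ^+ 2)%:E)%E.
Hypothesis m_gt0 : forall n, (0 < n)%N -> (0 < m n)%N.
Hypothesis m_lim : (fun n : nat => n%:R / (m n)%:R : R) @ \oo --> lambda.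
Let x w ij := X ij w.

(** Countably many values of [eps] suffice, by monotonicity. *)
Lemma ae_ecoef_le_all : {ae P, forall w, forall eps, 0 < eps ->
  exists N, forall n l, (N <= n)%N -> (l <= n)%N ->
  ecoef 0 (x w) (m n) n l <= expR (eps * n%:R) * laguerre_coef (sigma ^+ 2) (m n) n l}.
Proof.
have h (p : nat) : 0 < p.+1%:R^-1 :> R by rewrite invr_gt0 ltr0n.
have := ae_foralln (fun p => ae_ecoef_le sigma_gt0 X_indep X_mean X_var m_gt0 (h p)).
apply: filterS => w hw eps /small_inv_succ[p pe]; have [N hN] := hw p.
exists N => n l Nn ln; apply: le_trans (hN n l Nn ln) _; apply: ler_wpM2r.
  by apply: laguerre_coef_ge0; exact: sqr_ge0.
by rewrite ler_expR ler_wpM2r.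
Qed.

(** As for the upper bound, with the truncation level chosen as a function of
    [eps] so that [s] is positive and close to the variance. *)
Lemma ae_ecoef_ge_all : {ae P, forall w, forall (eps dl : R) (p : nat), 0 < eps -> 0 < dl ->
  exists2 s, sigma ^+ 2 - eps <= s & exists N, forall n l,
    (N <= n)%N -> (l <= n)%N -> (l <= m n)%N -> dl * (m n)%:R <= (m n - l)%:R ->
    laguerre_coef s (m n) n l <= expR (eps * n%:R) * ecoef p.+1%:R^-1 (x w) (m n) n l}.
Proof.
have h (p : nat) : 0 < p.+1%:R^-1 :> R by rewrite invr_gt0 ltr0n.
have s2 : 0 < sigma ^+ 2 / 2 by rewrite divr_gt0// exprn_gt0.
have countable (i j p : nat) : {ae P, forall w,
    exists2 s, sigma ^+ 2 - i.+1%:R^-1 <= s & exists N, forall n l,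
    (N <= n)%N -> (l <= n)%N -> (l <= m n)%N ->
    j.+1%:R^-1 * (m n)%:R <= (m n - l)%:R :> R ->
    laguerre_coef s (m n) n l <= expR (i.+1%:R^-1 * n%:R) * ecoef p.+1%:R^-1 (x w) (m n) n l}.
  have t0 : 0 < Num.min i.+1%:R^-1 (sigma ^+ 2 / 2) by rewrite lt_min h.
  have [K [s [K0 sge hs]]] := cut_sqr_approx X_idist X_mean X_var (0, 0)%N t0.
  have s0 : 0 < s.
    apply: lt_le_trans sge; rewrite subr_gt0 gt_min; apply/orP; right.
    by move: s2; set q := sigma ^+ 2; lra.
  have := ae_ecoef_ge X_indep X_mean X_var m_gt0 m_lim K0 hs s0 (h p) (h j) (h i).
  apply: filterS => w hw; exists s => //; apply: le_trans sge.
  by rewrite lerD2l lerN2 ge_min lexx.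
have := ae_foralln (fun i => ae_foralln (fun j => ae_foralln (countable i j))).
apply: filterS => w hw eps dl p /small_inv_succ[i ie] /small_inv_succ[j jd].
have [s sge [N hN]] := hw i j p; exists s; first by apply: le_trans sge; rewrite lerD2l lerN2.
exists N => n l Nn ln lm dm; have dm' : j.+1%:R^-1 * (m n)%:R <= (m n - l)%:R :> R.
  by apply: le_trans dm; rewrite ler_wpM2r.
apply: le_trans (hN n l Nn ln lm dm') _; apply: ler_wpM2r; last by rewrite ler_expR ler_wpM2r.
by apply: ecoef_ge0; exact: ltW.
Qed.

End almost_sure_events.
Theorem theorem6p1 (R : realType) (d : measure_display) (T : measurableType d)
    (P : probability T R) (X : nat * nat -> {RV P >-> R})
    (sigma lambda : R) (m : nat -> nat)
    (sigma_gt0 : 0 < sigma) (lambda_gt0 : 0 < lambda)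
    (X_indep : independent_RVs P X)
    (X_idist : identically_distributed P X)
    (X_mean : forall ij, ('E_P[X ij] = 0)%E)
    (X_var : forall ij, ('V_P[X ij] = (sigma ^+ 2)%:E)%E)
    (m_gt0 : forall n, (0 < n)%N -> (0 < m n)%N)
    (m_lim : (fun n : nat => n%:R / (m n)%:R : R) @ \oo --> lambda) :
  exists2 astar : R, unique (is_alpha_star sigma lambda) astar &
    let ls := lambda_star lambda in
    let g := g_M sigma lambda astar in
    let M (n : nat) (w : T) : 'M[R]_n :=
      cov_mx (fun ij => X ij w) (m n) n in
    let L (n : nat) (w : T) (k : nat) : \bar R :=
      ((n%:R^-1)%:E * lne (det_coef (M n w) k)%:E)%E in
    [/\ forall a : R, ls < a < 1 -> g a <= 0,
        strictly_concave_on ls 1 g,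
        smooth_on ls 1 g,
        forall a : R, ls < a < 1 ->
          expR (- g^`()%classic a) =
          sigma ^+ 2 * a * (lambda * a + 1 - lambda) / (1 - a) &
        exists2 eps0 : R, 0 < eps0 &
          forall eps : R, 0 < eps -> eps < eps0 ->
            {ae P, forall w : T,
              (fun n : nat =>
                ereal_sup [set `|L n w k - (g (k%:R / n%:R))%:E|%E
                  | k in [set k : nat |
                      (ls + eps) * n%:R <= k%:R <= (1 - eps) * n%:R]])
                @ \oo --> 0%E
              /\
              (fun n : nat =>
                ereal_sup [set L n w k
                  | k in [set k : nat | k%:R <= (ls - eps) * n%:R]])
                @ \oo --> -oo%E}].
Proof.
have [astar astarU] := alpha_star_exists sigma_gt0 lambda_gt0.
have astarP : is_alpha_star sigma lambda astar by case: astarU.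
exists astar => // ls g M L; have ls1 : ls < 1 by exact: lambda_star_lt1.
split.
- by move=> a aI; exact: g_le0.
- exact: g_strictly_concave.
- exact: g_smooth.
- by move=> a aI; exact: g_derive.
exists ((1 - ls) / 4) => [|eps eps0 eps1]; first by rewrite divr_gt0// subr_gt0.
apply: filterS2 (ae_ecoef_le_all sigma_gt0 X_indep X_mean X_var m_gt0)
  (ae_ecoef_ge_all sigma_gt0 X_indep X_idist X_mean X_var m_gt0 m_lim) => w le_w ge_w.
split.
  apply: cvg_ereal_sup0 => tol tol0.
  have [N1 h1] := log_det_coef sigma_gt0 lambda_gt0 m_gt0 m_lim le_w ge_w astarP eps0 tol0.
  have a1 : ls + 2 * eps <= 1 - eps by lra.
  have [N2 h2] := truncn_bulk a1 (lexx _) eps0.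
  exists (maxn N1 N2) => n; rewrite geq_max => /andP[N1n /h2[k1 k2]]; split.
    by exists (Num.truncn ((1 - eps) * n%:R)); apply/andP.
  move=> k /= /andP[lk ku]; have [n0 a0 hk] := h1 n k N1n lk ku.
  exists `|n%:R^-1 * ln (det_coef (M n w) k) - g (k%:R / n%:R)|; last by rewrite normr_ge0.
  by rewrite /L lne_EFin// -EFinM -EFinB abse_EFin.
have [N hN] := det_coef_eq0 (fun ij => X ij w) lambda_gt0 m_lim eps0.
apply: cvg_near_cst; exists N => // n Nn; apply/ereal_sup_ninfty => _ [k ku <-].
have [n0 a0] := hN n k Nn ku.
by rewrite /= /L a0 le0_lneNy// mulrNy gtr0_sg ?mul1e// invr_gt0 ltr0n.
Qed.
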